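(* Let $1<p,q<\infty$, let $L_p$ and $L_q$ (over possibly different measure spaces) be infinite-dimensional, let $X=L_p(L_q)$, and let $r=\min\{p,q\}$. If $r$ is not an even integer, or if $r=p$ is an even integer, then there is no $T^r$-smooth bump function on $X$. If $r=q$ is an even integer, then there is a $T^p$-smooth bump function on $X$ if and only if $p$ and $q$ are both even integers and $p$ is a multiple of $q$; moreover, in this case $X$ admits a separating polynomial.
   Context: $L_p(L_q)$ is the Lebesgue–Bochner space of measurable $u:\Omega\to L_q$ with $(\int_\Omega\|u(s)\|_q^p d\mu)^{1/p}<\infty$. For real $s\ge1$, $f:X\to\mathbb{R}$ is $T^s$-smooth if at every $x$ there is a continuous polynomial $P$ of degree at most $[s]$ with $|f(x+h)-f(x)-P(h)|=o(\|h\|^s)$ as $h\to0$. A bump function is a real-valued function with bounded nonempty support. A separating polynomial is a continuous polynomial $P$ with $P(0)=0$ and $P(x)\ge1$ on the unit sphere.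
   Formalization: ''r = p is an even integer'' in the first clause is read as p even with p < q, since for p = q even (e.g. p = q = 2, a Hilbert space) a T^r-smooth bump exists and the clause would contradict the second one. *)

(* Defs.v *)
From mathcomp Require Import all_boot all_order all_algebra.
From mathcomp Require Import all_classical all_reals all_analysis.
Set Implicit Arguments.
Unset Strict Implicit.
Unset Printing Implicit Defensive.
Import Order.TTheory GRing.Theory Num.Theory numFieldNormedType.Exports.
Local Open Scope classical_set_scope.
Local Open Scope ring_scope.

(** * Generic notions on a (semi)normed space X, given as a subset D of a
    real vector space V (D is the carrier, N the (semi)norm on it). *)
Section Generic.
Variables (R : realType) (V : lmodType R) (D : set V) (N : V -> R).

Definition bounded_multilinear (k : nat) (A : ('I_k -> V) -> R) : Prop :=
  (forall x : 'I_k -> V, (forall j, D (x j)) ->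
     forall (i : 'I_k) (a : R) (y : V), D y ->
       A (fun j => if j == i then a *: x i + y else x j)
       = a * A x + A (fun j => if j == i then y else x j)) /\
  (exists C : R, forall x : 'I_k -> V, (forall j, D (x j)) ->
     `|A x| <= C * \prod_(j < k) N (x j)).

Definition cont_poly (m : nat) (P : V -> R) : Prop :=
  exists A : forall k : nat, ('I_k -> V) -> R,
    (forall k, (k <= m)%N -> bounded_multilinear (A k)) /\
    (forall h, D h -> P h = \sum_(k < m.+1) A k (fun _ => h)).

Definition Tsmooth (s : R) (f : V -> R) : Prop :=
  forall x, D x -> exists (m : nat) (P : V -> R),
    (m%:Z <= Num.floor s) /\ cont_poly m P /\
    (forall eps : R, 0 < eps -> exists delta : R, 0 < delta /\
       forall h, D h -> N h < delta ->
         `|f (x + h) - f x - P h| <= eps * (N h `^ s)).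

Definition bump_function (f : V -> R) : Prop :=
  (exists x, D x /\ f x != 0) /\
  (exists M : R, forall x, D x -> f x != 0 -> N x <= M).

Definition separating_poly (P : V -> R) : Prop :=
  (exists m, cont_poly m P) /\ P 0 = 0 /\
  (forall x, D x -> N x = 1 -> 1 <= P x).

End Generic.

Definition even_int (R : realType) (r : R) : Prop := exists n : nat, r = (2 * n)%:R.

Section Spaces.
Variables (R : realType).

Definition Lq_mem d (T : measurableType d) (nu : {measure set T -> \bar R})
    (q : R) (g : T -> R) : Prop :=
  measurable_fun setT g /\ (Lnorm nu (q%:E) (EFin \o g) < +oo)%E.

Definition Lq_norm d (T : measurableType d) (nu : {measure set T -> \bar R})
    (q : R) (g : T -> R) : R :=
  fine (Lnorm nu (q%:E) (EFin \o g)).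

Definition Lspace_infinite_dim d (T : measurableType d)
    (nu : {measure set T -> \bar R}) (q : R) : Prop :=
  forall n : nat, exists g : 'I_n -> T -> R,
    (forall i, Lq_mem nu q (g i)) /\
    (forall c : 'I_n -> R,
       Lnorm nu (q%:E) (fun t => (\sum_(i < n) c i * g i t)%:E) = 0%E ->
       forall i, c i = 0).

Definition simple_Lq d1 d2 (T1 : measurableType d1) (T2 : measurableType d2)
    (nu : {measure set T2 -> \bar R}) (q : R) (s : T1 -> T2 -> R) : Prop :=
  exists (k : nat) (A : 'I_k -> set T1) (g : 'I_k -> T2 -> R),
    (forall i, measurable (A i)) /\ (forall i, Lq_mem nu q (g i)) /\
    s = (fun w t => \sum_(i < k) \1_(A i) w * g i t).

(** Carrier of L_p(mu; L_q(nu)): strongly measurable L_q-valued functions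
    (pointwise L_q-limits of simple functions) with finite mixed norm *)
Definition LpLq d1 d2 (T1 : measurableType d1) (T2 : measurableType d2)
    (mu : {measure set T1 -> \bar R}) (nu : {measure set T2 -> \bar R})
    (p q : R) (u : T1 -> T2 -> R) : Prop :=
  (forall w, Lq_mem nu q (u w)) /\
  (exists s : nat -> T1 -> T2 -> R, (forall n, simple_Lq nu q (s n)) /\
     forall w, (fun n => Lq_norm nu q (u w - s n w)) @ \oo --> (0 : R)) /\
  (Lnorm mu (p%:E) (fun w => (Lq_norm nu q (u w))%:E) < +oo)%E.

Definition LpLq_norm d1 d2 (T1 : measurableType d1) (T2 : measurableType d2)
    (mu : {measure set T1 -> \bar R}) (nu : {measure set T2 -> \bar R})
    (p q : R) (u : T1 -> T2 -> R) : R :=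
  fine (Lnorm mu (p%:E) (fun w => (Lq_norm nu q (u w))%:E)).

End Spaces.

(* Main.v *)
(** A [T^s]-smooth bump on [X] restricts to one on any isometric copy of a space
    [l_s(E)] inside [X]: [l_p(L_q)] for [s = p], and the scalar [l_q] for [s = q].
    On [l_s(E)] one climbs from a point where the bump [g] is positive, in an order
    in which [g] decreases by at most [e] times the gain of [||x||^s]. At a maximal
    point the Taylor polynomial [P] leaves no room to climb further. Terms of [P] of
    degree [k < s] are negligible on far away rows, since [n] disjoint unit vectors
    have a signed sum of norm [n^(1/s)]. So [s] is an integer [m], and the term of
    degree [m] provides an [m]-homogeneous form on [E] bounded below by [eps > 0] on
    the unit sphere. Then [m] is even, by replacing [h] by [-h]. If [E] is [L_q],
    averaging the form over the unit vectors [n^(-1/q) (e_(1,xi 1) + ... + e_(n,xi n))]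
    of [l_q], for random [xi : 'I_n -> 'I_N], makes it tend to [0] (first [n], then
    [N] large) unless [m] is a multiple of [q].

    Conversely, if [q] is even and [p = k q] then [||u||^p = \int (\int u^q)^k] is a
    polynomial [A(u, ..., u)], and [max(0, 1 - A(u, ..., u))^(p+1)] is a bump. *)

Require Import Defs.
From mathcomp Require Import all_boot all_order all_algebra.
From mathcomp Require Import all_classical all_reals all_analysis.
From mathcomp Require Import measurable_realfun ring lra zify.
Import Order.TTheory GRing.Theory Num.Theory.
Import numFieldNormedType.Exports.
Set Implicit Arguments.
Unset Strict Implicit.
Unset Printing Implicit Defensive.
Local Open Scope classical_set_scope.
Local Open Scope ring_scope.

(** * Multilinear forms *)

(** A Taylor expansion at [x] comes with its own radius [delta], and nothing is uniform in [x], so a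
    step of fixed size cannot be repeated until the support of the bump is left. A maximal point
    replaces the repetition: one step taken there, however small, is already contradictory. The
    price is that increasing sequences must have upper bounds, which is the reason for the doubling
    rule in [row_le]. Forms are controlled by decoupling. Boundedness is tested on sums with
    arbitrary coefficients of modulus at most 1 in each slot, and averaging over signs discards all
    terms except those whose indices satisfy prescribed equalities. The one bound [ml_diag_bound]
    yields both the smallness of low degrees (all indices equal) and the averaging estimate (indices
    equal along the fibres of a map [f]). Functions equal almost everywhere are not identified: each
    space is a subset [D] of a vector space of functions, with a seminorm that may vanish away from
    [0]. *)

Definition upd (I : eqType) (V : Type) (x : I -> V) (i : I) (v : V) : I -> V :=
  fun j => if j == i then v else x j.

Section Update.
Variables (I : eqType) (V : Type).
Implicit Types (x : I -> V) (i : I).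

Lemma upd_upd x i u v : upd (upd x i u) i v = upd x i v.
Proof. by apply/funext => j; rewrite /upd; case: eqP. Qed.

Lemma upd_same x i u : upd x i u i = u.
Proof. by rewrite /upd eqxx. Qed.

Lemma upd_id x i : upd x i (x i) = x.
Proof. by apply/funext => j; rewrite /upd; case: eqP => // ->. Qed.

Lemma upd_in (D : set V) x i v : (forall j, D (x j)) -> D v -> forall j, D (upd x i v j).
Proof. by move=> Dx Dv j; rewrite /upd; case: eqP. Qed.

End Update.

Definition ffupd (I : finType) (T : finType) (f : {ffun I -> T}) (i : I) (u : T)
  : {ffun I -> T} := [ffun j => upd f i u j].

(* Averaging over a coordinate that is overwritten changes nothing: the map
   [(u, f) |-> (f i, f with i := u)] is an involution. *)
Lemma sum_ffupd (R : pzRingType) (I T : finType) (H : {ffun I -> T} -> R) (i : I) :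
  \sum_(f : {ffun I -> T}) \sum_(u : T) H (ffupd f i u) = #|T|%:R * \sum_f H f.
Proof.
rewrite pair_big /=.
pose s (p : {ffun I -> T} * T) := (ffupd p.1 i p.2, p.1 i).
have sK : involutive s.
  move=> [f u]; rewrite /s /= ffunE upd_same; congr pair.
  by apply/ffunP => j; rewrite !ffunE /upd; case: eqP => [->|ji] //; rewrite ffunE /upd; case: eqP.
rewrite (reindex_inj (inv_inj sK)) /=.
rewrite (eq_bigr (fun p : {ffun I -> T} * T => H p.1)); last first.
  move=> [f u] _ /=; congr H.
  by have /(congr1 fst) := sK (f, u).
rewrite -(pair_big xpredT xpredT (fun f _ => H f)) /= exchange_big /=.
by rewrite sumr_const mulr_natl; congr (_ *+ _); apply: eq_card.
Qed.

Record subspace_on (R : realType) (V : lmodType R) (D : set V) : Prop := {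
  sub0 : D 0;
  subL : forall a x y, D x -> D y -> D (a *: x + y)
}.

(** Nonnegativity is asked on all of [V]: [Lq_norm] is the [fine] of a nonnegative extended real
    even off the carrier. The remaining laws hold only on [D], where that extended real is
    finite. *)
Record seminormed_on (R : realType) (V : lmodType R) (D : set V) (N : V -> R) : Prop := {
  sn_subspace :> subspace_on D;
  sn_ge0 : forall x, 0 <= N x;
  snZ : forall a x, D x -> N (a *: x) = `|a| * N x;
  snD : forall x y, D x -> D y -> N (x + y) <= N x + N y
}.

Section Subspace.
Variables (R : realType) (V : lmodType R) (D : set V).
Hypothesis DS : subspace_on D.

Lemma sub_addr x y : D x -> D y -> D (x + y).
Proof. by move=> Dx Dy; rewrite -[x]scale1r; exact: (subL DS). Qed.

Lemma sub_scale a x : D x -> D (a *: x).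
Proof. by move=> Dx; rewrite -[_ *: _]addr0; apply: (subL DS) => //; exact: sub0 DS. Qed.

Lemma sub_opp x : D x -> D (- x).
Proof. by move=> Dx; rewrite -scaleN1r; exact: sub_scale. Qed.

Lemma sub_sub x y : D x -> D y -> D (x - y).
Proof. by move=> Dx Dy; apply: sub_addr => //; exact: sub_opp. Qed.

Lemma sub_sum (I : Type) (r : seq I) (P : pred I) (v : I -> V) :
  (forall i, P i -> D (v i)) -> D (\sum_(i <- r | P i) v i).
Proof.
move=> Dv; elim/big_rec: _ => [|i x Pi Dx]; first exact: sub0 DS.
by apply: sub_addr => //; exact: Dv.
Qed.

End Subspace.

Section Seminormed.
Variables (R : realType) (V : lmodType R) (D : set V) (N : V -> R).
Hypothesis DN : seminormed_on D N.
Let DS : subspace_on D := DN.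

Lemma sn_norm0 : N 0 = 0.
Proof. by have := snZ DN 0 (sub0 DS); rewrite scale0r normr0 mul0r. Qed.

Lemma sn_normN x : D x -> N (- x) = N x.
Proof. by move=> Dx; rewrite -scaleN1r (snZ DN)// normrN1 mul1r. Qed.

Lemma sn_subC x y : D x -> D y -> N (x - y) = N (y - x).
Proof. by move=> Dx Dy; rewrite -opprB sn_normN//; exact: (sub_sub DS). Qed.

Lemma sn_lerB x y : D x -> D y -> N x - N y <= N (x - y).
Proof.
move=> Dx Dy; rewrite lerBlDr; apply: le_trans (snD DN _ _) => //.
  by rewrite subrK.
exact: (sub_sub DS).
Qed.

Lemma sn_distB x y : D x -> D y -> `|N x - N y| <= N (x - y).
Proof.
move=> Dx Dy; rewrite ler_norml sn_lerB// andbT lerNl opprB sn_subC//.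
exact: sn_lerB.
Qed.

End Seminormed.

Section Multilinear.
Variables (R : realType) (V : lmodType R) (D : set V).

Definition multilinear (k : nat) (A : ('I_k -> V) -> R) : Prop :=
  forall x : 'I_k -> V, (forall j, D (x j)) ->
     forall (i : 'I_k) (a : R) (y : V), D y ->
       A (upd x i (a *: x i + y)) = a * A x + A (upd x i y).

Hypothesis DS : subspace_on D.
Variables (k : nat) (A : ('I_k -> V) -> R).
Hypothesis mlA : multilinear A.

Lemma ml_updD x i u v : (forall j, D (x j)) -> D u -> D v ->
  A (upd x i (u + v)) = A (upd x i u) + A (upd x i v).
Proof.
move=> Dx Du Dv; have := mlA (upd_in i Dx Du) i 1 Dv.
by rewrite upd_same scale1r mul1r !upd_upd.
Qed.

Lemma ml_upd0 x i : (forall j, D (x j)) -> A (upd x i 0) = 0.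
Proof.
move=> Dx; have D0 := sub0 DS.
by have := ml_updD i Dx D0 D0; rewrite addr0 => /eqP; rewrite -subr_eq subrr eq_sym => /eqP.
Qed.

Lemma ml_updZ x i a u : (forall j, D (x j)) -> D u ->
  A (upd x i (a *: u)) = a * A (upd x i u).
Proof.
move=> Dx Du; have := mlA (upd_in i Dx Du) i a (sub0 DS).
by rewrite upd_same addr0 !upd_upd ml_upd0// addr0.
Qed.

Lemma ml_upd_sum (T : Type) (r : seq T) (P : pred T) x i (v : T -> V) :
  (forall j, D (x j)) -> (forall t, D (v t)) ->
  A (upd x i (\sum_(t <- r | P t) v t)) = \sum_(t <- r | P t) A (upd x i (v t)).
Proof.
move=> Dx Dv; suff [] : D (\sum_(t <- r | P t) v t) /\
  A (upd x i (\sum_(t <- r | P t) v t)) = \sum_(t <- r | P t) A (upd x i (v t)) by [].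
elim/big_rec2: _ => [|t y z Pt [Dz e]].
  by split; [exact: sub0 DS | exact: ml_upd0].
split; first exact: (sub_addr DS).
by rewrite ml_updD// e.
Qed.

Lemma ml_scale (c : 'I_k -> R) x : (forall j, D (x j)) ->
  A (fun i => c i *: x i) = (\prod_i c i) * A x.
Proof.
move=> Dx.
suff H (j : nat) : (j <= k)%N ->
    A (fun i : 'I_k => if (i < j)%N then c i *: x i else x i) =
    (\prod_(i < k | (i < j)%N) c i) * A x.
  transitivity ((\prod_(i < k | (i < k)%N) c i) * A x).
    by rewrite -H//; congr A; apply/funext => i; rewrite ltn_ord.
  by congr (_ * _); apply: eq_bigl => i; rewrite ltn_ord.
elim: j => [_|j IH jk].
  by rewrite big_pred0_eq mul1r; congr A.
pose i0 := Ordinal jk.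
rewrite (bigD1 i0)//= -mulrA (eq_bigl (fun i : 'I_k => (i < j)%N)); last first.
  by move=> i; rewrite ltnS -val_eqE/= [RHS]ltn_neqAle andbC.
rewrite -IH; last exact: ltnW.
pose y := fun i : 'I_k => if (i < j)%N then c i *: x i else x i.
have Dy i : D (y i) by rewrite /y; case: ifP => // _; exact: (sub_scale DS).
rewrite -[X in _ * A X]/y; have -> : y = upd y i0 (x i0).
  by apply/funext => i; rewrite /upd; case: eqP => // ->; rewrite /y ltnn.
rewrite -ml_updZ//=; congr A; apply/funext => i; rewrite /upd ltnS leq_eqVlt /y -val_eqE/=.
by case: eqP => //= e; have -> : i = i0 by exact: val_inj.
Qed.

(** Slots are expanded one at a time, but always inside a sum over full choice functions [f]. A slot
    not yet expanded ignores its coordinate of [f] and so carries a redundant factor [#|T|]; the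
    point [t0] makes this factor nonzero and lets it be cancelled at the end. *)
Lemma ml_expand (T : finType) (t0 : T) (v : 'I_k -> T -> V) :
  (forall i t, D (v i t)) ->
  A (fun i => \sum_t v i t) = \sum_(f : {ffun 'I_k -> T}) A (fun i => v i (f i)).
Proof.
move=> Dv; pose S i := \sum_t v i t.
have DSi i : D (S i) by exact: (sub_sum DS).
pose H j (f : {ffun 'I_k -> T}) :=
  A (fun i : 'I_k => if (i < j)%N then v i (f i) else S i).
have T0 : #|T|%:R != 0 :> R by rewrite pnatr_eq0 -lt0n; apply/card_gt0P; exists t0.
suff Hj j : (j <= k)%N -> #|T|%:R ^+ j * \sum_f H j f = #|T|%:R ^+ k * A S.
  have /(mulfI (expf_neq0 k T0)) := Hj k (leqnn k).
  rewrite -[A _]/(A S) => <-; apply: eq_bigr => f _; congr A.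
  by apply/funext => i; rewrite ltn_ord.
elim: j => [_|j IH jk].
  rewrite expr0 mul1r (eq_bigr (fun=> A S)) => [|f _]; last by congr A.
  rewrite sumr_const -[LHS]mulr_natl -natrX; congr (_%:R * _).
  by rewrite -[X in (_ ^ X)%N](card_ord k) -card_ffun; apply: eq_card.
rewrite -IH; last exact: ltnW.
rewrite exprSr -mulrA; congr (_ * _).
pose i0 := Ordinal jk.
rewrite -(sum_ffupd _ i0); apply: eq_bigr => f _.
pose y := fun i : 'I_k => if (i < j)%N then v i (f i) else S i.
have -> : H j f = A (upd y i0 (S i0)).
  by congr A; apply/funext => i; rewrite /upd; case: eqP => // ->; rewrite ltnn.
rewrite ml_upd_sum//; last by move=> i; rewrite /y; case: ifP.
apply: eq_bigr => u _; congr A; apply/funext => i.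
rewrite ltnS leq_eqVlt /ffupd ffunE /upd /y -val_eqE /=.
by case: eqP => //= e; have -> : i = i0 by exact: val_inj.
Qed.

End Multilinear.

(** Orthogonality of Rademacher signs: for [s != u], flipping the sign at [s] alone pairs the terms
    off with opposite values. *)
Lemma sum_sign2 (R : realFieldType) (T : finType) (s u : T) :
  \sum_(e : {ffun T -> bool}) (-1) ^+ e s * (-1) ^+ e u
  = 2 ^+ #|T| * (s == u)%:R :> R.
Proof.
case: eqVneq => [->|su].
  rewrite (eq_bigr (fun=> 1)) => [|e _]; last by rewrite -expr2 sqrr_sign.
  rewrite sumr_const mulr1 -natrX; congr (_%:R).
  by rewrite -card_bool -card_ffun; apply: eq_card.
rewrite mulr0; apply: (@mulfI _ 2); first by rewrite pnatr_eq0.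
rewrite mulr0 -[X in X%:R]card_bool -(sum_ffupd _ s) big1// => e _.
rewrite !big_bool /ffupd !ffunE /upd eqxx.
by rewrite eq_sym (negPf su) expr0 expr1 mul1r mulN1r /= addNr.
Qed.

Section Diagonal.
Variables (R : realType) (V : lmodType R) (D : set V).
Hypothesis DS : subspace_on D.
Variables (k : nat) (A : ('I_k -> V) -> R).
Hypothesis mlA : multilinear D A.
Variables (T : finType) (t0 : T) (v : 'I_k -> T -> V) (K : R).
Hypothesis Dv : forall i t, D (v i t).
Hypothesis AK : forall th : 'I_k -> T -> R, (forall i t, `|th i t| <= 1) ->
  `|A (fun i => \sum_t th i t *: v i t)| <= K.

(* Each equality constraint [f a = f b] is produced by averaging over random
   signs attached to the slots [a] and [b]. *)
Lemma ml_diag_bound (L : seq ('I_k * 'I_k)) (th : 'I_k -> T -> R) :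
  (forall i t, `|th i t| <= 1) ->
  `|\sum_(f : {ffun 'I_k -> T} | all (fun p => f p.1 == f p.2) L)
      (\prod_i th i (f i)) * A (fun i => v i (f i))| <= K.
Proof.
elim: L th => [|[a b] L IH] th th1 /=.
  have -> : \sum_(f : {ffun 'I_k -> T}) (\prod_i th i (f i)) * A (fun i => v i (f i))
     = A (fun i => \sum_t th i t *: v i t); last exact: AK.
  rewrite (ml_expand DS mlA t0); last by move=> i t; apply: (sub_scale DS).
  by apply: eq_bigr => f _; rewrite (ml_scale DS mlA).
(* The signs are absorbed into the coefficients, whose moduli stay at most 1. If [a = b] the two
   signs cancel, in accordance with a vacuous constraint. *)
pose the (e : {ffun T -> bool}) i t : R := th i t *
  ((if i == a then (-1) ^+ e t else 1) * (if i == b then (-1) ^+ e t else 1)).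
have the1 e i t : `|the e i t| <= 1.
  rewrite /the !normrM; apply: mulr_ile1 => //.
  by case: ifP => _; case: ifP => _; rewrite ?normr_sign ?normr1 ?mulr1.
have the_prod e (f : {ffun 'I_k -> T}) : \prod_i the e i (f i) =
    (\prod_i th i (f i)) * ((-1) ^+ e (f a) * (-1) ^+ e (f b)).
  rewrite !big_split/=; congr (_ * (_ * _)).
    by rewrite -big_mkcond /= big_pred1_eq.
  by rewrite -big_mkcond /= big_pred1_eq.
have p2 : 0 < 2 ^+ #|T| :> R by rewrite exprn_gt0.
rewrite -(ler_pM2l p2) -{1}(gtr0_norm p2) -normrM.
apply: (@le_trans _ _ (\sum_(e : {ffun T -> bool})
   `|\sum_(f : {ffun 'I_k -> T} | all (fun p => f p.1 == f p.2) L)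
      (\prod_i the e i (f i)) * A (fun i => v i (f i))|)); last first.
  apply: (@le_trans _ _ (\sum_(e : {ffun T -> bool}) K)).
    by apply: ler_sum => e _; exact: IH.
  rewrite sumr_const -[leLHS]mulr_natl -natrX -[X in (X ^ _)%N]card_bool -card_ffun.
  by rewrite le_eqVlt; apply/orP; left; apply/eqP; congr (_%:R * _); apply: eq_card.
apply: le_trans (ler_norm_sum _ _ _); rewrite exchange_big/=.
rewrite le_eqVlt; apply/orP; left; apply/eqP; congr (`|_|).
rewrite mulr_sumr big_mkcond /= [RHS]big_mkcond /=; apply: eq_bigr => f _.
rewrite (eq_bigr (fun e : {ffun T -> bool} => ((\prod_i th i (f i)) * A (fun i => v i (f i))) *
  ((-1) ^+ e (f a) * (-1) ^+ e (f b)))); last by move=> e _; rewrite the_prod mulrAC.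
rewrite -mulr_sumr sum_sign2.
by case: (f a == f b); case: (all _ _) => //=; rewrite ?mulr0 ?mulr1 // mulrC.
Qed.

End Diagonal.

Section Bounded.
Variables (R : realType) (V : lmodType R) (D : set V) (N : V -> R).
Hypothesis DN : seminormed_on D N.

(** Homogeneity reduces to the unit ball, except that a slot of seminorm 0 cannot be normalized.
    Such a slot is divided by arbitrarily small constants instead, which forces the form to
    vanish. *)
Lemma ml_bounded_unit k (A : ('I_k -> V) -> R) (C : R) : multilinear D A ->
  (forall x, (forall j, D (x j)) -> (forall j, N (x j) <= 1) -> `|A x| <= C) ->
  forall x, (forall j, D (x j)) -> `|A x| <= C * \prod_j N (x j).
Proof.
move=> mlA AC x Dx.
have C0 : 0 <= C.
  apply: le_trans (normr_ge0 _) (AC (fun=> 0) _ _) => j; first exact: sub0 DN.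
  by rewrite (sn_norm0 DN).
have H (c : 'I_k -> R) : (forall j, 0 < c j) -> (forall j, N (x j) <= c j) ->
    `|A x| <= C * \prod_j c j.
  move=> c0 xc; pose y j := (c j)^-1 *: x j.
  have Dy j : D (y j) by exact: (sub_scale DN).
  have -> : x = (fun j => c j *: y j).
    by apply/funext => j; rewrite /y scalerA divff ?scale1r// gt_eqF.
  rewrite (ml_scale DN mlA)// normrM mulrC ler_pM// ?AC//.
    move=> j; rewrite (snZ DN)// gtr0_norm ?invr_gt0// ler_pdivrMl//.
    by rewrite mulr1.
  by rewrite ger0_norm// prodr_ge0// => j _; exact: ltW.
have [/existsP[j0 /eqP j0P]|/existsPn N0] := boolP [exists j, N (x j) == 0]; last first.
  by apply: H => // j; rewrite lt_def N0 (sn_ge0 DN).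
rewrite (bigD1 j0)//= j0P mul0r mulr0.
apply/ler_addgt0Pl => e e0; rewrite addr0.
(* [P] is the product of the weights of the other slots; the weight [e / (C * P + 1)] at [j0] then
   brings the whole bound below [e]. *)
pose P := \prod_(j | j != j0) (N (x j) + 1).
have P0 : 0 < P.
  by apply: prodr_gt0 => j _; rewrite ltr_wpDl// (sn_ge0 DN).
have CP : 0 < C * P + 1 by rewrite ltr_wpDl// mulr_ge0// ltW.
apply: le_trans (H (fun j => if j == j0 then e / (C * P + 1) else N (x j) + 1) _ _) _.
- move=> j; case: ifP => _; first by rewrite divr_gt0.
  by rewrite ltr_wpDl// (sn_ge0 DN).
- move=> j; case: eqP => [->|_]; last by rewrite lerDl.
  by rewrite j0P divr_ge0// ltW.
rewrite (bigD1 j0)//= eqxx (eq_bigr (fun j => N (x j) + 1)); last first.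
  by move=> j /negPf->.
rewrite -/P mulrCA -mulrA -[leRHS]mulr1 ler_pM2l//.
by rewrite mulrC ler_pdivrMr// mul1r lerDl.
Qed.

Lemma bounded_multilinearE k (A : ('I_k -> V) -> R) : bounded_multilinear D N A <->
  multilinear D A /\ exists C, 0 <= C /\
    forall x, (forall j, D (x j)) -> `|A x| <= C * \prod_j N (x j).
Proof.
split=> [[mlA [C AC]]|[mlA [C [_ AC]]]]; split => //; last by exists C.
exists `|C|; split => // x Dx; apply: le_trans (AC _ Dx) _.
by rewrite ler_wpM2r ?ler_norm// prodr_ge0// => j _; exact: (sn_ge0 DN).
Qed.

End Bounded.

(** * Spaces of [s]-summable sequences *)

Lemma powR_nat_unbounded (R : realType) (e M : R) : 0 < e ->
  exists n0 : nat, (0 < n0)%N /\ forall n, (n0 <= n)%N -> M < n%:R `^ e.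
Proof.
move=> e0; exists (Num.truncn (`|M| `^ e^-1)).+1; split => // n le_n.
apply: le_lt_trans (ler_norm M) _.
rewrite -[X in X < _](powRr1 (normr_ge0 M)) -[X in _ `^ X < _](mulVf (lt0r_neq0 e0)) powRrM.
apply: gt0_ltr_powR => //; rewrite ?nnegrE ?powR_ge0 ?ler0n//.
by apply: lt_le_trans (truncnS_gt _) _; rewrite ler_nat.
Qed.

Section SequenceSpace.
Variables (R : realType) (E : lmodType R) (DE : set E) (nE : E -> R).
Hypothesis SE : seminormed_on DE nE.
Variable s : R.
Hypothesis s0 : 0 < s.
Implicit Types x y : nat -> E.

Definition seq_psum x (n : nat) : R := \sum_(i < n) nE (x i) `^ s.

Definition seq_dom : set (nat -> E) := [set x |
  (forall i, DE (x i)) /\ exists M, forall n, seq_psum x n <= M].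

Definition seq_sum x : R := limn (seq_psum x).

Definition seq_norm x : R := seq_sum x `^ s^-1.

Definition seq_row (i : nat) (v : E) : nat -> E := upd (fun=> 0) i v.

Lemma seq_psumS x n : seq_psum x n.+1 = seq_psum x n + nE (x n) `^ s.
Proof. by rewrite /seq_psum big_ord_recr. Qed.

Lemma nondecreasing_seq_psum x : nondecreasing_seq (seq_psum x).
Proof.
by apply/nondecreasing_seqP => n; rewrite seq_psumS lerDl powR_ge0.
Qed.

Lemma is_cvg_seq_psum x : seq_dom x -> cvgn (seq_psum x).
Proof.
move=> [_ [M xM]]; apply: nondecreasing_is_cvgn; first exact: nondecreasing_seq_psum.
by exists M => _ [n _ <-].
Qed.

Lemma seq_psum_le x n : seq_dom x -> seq_psum x n <= seq_sum x.
Proof.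
move=> Dx; apply: nondecreasing_cvgn_le; first exact: nondecreasing_seq_psum.
exact: is_cvg_seq_psum.
Qed.

Lemma seq_sum_le x M : seq_dom x -> (forall n, seq_psum x n <= M) -> seq_sum x <= M.
Proof.
by move=> Dx xM; apply: limr_le; [exact: is_cvg_seq_psum | exact: nearW].
Qed.

Lemma seq_sum_ge0 x : seq_dom x -> 0 <= seq_sum x.
Proof. by move=> Dx; have := seq_psum_le 0 Dx; rewrite /seq_psum big_ord0. Qed.

Lemma seq_term_le x i : seq_dom x -> nE (x i) `^ s <= seq_sum x.
Proof.
move=> Dx; apply: le_trans (seq_psum_le i.+1 Dx); rewrite seq_psumS lerDr.
by apply: sumr_ge0 => j _; exact: powR_ge0.
Qed.

Lemma seq_tail x e : seq_dom x -> 0 < e -> exists n0 : nat,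
  forall i, (n0 <= i)%N -> nE (x i) < e.
Proof.
move=> Dx e0; have es0 : 0 < e `^ s by exact: powR_gt0.
have /cvgrPdist_lt/(_ _ es0)[n0 _ H] := is_cvg_seq_psum Dx.
exists n0 => i le_i; have {H} := H i le_i; rewrite -/(seq_sum x) => H.
rewrite ltNge; apply/negP => ei; move: H.
rewrite ger0_norm ?subr_ge0 ?seq_psum_le// ltrBlDr; apply/negP; rewrite -leNgt.
apply: le_trans (seq_psum_le i.+1 Dx); rewrite seq_psumS addrC lerD2l.
by rewrite ge0_ler_powR ?nnegrE ?(sn_ge0 SE)// ltW.
Qed.

Lemma seq_sum_shift x y d n0 : seq_dom x -> (forall i, DE (y i)) ->
  (forall n, (n0 <= n)%N -> seq_psum y n = seq_psum x n + d) ->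
  seq_dom y /\ seq_sum y = seq_sum x + d.
Proof.
move=> Dx Dy e.
have cy : seq_psum y n @[n --> \oo] --> seq_sum x + d.
  have : seq_psum x n + d @[n --> \oo] --> seq_sum x + d.
    by apply: cvgD; [exact: is_cvg_seq_psum | exact: cvg_cst].
  by apply: cvg_trans; apply: near_eq_cvg; exists n0 => // n /= /e ->.
split; last exact: cvg_lim.
split => //; exists (seq_sum x + d) => n.
rewrite -(cvg_lim _ cy)//; apply: nondecreasing_cvgn_le; first exact: nondecreasing_seq_psum.
by apply/cvg_ex; exists (seq_sum x + d).
Qed.

Lemma seq_sum_upd x i v : seq_dom x -> DE v ->
  seq_dom (upd x i v) /\
  seq_sum (upd x i v) = seq_sum x + (nE v `^ s - nE (x i) `^ s).
Proof.
move=> Dx Dv; apply: (@seq_sum_shift _ _ _ i.+1) => //.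
  by apply: upd_in => //; case: Dx.
move=> n lt_in; rewrite /seq_psum (bigD1 (Ordinal lt_in))//=.
rewrite [in RHS](bigD1 (Ordinal lt_in))//= upd_same.
rewrite (eq_bigr (fun j : 'I_n => nE (x j) `^ s)).
  set X := \sum_(_ < _ | _) _; ring.
by move=> j; rewrite -val_eqE /= /upd => /negPf ->.
Qed.

Lemma nE0 : nE 0 = 0. Proof. exact: sn_norm0 SE. Qed.

Lemma seq_dom0 : seq_dom (fun=> 0) /\ seq_sum (fun=> 0) = 0.
Proof.
have p n : seq_psum (fun=> 0) n = 0.
  by rewrite /seq_psum big1// => i _; rewrite nE0 powR0 ?gt_eqF.
split; last by apply/cvg_lim => //; rewrite (_ : seq_psum _ = fun=> 0);
  [exact: cvg_cst | exact/funext].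
by split => [i|]; [exact: sub0 SE | exists 0 => n; rewrite p].
Qed.

(** The induction carries along that the partial sum vanishes in the rows not yet used, so that
    adding a row there is an update of a zero entry. *)
Lemma seq_row_sum (T : eqType) (r : seq T) (iota : T -> nat) (h : T -> E) :
  uniq r -> injective iota -> (forall t, DE (h t)) ->
  seq_dom (\sum_(t <- r) seq_row (iota t) (h t)) /\
  seq_sum (\sum_(t <- r) seq_row (iota t) (h t)) = \sum_(t <- r) nE (h t) `^ s.
Proof.
move=> + ii Dh.
suff H : uniq r -> [/\ seq_dom (\sum_(t <- r) seq_row (iota t) (h t)),
    seq_sum (\sum_(t <- r) seq_row (iota t) (h t)) = \sum_(t <- r) nE (h t) `^ s &
    forall t, t \notin r -> (\sum_(t <- r) seq_row (iota t) (h t)) (iota t) = 0].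
  by move=> /H[].
elim: r => [_|a r IH /= /andP[ar ur]].
  by rewrite !big_nil; have [? ?] := seq_dom0.
have [Dr Sr zr] := IH ur.
have -> : \sum_(t <- a :: r) seq_row (iota t) (h t) =
    upd (\sum_(t <- r) seq_row (iota t) (h t)) (iota a) (h a).
  rewrite big_cons; apply/funext => i; rewrite fctE /seq_row /upd.
  by case: eqP => [->|_]; rewrite ?zr ?addr0 ?add0r.
have [Da Sa] := seq_sum_upd (iota a) Dr (Dh a).
split => //.
  by rewrite Sa Sr zr// nE0 powR0 ?gt_eqF// subr0 big_cons addrC.
move=> t; rewrite in_cons negb_or => /andP[ta tr].
by rewrite /upd (inj_eq ii) (negPf ta) zr.
Qed.

Lemma seq_row_dom i v : DE v -> seq_dom (seq_row i v) /\
  seq_sum (seq_row i v) = nE v `^ s.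
Proof.
move=> Dv; have [D0 S0] := seq_dom0; have [? ->] := seq_sum_upd i D0 Dv; split => //.
by rewrite S0 nE0 powR0 ?gt_eqF// subr0 add0r.
Qed.

Lemma seq_norm_row i v : DE v -> seq_norm (seq_row i v) = nE v.
Proof.
move=> Dv; rewrite /seq_norm; have [_ ->] := seq_row_dom i Dv.
by rewrite -powRrM divff ?gt_eqF// powRr1// (sn_ge0 SE).
Qed.

Lemma seq_rowZ i a v : seq_row i (a *: v) = a *: seq_row i v.
Proof. by apply/funext => j; rewrite /seq_row /upd fctE; case: eqP => //; rewrite scaler0. Qed.

Lemma seq_rowD i u v : seq_row i (u + v) = seq_row i u + seq_row i v.
Proof. by apply/funext => j; rewrite /seq_row /upd fctE; case: eqP => //; rewrite addr0. Qed.

Lemma seq_dom_le C x y : 0 <= C -> seq_dom x -> (forall i, DE (y i)) ->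
  (forall i, nE (y i) `^ s <= C * nE (x i) `^ s) ->
  seq_dom y /\ seq_sum y <= C * seq_sum x.
Proof.
move=> C0 Dx Dy yx.
have H n : seq_psum y n <= C * seq_sum x.
  apply: le_trans (ler_wpM2l C0 (seq_psum_le n Dx)); rewrite mulr_sumr.
  exact: ler_sum.
have Dy' : seq_dom y by split => //; exists (C * seq_sum x).
by split => //; exact: seq_sum_le.
Qed.

(** Both terms are compared with the larger one. The estimate is crude but valid for every [s > 0],
    and it closes [seq_dom] under sums. *)
Lemma powR_addr_le (a b : R) : 0 <= a -> 0 <= b ->
  (a + b) `^ s <= 2 `^ s * (a `^ s + b `^ s).
Proof.
move=> a0 b0; wlog ab : a b a0 b0 / a <= b.
  by move=> H; case: (leP a b) => ab; [exact: H | rewrite addrC (addrC (a `^ s)) H// ltW].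
apply: (@le_trans _ _ ((2 * b) `^ s)).
  by apply: ge0_ler_powR; rewrite ?nnegrE ?addr_ge0 ?mulr_ge0 ?(ltW s0)// mulr_natl mulr2n lerD2r.
by rewrite powRM// ler_pM2l ?powR_gt0// lerDr powR_ge0.
Qed.

Lemma seq_dom_subspace : subspace_on seq_dom.
Proof.
split; first by case: seq_dom0.
move=> a x y [Dx [M1 xM]] [Dy [M2 yM]]; split.
  by move=> i; rewrite !fctE; exact: (subL SE).
exists (2 `^ s * (`|a| `^ s * M1 + M2)) => n.
apply: (@le_trans _ _ (2 `^ s * (`|a| `^ s * seq_psum x n + seq_psum y n))).
  rewrite /seq_psum mulr_sumr -big_split/= mulr_sumr; apply: ler_sum => i _.
  rewrite !fctE -powRM ?(sn_ge0 SE)//.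
  apply: le_trans (powR_addr_le _ _); rewrite ?mulr_ge0 ?(sn_ge0 SE)//.
  apply: ge0_ler_powR; rewrite ?nnegrE ?addr_ge0 ?mulr_ge0 ?(sn_ge0 SE) ?(ltW s0)//.
  rewrite -(snZ SE)//; apply: (snD SE) => //; exact: (sub_scale SE).
by rewrite ler_pM2l ?powR_gt0// lerD// ler_wpM2l// powR_ge0.
Qed.

Lemma seq_norm_ge0 x : 0 <= seq_norm x. Proof. exact: powR_ge0. Qed.

Lemma seq_norm_powR x : seq_dom x -> seq_norm x `^ s = seq_sum x.
Proof.
by move=> Dx; rewrite /seq_norm -powRrM mulVf ?gt_eqF// powRr1// seq_sum_ge0.
Qed.

(* The [k]-homogeneous form is summed diagonally over [n] disjoint unit vectors,
   whose signed sums have norm [n^(1/s)]. *)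
Lemma seq_form_row_sum k (A : ('I_k.+1 -> nat -> E) -> R) (C : R) (h : nat -> E) (n i0 : nat) :
  multilinear seq_dom A -> 0 <= C ->
  (forall x : 'I_k.+1 -> nat -> E, (forall j, seq_dom (x j)) -> `|A x| <= C * \prod_j seq_norm (x j)) ->
  (forall i, DE (h i)) -> (forall i, nE (h i) <= 1) -> (0 < n)%N ->
  \sum_(i < n) `|A (fun=> seq_row (i0 + i) (h (i0 + i)%N))| <=
    C * (n%:R `^ s^-1) ^+ k.+1.
Proof.
move=> mlA C0 AC Dh h1 n0.
pose v (j : 'I_k.+1) (i : 'I_n) := seq_row (i0 + i) (h (i0 + i)%N).
have Dv j i : seq_dom (v j i) by have [] := seq_row_dom (i0 + i) (Dh (i0 + i)%N).
(* These constraints force [f] to be constant. The signs [sg], put in slot [0] only, turn the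
   surviving diagonal terms into absolute values. *)
pose L := [seq (ord0 : 'I_k.+1, j) | j <- enum 'I_k.+1].
pose sg (i : 'I_n) := Num.sg (A (fun=> v ord0 i)).
pose th (j : 'I_k.+1) (i : 'I_n) : R := if j == ord0 then sg i else 1.
have th1 j i : `|th j i| <= 1.
  by rewrite /th; case: ifP => _; rewrite ?normr1// /sg normr_sg lern1 leq_b1.
have := @ml_diag_bound _ _ _ seq_dom_subspace _ _ mlA _ (Ordinal n0) v
  (C * (n%:R `^ s^-1) ^+ k.+1) Dv _ L th th1.
rewrite (_ : \sum_(_ | _) _ = \sum_(i < n) `|A (fun=> v ord0 i)|); last first.
  rewrite (reindex (fun i : 'I_n => [ffun _ : 'I_k.+1 => i])); last first.
    exists (fun f : {ffun 'I_k.+1 -> 'I_n} => f ord0) => [i _|f]; first by rewrite ffunE.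
    rewrite inE => /allP fL; apply/ffunP => j; rewrite ffunE.
    have /fL /= /eqP // : (ord0 : 'I_k.+1, j) \in L.
    by apply/mapP; exists j => //; rewrite mem_enum.
  apply: eq_big => [i|i _]; first by apply/allP => -[a b] _; rewrite !ffunE /=.
  rewrite (bigD1 ord0)//= big1 ?mulr1; last by move=> j /negPf j0; rewrite /th j0.
  rewrite ffunE /th eqxx (_ : A _ = A (fun=> v ord0 i)); first by rewrite /sg -normrEsg.
  by congr A; apply/funext => j; rewrite ffunE.
move=> H; rewrite -[leLHS]ger0_norm; last exact: sumr_ge0.
apply: H => th' th'1.
have Dw j : forall i : 'I_n, DE (th' j i *: h (i0 + i)%N).
  by move=> i; exact: (sub_scale SE).
have ii : injective (fun i : 'I_n => (i0 + i)%N).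
  by move=> i j /eqP; rewrite eqn_add2l => /eqP/val_inj.
have DS j := seq_row_sum (index_enum_uniq _) ii (Dw j).
have e j : \sum_t th' j t *: v j t =
    \sum_(t < n) seq_row (i0 + t) (th' j t *: h (i0 + t)%N).
  by apply: eq_bigr => t _; rewrite seq_rowZ.
apply: le_trans (AC _ _) _; first by move=> j; rewrite e; case: (DS j).
rewrite ler_wpM2l// -[X in _ ^+ X]card_ord -prodr_const; apply: ler_prod => j _.
rewrite seq_norm_ge0 /seq_norm e; have [D1 ->] := DS j.
apply: ge0_ler_powR; rewrite ?invr_ge0 ?nnegrE ?(ltW s0)//.
  by apply: sumr_ge0 => i _; exact: powR_ge0.
rewrite -[X in X%:R]card_ord -sumr_const; apply: ler_sum => i _.
apply: (@le_trans _ _ (1 `^ s)); last by rewrite powR1.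
apply: ge0_ler_powR; rewrite ?nnegrE ?(sn_ge0 SE) ?(ltW s0)//.
by rewrite (snZ SE)// mulr_ile1// (sn_ge0 SE).
Qed.

End SequenceSpace.

(** * Separating forms on [l_s] *)

Section Counting.

(** A map with at most [k] values factors through an enumeration of its image, padded to length [k]:
    there are [n ^ k] lists of values and [k ^ m] ways to point into them. *)
Lemma card_small_image (m n k : nat) : (0 < n)%N ->
  (#|[pred f : {ffun 'I_m -> 'I_n} | #|codom f| <= k]| <= n ^ k * k ^ m)%N.
Proof.
case: n => // n _.
pose comp (p : {ffun 'I_k -> 'I_n.+1} * {ffun 'I_m -> 'I_k}) : {ffun 'I_m -> 'I_n.+1} :=
  [ffun i => p.1 (p.2 i)].
apply: (@leq_trans #|codom comp|); last first.
  by apply: leq_trans (leq_image_card _ _) _; rewrite card_prod !card_ffun !card_ord.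
apply: subset_leq_card; apply/fintype.subsetP => f; rewrite inE => fk.
pose B := enum (codom f).
have fB i : f i \in B by rewrite mem_enum; apply: codom_f.
have ik i : (index (f i) B < k)%N by rewrite (leq_trans _ fk)// cardE index_mem.
apply/codomP; exists ([ffun j : 'I_k => nth ord0 B j], [ffun i => Ordinal (ik i)]).
by apply/ffunP => i; rewrite !ffunE /= nth_index.
Qed.

(** The tuples [xi o f] are exactly those constant on the fibres of [f]. Each of them comes from
    [N ^ (n - #|codom f|)] maps [xi], which are prescribed on the image of [f] and free
    elsewhere. *)
Lemma sum_ffun_comp (R : pzRingType) (m n N : nat) (f : {ffun 'I_m -> 'I_n})
    (F : {ffun 'I_m -> 'I_N} -> R) :
  \sum_(xi : {ffun 'I_n -> 'I_N}) F [ffun i => xi (f i)] =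
  N%:R ^+ (n - #|codom f|) *
  \sum_(t : {ffun 'I_m -> 'I_N} | [forall i, forall j, (f i == f j) ==> (t i == t j)]) F t.
Proof.
pose P (t : {ffun 'I_m -> 'I_N}) := [forall i, forall j, (f i == f j) ==> (t i == t j)].
pose c (xi : {ffun 'I_n -> 'I_N}) : {ffun 'I_m -> 'I_N} := [ffun i => xi (f i)].
rewrite (partition_big c P) => [|xi _]; last first.
  by apply/forallP => i; apply/forallP => j; apply/implyP => /eqP e; rewrite !ffunE e.
rewrite mulr_sumr; apply: eq_bigr => t Pt.
rewrite (eq_bigr (fun=> F t)); last by move=> xi /andP[_ /eqP e]; congr F; exact: e.
rewrite sumr_const -[LHS]mulr_natl -natrX; congr (_%:R * _).
pose G (g : 'I_n) : pred 'I_N := if [pick i | f i == g] is Some i then pred1 (t i) else predT.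
have fG xi : (xi \in family G) = (c xi == t).
  apply/familyP/eqP => [xiG|e g].
    apply/ffunP => i; rewrite ffunE; have := xiG (f i); rewrite /G.
    case: pickP => [j fji|/(_ i)]; last by rewrite eqxx.
    rewrite inE => /eqP ->.
    by have /forallP/(_ j)/forallP/(_ i)/implyP/(_ fji)/eqP := Pt.
  by rewrite /G; case: pickP => // i /eqP <-; rewrite inE -e ffunE.
transitivity #|family G|; first by apply: eq_card => xi; rewrite fG.
rewrite card_family foldrE big_map enumT.
rewrite (eq_bigr (fun g => if g \in codom f then 1 else N)%N); last first.
  move=> g _; rewrite /G; case: pickP => [i /eqP <-|fg].
    by rewrite codom_f// card1.
  case: codomP => [[i e]|_]; first by have := fg i; rewrite e eqxx.
  by rewrite -[RHS]card_ord; apply: eq_card.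
rewrite (eq_bigr (fun g => if g \notin codom f then N else 1)%N); last first.
  by move=> g _; case: ifP.
rewrite -big_mkcond /= prod_nat_const; congr (_ ^ _)%N.
by have := cardC (mem (codom f)); rewrite card_ord => /(congr1 (subn^~ #|codom f|)) /=; rewrite addKn.
Qed.

End Counting.

(** * Averaging a form over random unit vectors of [l_s] *)

Section Separating.
Variables (R : realType) (E : lmodType R) (DE : set E) (nE : E -> R).
Hypothesis SE : seminormed_on DE nE.
Variable s : R.
Hypothesis s0 : 0 < s.
Variable e0 : E.
Hypotheses (De0 : DE e0) (ne0 : nE e0 = 1).

Section Average.
Variables (m : nat) (A : ('I_m -> nat -> E) -> R) (C : R).
Hypothesis mlA : multilinear (seq_dom DE nE s) A.
Hypothesis C0 : 0 <= C.
Hypothesis AC : forall x : 'I_m -> nat -> E, (forall j, seq_dom DE nE s (x j)) ->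
  `|A x| <= C * \prod_j seq_norm nE s (x j).
Variables (n N : nat) (n0 : (0 < n)%N) (N0 : (0 < N)%N).

(** [pickle] gives each pair its own row, so the vectors [w p] are disjoint, and [c] makes the sum
    of any [n] of them a unit vector. *)
Let c : R := n%:R `^ (- s^-1).
Let w (p : 'I_n * 'I_N) : nat -> E := seq_row (pickle p) (c *: e0).
Let Dce : DE (c *: e0). Proof. exact: (sub_scale SE). Qed.
Let nce : nE (c *: e0) = c.
Proof. by rewrite (snZ SE)// ne0 mulr1 ger0_norm// powR_ge0. Qed.
Let Dw p : seq_dom DE nE s (w p).
Proof. by have [] := seq_row_dom SE s0 (pickle p) Dce. Qed.
Let nr : (0 : R) < n%:R. Proof. by rewrite ltr0n. Qed.
Let cs : c `^ s = n%:R^-1.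
Proof. by rewrite /c -powRrM mulNr mulVf ?gt_eqF// powR_inv1. Qed.

Let x (xi : {ffun 'I_n -> 'I_N}) : nat -> E := \sum_(g < n) w (g, xi g).

Let x_unit xi : seq_dom DE nE s (x xi) /\ seq_norm nE s (x xi) = 1.
Proof.
have ii : injective (fun g : 'I_n => pickle (g, xi g)).
  by move=> g g' /(pcan_inj pickleK)[].
have [D1 S1] := seq_row_sum SE s0 (index_enum_uniq _) ii (fun=> Dce).
split => //; rewrite /seq_norm S1 (eq_bigr (fun=> c `^ s)) => [|i _]; last by rewrite nce.
rewrite sumr_const card_ord cs (_ : _^-1 *+ n = 1) ?powR1//.
by rewrite -[LHS]mulr_natl divff ?gt_eqF.
Qed.

(** The bound with [1] is the triangle inequality. For the other, grouping the [xi] by [t = xi o f]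
    leaves a sum over the [t] constant on the fibres of [f], which [ml_diag_bound] controls: each
    slot then holds [N] disjoint vectors of norm at most [c], of total norm at most [c N^(1/s)]. The
    factor [N^(n - l)], with [l] the number of values of [f], counts the [xi] above one [t]. *)
Lemma average_bound (f : {ffun 'I_m -> 'I_n}) :
  `|\sum_(xi : {ffun 'I_n -> 'I_N}) A (fun i => w (f i, xi (f i)))| <=
  N%:R ^+ n * (C * n%:R `^ (- (m%:R / s)) *
    Num.min 1 (N%:R `^ (m%:R / s - #|codom f|%:R))).
Proof.
have cm : c ^+ m = n%:R `^ (- (m%:R / s)).
  by rewrite -powR_mulrn ?powR_ge0// /c -powRrM mulNr mulrC.
have Nr : (0 : R) < N%:R by rewrite ltr0n.
rewrite minr_pMr ?mulr_ge0 ?powR_ge0// minr_pMr ?exprn_ge0// le_min mulr1; apply/andP; split.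
  apply: le_trans (ler_norm_sum _ _ _) _.
  apply: (@le_trans _ _ (\sum_(xi : {ffun 'I_n -> 'I_N}) C * c ^+ m)).
    apply: ler_sum => xi _; apply: le_trans (AC _) _ => //.
    rewrite (eq_bigr (fun=> c)); first by rewrite prodr_const card_ord.
    by move=> i _; rewrite (seq_norm_row SE s0)// nce.
  rewrite sumr_const cm -[leLHS]mulr_natl -natrX.
  rewrite le_eqVlt; apply/orP; left; apply/eqP; congr (_%:R * _).
  by rewrite -[X in (X ^ _)%N](card_ord N) -[X in (_ ^ X)%N](card_ord n) -card_ffun; apply: eq_card.
have l_n : (#|codom f| <= n)%N by rewrite -[leqRHS]card_ord max_card.
have := sum_ffun_comp f (fun t => A (fun i => w (f i, t i))).
under eq_bigr do under eq_fun do rewrite ffunE.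
move=> ->; rewrite normrM ger0_norm ?exprn_ge0//.
have -> : N%:R ^+ n * (C * n%:R `^ (- (m%:R / s)) * N%:R `^ (m%:R / s - #|codom f|%:R)) =
    N%:R ^+ (n - #|codom f|) * (C * (c * N%:R `^ s^-1) ^+ m).
  rewrite exprMn cm -[(N%:R `^ _) ^+ m]powR_mulrn ?powR_ge0// -powRrM.
  rewrite powRB; last by apply/implyP => _; rewrite gt_eqF.
  rewrite powR_mulrn// (mulrC s^-1).
  have -> : N%:R ^+ n = N%:R ^+ (n - #|codom f|) * N%:R ^+ #|codom f| :> R.
    by rewrite -exprD subnK.
  have Nl : N%:R ^+ #|codom f| != 0 :> R by rewrite expf_neq0 ?gt_eqF.
  by field.
rewrite ler_pM2l ?exprn_gt0//.
pose v (i : 'I_m) (t : 'I_N) := w (f i, t).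
pose L := [seq p <- enum {: 'I_m * 'I_m} | f p.1 == f p.2].
have AK (th : 'I_m -> 'I_N -> R) : (forall i t, `|th i t| <= 1) ->
    `|A (fun i => \sum_t th i t *: v i t)| <= C * (c * N%:R `^ s^-1) ^+ m.
  move=> th1.
  have Dh i t : DE (th i t *: (c *: e0)) by exact: (sub_scale SE).
  have ii i : injective (fun t : 'I_N => pickle (f i, t)).
    by move=> t t' /(pcan_inj pickleK)[].
  have DS i := seq_row_sum SE s0 (index_enum_uniq _) (ii i) (Dh i).
  have e i : \sum_t th i t *: v i t =
     \sum_t seq_row (pickle (f i, t)) (th i t *: (c *: e0)).
    by apply: eq_bigr => t _; rewrite seq_rowZ.
  apply: le_trans (AC _) _; first by move=> i; rewrite e; case: (DS i).
  rewrite ler_wpM2l// -[X in _ ^+ X]card_ord -prodr_const; apply: ler_prod => i _.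
  rewrite seq_norm_ge0 /seq_norm e; have [D1 ->] := DS i.
  have -> : c * N%:R `^ s^-1 = (N%:R * c `^ s) `^ s^-1.
    by rewrite powRM ?powR_ge0// -powRrM divff ?gt_eqF// powRr1 ?powR_ge0// mulrC.
  apply: ge0_ler_powR; rewrite ?invr_ge0 ?nnegrE ?(ltW s0) ?mulr_ge0 ?powR_ge0//.
    by apply: sumr_ge0 => t _; exact: powR_ge0.
  rewrite -[X in X%:R * _]card_ord mulr_natl -sumr_const; apply: ler_sum => t _.
  apply: ge0_ler_powR; rewrite ?nnegrE ?(sn_ge0 SE) ?(ltW s0) ?powR_ge0//.
  by rewrite (snZ SE)// nce -[leRHS]mul1r ler_wpM2r// powR_ge0.
have := @ml_diag_bound _ _ _ (seq_dom_subspace SE s0) _ _ mlA _ (Ordinal N0) v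
  _ (fun i t => Dw (f i, t)) AK L (fun=> fun=> 1) _.
rewrite (_ : \sum_(_ | all _ _) _ = \sum_(t : {ffun 'I_m -> 'I_N} |
   [forall i, forall j, (f i == f j) ==> (t i == t j)]) A (fun i => w (f i, t i))).
  by apply => i t; rewrite normr1.
apply: eq_big => [t|t _]; last by rewrite big1 ?mul1r.
apply/allP/forallP => [tL i|tP [i j]].
  apply/forallP => j; apply/implyP => fij; apply: (tL (i, j)).
  by rewrite mem_filter /= fij mem_enum.
by rewrite mem_filter /= => /andP[fij _]; have /forallP/(_ j)/implyP := tP i; exact.
Qed.

(** The lower bound is summed over all [xi], and each [x xi] is expanded in the [m] slots;
    exchanging the sums leaves, for each [f], the quantity estimated in [average_bound]. *)
Lemma average_lower eps :
  (forall y, seq_dom DE nE s y -> seq_norm nE s y = 1 -> eps <= A (fun=> y)) ->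
  eps <= \sum_(f : {ffun 'I_m -> 'I_n}) (C * n%:R `^ (- (m%:R / s)) *
    Num.min 1 (N%:R `^ (m%:R / s - #|codom f|%:R))).
Proof.
move=> Aeps; have Nn : (0 : R) < N%:R ^+ n by rewrite exprn_gt0// ltr0n.
rewrite -(ler_pM2l Nn) mulr_sumr.
apply: (@le_trans _ _ (\sum_(xi : {ffun 'I_n -> 'I_N}) A (fun=> x xi))).
  apply: (@le_trans _ _ (\sum_(xi : {ffun 'I_n -> 'I_N}) eps)).
    rewrite sumr_const -[leRHS]mulr_natl -natrX.
    rewrite le_eqVlt; apply/orP; left; apply/eqP; congr (_%:R * _).
    by rewrite -[X in (X ^ _)%N](card_ord N) -[X in (_ ^ X)%N](card_ord n) -card_ffun;
       apply: eq_card.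
  by apply: ler_sum => xi _; have [? ?] := x_unit xi; exact: Aeps.
under eq_bigr do rewrite (ml_expand (seq_dom_subspace SE s0) mlA (Ordinal n0)) ?Dw//.
rewrite exchange_big/=; apply: ler_sum => f _.
exact: le_trans (ler_norm _) (average_bound f).
Qed.

End Average.

(* With [l] the number of values of [f], the contribution of the [f] with [l < m/s]
   is [O(n^(l - m/s))], and for fixed [n] that of the [f] with [l > m/s] tends to 0
   as [N] grows: only [l = m/s] could survive. *)
Lemma separating_form_ratio (m : nat) (A : ('I_m -> nat -> E) -> R) (eps : R) :
  bounded_multilinear (seq_dom DE nE s) (seq_norm nE s) A -> 0 < eps ->
  (forall y, seq_dom DE nE s y -> seq_norm nE s y = 1 -> eps <= A (fun=> y)) ->
  exists k : nat, m%:R = k%:R * s.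
Proof.
move=> [mlA [C' AC']] eps0 Aeps; apply: contrapT => noint.
pose C : R := `|C'|.
have AC (x : 'I_m -> nat -> E) : (forall j, seq_dom DE nE s (x j)) ->
    `|A x| <= C * \prod_j seq_norm nE s (x j).
  move=> Dx; apply: le_trans (AC' _ Dx) _; rewrite ler_wpM2r ?ler_norm//.
  by apply: prodr_ge0 => j _; exact: seq_norm_ge0.
have C0 : 0 <= C by exact: normr_ge0.
pose a := m%:R / s; pose k := Num.truncn a.
have a0 : 0 <= a by rewrite divr_ge0// ltW.
have /andP[ka aS] := truncn_itv a0.
(* Since [m] is not an integer multiple of [s], the ratio [a] lies strictly between [k] and
   [k + 1]. *)
have {}ka : k%:R < a.
  rewrite lt_neqAle ka andbT; apply/eqP => e; apply: noint; exists k.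
  by rewrite -/k in e; rewrite e /a -mulrA mulVf ?mulr1// gt_eqF.
pose K : R := (k ^ m)%:R.
have ak : 0 < a - k%:R by rewrite subr_gt0.
have ak1 : 0 < k.+1%:R - a by rewrite subr_gt0.
(* [n] makes the at most [n ^ k * k ^ m] maps with few values contribute less than [eps / 2]. Then
   [N], which depends on [n], does the same for the others, of which there are at most [n ^ m]. *)
have [n [n0 /(_ n (leqnn n)) Hn]] := powR_nat_unbounded (C * K * 2 / eps) ak.
have [N [N0 /(_ N (leqnn N)) HN]] := powR_nat_unbounded (n%:R ^+ m * C * 2 / eps) ak1.
have nr : (0 : R) < n%:R by rewrite ltr0n.
have Nr : (0 : R) < N%:R by rewrite ltr0n.
have := average_lower mlA C0 AC n0 N0 Aeps.
apply/negP; rewrite -ltNge (bigID (fun f : {ffun 'I_m -> 'I_n} => (#|codom f| <= k)%N))/=.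
rewrite [ltRHS](splitr eps) -/a; apply: ltrD.
- apply: (@le_lt_trans _ _ (\sum_(f : {ffun 'I_m -> 'I_n} | (#|codom f| <= k)%N)
    C * n%:R `^ (- a))).
    by apply: ler_sum => f _; rewrite -[leRHS]mulr1 ler_wpM2l ?mulr_ge0 ?powR_ge0//.
  rewrite sumr_const -[ltLHS]mulr_natl.
  apply: (@le_lt_trans _ _ ((n ^ k * k ^ m)%:R * (C * n%:R `^ (- a)))).
    rewrite ler_wpM2r ?mulr_ge0 ?powR_ge0// ler_nat.
    apply: leq_trans (@card_small_image m n k n0); rewrite leq_eqVlt; apply/orP; left.
    by apply/eqP; apply: eq_card => f; rewrite inE.
  rewrite natrM -/K natrX -powR_mulrn//.
  have -> : n%:R `^ k%:R * K * (C * n%:R `^ (- a)) = (C * K) * n%:R `^ (- (a - k%:R)).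
    rewrite opprB powRD; last by apply/implyP => _; rewrite gt_eqF.
    by ring.
  rewrite powRN ltr_pdivrMr ?powR_gt0//.
  move: Hn; rewrite ltr_pdivrMr// => Hn.
  by rewrite mulrAC ltr_pdivlMr// mulrC [ltRHS]mulrC mulrC.
- apply: (@le_lt_trans _ _ (\sum_(f : {ffun 'I_m -> 'I_n})
    C * N%:R `^ (a - k.+1%:R))).
    rewrite [leRHS](bigID (fun f : {ffun 'I_m -> 'I_n} => (#|codom f| <= k)%N))/=.
    apply: ler_wpDl; first by apply: sumr_ge0 => f _; rewrite mulr_ge0 ?powR_ge0.
    apply: ler_sum => f; rewrite -ltnNge => kf; rewrite -mulrA ler_wpM2l//.
    apply: (@le_trans _ _ (1 * N%:R `^ (a - #|codom f|%:R))).
      apply: ler_pM; rewrite ?powR_ge0 ?le_min ?ler01 ?powR_ge0//.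
        rewrite -[leRHS](powRr0 n%:R) ler_powR ?ler1n// oppr_le0//.
      by rewrite ge_min lexx orbT.
    by rewrite mul1r ler_powR ?ler1n// lerD2l lerN2 ler_nat.
  rewrite sumr_const -[ltLHS]mulr_natl card_ffun !card_ord natrX -opprB powRN.
  rewrite mulrA ltr_pdivrMr ?powR_gt0//.
  move: HN; rewrite ltr_pdivrMr// => HN.
  by rewrite mulrAC ltr_pdivlMr// mulrC [ltRHS]mulrC mulrC.
Qed.

End Separating.

(** * Smooth bumps on [l_s(E)] *)

(** The Brezis-Browder ordering principle. The [n]-th step comes within [1 / (n + 1)] of the
    supremum of [phi] above the current point, so above an upper bound of the whole sequence nothing
    is left to gain. Only countable chains need upper bounds, and maximality is measured by
    [phi]. *)
Lemma exists_maximal (R : realType) (T : Type) (le : T -> T -> Prop) (P : T -> Prop)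
    (phi : T -> R) (B : R) (x0 : T) :
  (forall x, le x x) -> (forall x y z, le x y -> le y z -> le x z) ->
  (forall x y, P x -> P y -> le x y -> phi x <= phi y) ->
  (forall x, P x -> phi x <= B) -> P x0 ->
  (forall u : nat -> T, (forall n, P (u n)) -> (forall n, le (u n) (u n.+1)) ->
    exists y, P y /\ forall n, le (u n) y) ->
  exists x, P x /\ forall y, P y -> le x y -> phi y <= phi x.
Proof.
move=> refl trans mono bnd Px0 chain.
pose U x : set R := [set phi z | z in [set z | P z /\ le x z]].
have hU x : P x -> has_sup (U x).
  move=> Px; split; first by exists (phi x), x.
  by exists B => _ [z [Pz _] <-]; exact: bnd.
have next (xn : T * nat) : exists y, P xn.1 ->
    [/\ P y, le xn.1 y & sup (U xn.1) - xn.2.+1%:R^-1 < phi y].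
  case: xn => x n /=; have [Px|nPx] := pselect (P x); last by exists x.
  have n0 : (0 : R) < n.+1%:R^-1 by rewrite invr_gt0.
  have [_ [y [Py xy] <-] ylt] := sup_adherent n0 (hU x Px).
  by exists y.
have [f fP] := choice next.
pose u := fix u n := if n is n'.+1 then f (u n', n') else x0.
have Pu n : P (u n) by elim: n => //= n IH; have [] := fP (u n, n) IH.
have uS n : le (u n) (u n.+1) by have [] := fP (u n, n) (Pu n).
have [y [Py uy]] := chain u Pu uS.
exists y; split => // z Pz yz; apply/ler_addgt0Pr => e e0.
have [n [n0 /(_ n (leqnn n)) Hn]] := powR_nat_unbounded e^-1 (ltr01 : 0 < 1 :> R).
rewrite powRr1// in Hn.
have [_ _ /= H] := fP (u n, n) (Pu n).
have uz : phi z <= sup (U (u n)).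
  by apply: sup_upper_bound; [exact: hU | exists z => //; split => //; exact: trans (uy n) yz].
apply: le_trans uz _; rewrite ltrBlDr in H; apply: le_trans (ltW H) _.
apply: lerD; first exact: (mono _ _ (Pu n.+1) Py (uy n.+1)).
rewrite -[leRHS]invrK lef_pV2 ?posrE ?invr_gt0// (le_trans (ltW Hn))//.
by rewrite ler_nat.
Qed.

Section LowerDegree.
Variables (R : realType) (E : lmodType R) (DE : set E) (nE : E -> R).
Hypothesis SE : seminormed_on DE nE.
Variable s : R.
Hypothesis s0 : 0 < s.
Notation D := (seq_dom DE nE s).
Notation N := (seq_norm nE s).

(** If the sum stayed above [del] in every row from [i0] on, then [n] rows would contribute at least
    [n * del]. By [seq_form_row_sum], a degree [k + 1 < s] contributes at most a multiple of
    [n ^ ((k + 1) / s)], which grows more slowly than [n]. *)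
Lemma exists_small_lower_forms (m : nat) (A : forall k, ('I_k -> nat -> E) -> R)
    (h : nat -> E) (c del : R) (i0 : nat) :
  (forall k, (k <= m)%N -> bounded_multilinear D N (A k)) ->
  (forall i, DE (h i)) -> (forall i, nE (h i) <= 1) -> 0 < c -> 0 < del ->
  exists i, (i0 <= i)%N /\
    \sum_(k < m | k.+1%:R < s) c ^+ k.+1 * `|A k.+1 (fun=> seq_row i (h i))| < del.
Proof.
move=> bA Dh h1 c0 del0; apply: contrapT => Hno.
have {}Hno i : (i0 <= i)%N ->
    del <= \sum_(k < m | k.+1%:R < s) c ^+ k.+1 * `|A k.+1 (fun=> seq_row i (h i))|.
  by move=> ii; rewrite leNgt; apply/negP => lt; apply: Hno; exists i.
have /choice[C CP] (k : 'I_m) : exists C, 0 <= C /\ forall n, (0 < n)%N ->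
    \sum_(i < n) `|A k.+1 (fun=> seq_row (i0 + i) (h (i0 + i)%N))|
    <= C * (n%:R `^ s^-1) ^+ k.+1.
  have [mlA [C' AC']] := bA k.+1 (ltn_ord k).
  exists `|C'|; split => // n n0; apply: (seq_form_row_sum SE s0 (C := `|C'|) i0 mlA) => // x Dx.
  apply: le_trans (AC' _ Dx) _; rewrite ler_wpM2r ?ler_norm//.
  by apply: prodr_ge0 => j _; exact: seq_norm_ge0.
(* The largest exponent that occurs; the default [0] covers the case where no degree lies below
   [s]. *)
pose th : R := \big[Num.max/0]_(k < m | k.+1%:R < s) (k.+1%:R / s).
have th1 : th < 1.
  by apply: bigmax_lt => // k ks; rewrite ltr_pdivrMr// mul1r.
have thk (k : 'I_m) : k.+1%:R < s -> k.+1%:R / s <= th.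
  by move=> ks; apply: (@le_bigmax_cond _ _ _ _ k (fun k : 'I_m => k.+1%:R < s)
    (fun k : 'I_m => k.+1%:R / s)).
pose Ct := \sum_(k < m | k.+1%:R < s) c ^+ k.+1 * C k.
have [n [n0 /(_ n (leqnn n)) Hn]] : exists n : nat, (0 < n)%N /\
    forall k, (n <= k)%N -> Ct / del < k%:R `^ (1 - th).
  by apply: powR_nat_unbounded; rewrite subr_gt0.
have nr : (0 : R) < n%:R by rewrite ltr0n.
have : n%:R * del <= Ct * n%:R `^ th.
  apply: (@le_trans _ _ (\sum_(i < n) \sum_(k < m | k.+1%:R < s)
      c ^+ k.+1 * `|A k.+1 (fun=> seq_row (i0 + i) (h (i0 + i)%N))|)).
    rewrite -[n in n%:R]card_ord mulr_natl -sumr_const; apply: ler_sum => i _.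
    by apply: Hno; rewrite leq_addr.
  rewrite exchange_big/= mulr_suml; apply: ler_sum => k ks.
  rewrite -mulr_sumr -mulrA ler_wpM2l ?exprn_ge0 ?(ltW c0)//.
  have [C0 H] := CP k; apply: le_trans (H n n0) _; rewrite ler_wpM2l//.
  rewrite -powR_mulrn ?powR_ge0// -powRrM ler_powR ?ler1n//.
  by rewrite mulrC thk.
apply/negP; rewrite -ltNge.
move: Hn; rewrite ltr_pdivrMr// => Hn.
have -> : n%:R * del = n%:R `^ (1 - th) * del * n%:R `^ th.
  rewrite mulrAC -powRD ?subrK ?powRr1// ?ler0n//.
  by apply/implyP => _; rewrite gt_eqF.
by rewrite ltr_pM2r ?powR_gt0.
Qed.

End LowerDegree.

Section SmoothBasics.
Variables (R : realType) (V : lmodType R) (D : set V) (N : V -> R).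
Hypothesis DS : subspace_on D.
Hypothesis N0 : forall x, 0 <= N x.

(** Forms of positive degree vanish at [0], so [P 0 = 0] removes the constant term; each remaining
    part is [O(N h)] on the unit ball. *)
Lemma cont_poly_bound (m : nat) (P : V -> R) : N 0 = 0 -> cont_poly D N m P -> P 0 = 0 ->
  exists C, 0 <= C /\ forall h, D h -> N h <= 1 -> `|P h| <= C * N h.
Proof.
move=> N00 [A [bA PA]] P0.
have /choice[C CP] (k : 'I_m.+1) : exists C, 0 <= C /\
    forall h, D h -> `|A k (fun=> h)| <= C * N h ^+ k.
  have [_ [C AC]] := bA k (ltn_ord k : (k <= m)%N).
  exists `|C|; split => // h Dh; apply: le_trans (AC (fun=> h) (fun=> Dh)) _.
  rewrite prodr_const card_ord ler_wpM2r ?ler_norm// exprn_ge0//.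
exists (\sum_k C k); split; first by apply: sumr_ge0 => k _; case: (CP k).
move=> h Dh h1; have A0 : A 0%N (fun=> h) = 0.
  rewrite -P0 (PA _ (sub0 DS)) big_ord_recl/= [X in _ + X]big1 ?addr0.
    by congr (A 0%N); apply/funext; case.
  move=> k _; apply/eqP; rewrite -normr_le0.
  have [_ H] := CP (lift ord0 k); apply: le_trans (H 0 (sub0 DS)) _.
  by rewrite N00 expr0n /= mulr0.
rewrite (PA _ Dh) big_ord_recl /= A0 add0r (le_trans (ler_norm_sum _ _ _))//.
rewrite mulr_suml [leRHS]big_ord_recl /= ler_wpDl//.
  by rewrite mulr_ge0//; case: (CP ord0).
apply: ler_sum => k _; have [C0 H] := CP (lift ord0 k).
apply: le_trans (H h Dh) _; rewrite ler_wpM2l// exprS.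
by rewrite -[leRHS]mulr1 ler_wpM2l// exprn_ile1.
Qed.

Lemma Tsmooth_opp s (f : V -> R) : Tsmooth D N s f -> Tsmooth D N s (fun x => - f x).
Proof.
move=> fs x Dx; have [m [P [ms [[A [bA PA]] H]]]] := fs x Dx.
exists m, (fun h => - P h); split => //; split.
  exists (fun k y => - A k y); split => [k km|h Dh].
    have [mlA [C AC]] := bA k km; split.
      by move=> y Dy i a z Dz; rewrite mlA// opprD mulrN.
    by exists C => y Dy; rewrite normrN; exact: AC.
  by rewrite sumrN -PA.
move=> e e0; have [d [d0 Hd]] := H e e0; exists d; split => // h Dh hd.
have -> : - f (x + h) - - f x - - P h = - (f (x + h) - f x - P h) by ring.
by rewrite normrN; exact: Hd.
Qed.

Lemma Tsmooth_continuous s (f : V -> R) x : N 0 = 0 -> 0 < s -> Tsmooth D N s f -> D x ->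
  forall e, 0 < e -> exists2 d, 0 < d & forall h, D h -> N h < d -> `|f (x + h) - f x| < e.
Proof.
move=> N00 s0 fs Dx e e0; have [m [P [_ [cP H]]]] := fs x Dx.
have e30 : 0 < e / 3 by rewrite divr_gt0.
have [d [d0 Hd]] := H _ e30.
have P0 : P 0 = 0.
  have := Hd 0 (sub0 DS); rewrite N00 addr0 subrr sub0r powR0 ?gt_eqF// mulr0.
  by move=> /(_ d0); rewrite normrN normr_le0 => /eqP.
have [C [C0 HC]] := cont_poly_bound N00 cP P0.
have eC : 0 < (e / 3) / (C + 1) by rewrite divr_gt0// ltr_wpDl.
exists (Num.min d (Num.min 1 ((e / 3) / (C + 1)))); first by rewrite !lt_min d0 ltr01.
move=> h Dh; rewrite !lt_min => /and3P[hd h1 hC].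
have := Hd h Dh hd; have := HC h Dh (ltW h1) => H1 H2.
have h3 : C * N h <= e / 3.
  move: hC; rewrite ltr_pdivlMr ?ltr_wpDl// => hC.
  apply: le_trans (ltW hC); rewrite mulrC ler_wpM2l//.
  by rewrite lerDl.
have h4 : e / 3 * N h `^ s <= e / 3.
  rewrite -[leRHS]mulr1 ler_wpM2l ?(ltW e30)//.
  have := ge0_ler_powR (ltW s0) (N0 h) (ler01 : 0 <= 1 :> R) (ltW h1).
  by rewrite powR1.
rewrite -(subrK (P h) (f _ - _)) (le_lt_trans (ler_normD _ _))//.
apply: le_lt_trans (lerD (le_trans H2 h4) (le_trans H1 h3)) _.
by lra.
Qed.

End SmoothBasics.

Lemma eventually_uniform (n : nat) (Q : 'I_n -> nat -> Prop) :
  (forall i, exists n0, forall m, (n0 <= m)%N -> Q i m) ->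
  exists n0, forall m, (n0 <= m)%N -> forall i, Q i m.
Proof.
move=> /choice[f fP]; exists (\max_i f i)%N => m mm i.
by apply: fP; rewrite (leq_trans _ mm)// leq_bigmax.
Qed.

(** * Climbing in [l_s(E)] to a maximal point *)

Section Bump.
Variables (R : realType) (E : lmodType R) (DE : set E) (nE : E -> R).
Hypothesis SE : seminormed_on DE nE.
Variable s : R.
Hypothesis s0 : 0 < s.
Notation D := (seq_dom DE nE s).
Notation N := (seq_norm nE s).
Notation S := (seq_sum nE s).
Implicit Types x y : nat -> E.

Lemma seq_norm0 : N 0 = 0.
Proof.
rewrite /seq_norm; have [_ ->] := seq_dom0 SE s0.
by rewrite powR0 ?gt_eqF ?invr_gt0.
Qed.

(* The jump in norm forces a bounded increasing sequence to be eventually constant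
   in each row, so that no completeness of [E] is needed. *)
Definition row_le (a b : E) := b = a \/ (2 * nE a <= nE b /\ 0 < nE b).

Lemma row_le_norm a b : row_le a b -> nE a <= nE b.
Proof.
by move=> [->//|[ab b0]]; have := sn_ge0 SE a; lra.
Qed.

Lemma row_le_trans a b c : row_le a b -> row_le b c -> row_le a c.
Proof.
move=> [->//|[ab b0]] [->|[bc c0]]; first by right.
by right; split => //; have := sn_ge0 SE a; lra.
Qed.

(** Once the norm exceeds half of its supremum, another doubling would exceed the supremum itself.
    If the supremum is [0], the clause [0 < nE b] of [row_le] excludes any jump. *)
Lemma row_stable (u : nat -> E) M : (forall n, row_le (u n) (u n.+1)) ->
  (forall n, nE (u n) <= M) ->
  exists n0, forall n, (n0 <= n)%N -> u n = u n0.
Proof.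
move=> uS uM; pose L := sup [set nE (u n) | n in [set: nat]].
have hL : has_sup [set nE (u n) | n in [set: nat]].
  by split; [exists (nE (u 0%N)), 0%N | exists M => _ [n _ <-]].
have uL n : nE (u n) <= L by apply: sup_upper_bound => //; exists n.
have mono n m : (n <= m)%N -> nE (u n) <= nE (u m).
  move=> /subnKC <-; elim: (m - n)%N => [|k IH]; first by rewrite addn0.
  by rewrite addnS (le_trans IH)// row_le_norm.
suff [n0 H] : exists n0, forall n, (n0 <= n)%N -> u n.+1 = u n.
  exists n0 => n /subnKC <-; elim: (n - n0)%N => [|k IH]; first by rewrite addn0.
  by rewrite addnS H ?leq_addr.
have [L0|L0] := leP L 0.
  exists 0%N => n _; case: (uS n) => [//|[_ H]].
  by have := le_lt_trans (le_trans (uL n.+1) L0) H; rewrite ltxx.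
have [_ [n0 _ <-] Hn] := @sup_adherent _ _ (L / 2) (divr_gt0 L0 (ltr0Sn _ 1)) hL.
exists n0 => n nn; case: (uS n) => // -[H _].
have {}Hn : L / 2 < nE (u n0) by rewrite (le_lt_trans _ Hn)// lerBrDr -splitr.
have : L < 2 * nE (u n).
  by rewrite mulrC -ltr_pdivrMr// (lt_le_trans Hn)// mono.
by rewrite ltNge (le_trans H).
Qed.

(** After a doubling, [3 / 2] bounds the ratio of [nE (b - a)] to [nE b], and [1 - 2^-s] is the
    least fraction of [nE b ^ s] that has been gained. *)
Let K : R := (3 / 2) `^ s / (1 - (2^-1) `^ s).

Let half_s : (2^-1 : R) `^ s < 1.
Proof.
apply: (@lt_le_trans _ _ (1 `^ s)); last by rewrite powR1.
by apply: gt0_ltr_powR; rewrite ?nnegrE//; lra.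
Qed.

Let K0 : 0 <= K.
Proof. by rewrite divr_ge0 ?powR_ge0// subr_ge0 ltW. Qed.

Lemma row_le_dist a b : DE a -> DE b -> row_le a b ->
  nE (b - a) `^ s <= K * (nE b `^ s - nE a `^ s).
Proof.
move=> Da Db [->|[ab b0]].
  by rewrite !subrr mulr0 (sn_norm0 SE) powR0// gt_eqF.
have na := sn_ge0 SE a; have nb := sn_ge0 SE b.
have h1 : nE (b - a) `^ s <= (3 / 2) `^ s * nE b `^ s.
  rewrite -powRM//; apply: ge0_ler_powR; rewrite ?nnegrE ?(sn_ge0 SE) ?(ltW s0)//.
    by rewrite mulr_ge0.
  apply: le_trans (snD SE _ _) _ => //; first exact: (sub_opp SE).
  rewrite (sn_normN SE)//; lra.
have h2 : nE a `^ s <= (2^-1) `^ s * nE b `^ s.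
  rewrite -powRM//; apply: ge0_ler_powR; rewrite ?nnegrE ?(sn_ge0 SE) ?(ltW s0)//.
    by rewrite mulr_ge0.
  lra.
apply: le_trans h1 _; rewrite /K -mulrA ler_wpM2l ?powR_ge0//.
rewrite ler_pdivlMl ?subr_gt0// mulrBl mul1r lerD2l.
by rewrite lerN2.
Qed.

(** Along an increasing sequence this turns convergence of the sums [S] into convergence in norm,
    the form in which continuity of [g] can be used. *)
Lemma seq_sum_dist x y : D x -> D y -> (forall i, row_le (x i) (y i)) ->
  D (y - x) /\ S (y - x) <= K * (S y - S x).
Proof.
move=> Dx Dy xy; have Dyx := sub_sub (seq_dom_subspace SE s0) Dy Dx.
split => //; apply: (seq_sum_le Dyx) => n.
apply: (@le_trans _ _ (K * (seq_psum nE s y n - seq_psum nE s x n))).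
  rewrite /seq_psum -sumrB mulr_sumr; apply: ler_sum => i _; rewrite !fctE.
  by apply: row_le_dist => //; [case: Dx | case: Dy].
rewrite ler_wpM2l//.
have cyx : seq_psum nE s y k - seq_psum nE s x k @[k --> \oo] --> S y - S x.
  by apply: cvgB; [exact: (is_cvg_seq_psum Dy) | exact: (is_cvg_seq_psum Dx)].
rewrite -(cvg_lim _ cyx)//; apply: (@nondecreasing_cvgn_le _ (seq_psum nE s y - seq_psum nE s x)).
  apply/nondecreasing_seqP => k; rewrite -subr_ge0.
  rewrite [leRHS](_ : _ = nE (y k) `^ s - nE (x k) `^ s); last by rewrite !fctE !seq_psumS; ring.
  rewrite subr_ge0; apply: ge0_ler_powR; rewrite ?nnegrE ?(sn_ge0 SE) ?(ltW s0)//.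
  exact: row_le_norm.
by apply/cvg_ex; exists (S y - S x).
Qed.

Lemma seq_sum_mono x y : D x -> D y -> (forall i, row_le (x i) (y i)) -> S x <= S y.
Proof.
move=> Dx Dy xy; rewrite -[leRHS]mul1r; apply: (seq_dom_le _ Dy _ _).2 => // [|i].
  by case: Dx.
rewrite mul1r; apply: ge0_ler_powR; rewrite ?nnegrE ?(sn_ge0 SE) ?(ltW s0)//.
exact: row_le_norm.
Qed.

Section Order.
Variables (g : (nat -> E) -> R) (e : R).
Hypothesis gcont : forall x, D x -> forall r, 0 < r ->
  exists2 d, 0 < d & forall h, D h -> N h < d -> `|g (x + h) - g x| < r.

(** An order of Ekeland type: the permitted losses of [g] telescope along a chain, whence
    transitivity. *)
Definition bump_le x y := (forall i, row_le (x i) (y i)) /\ g x - e * (S y - S x) <= g y.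

Lemma bump_le_refl x : bump_le x x.
Proof. by split => [i|]; [left | rewrite subrr mulr0 subr0]. Qed.

Lemma bump_le_trans x y z : bump_le x y -> bump_le y z -> bump_le x z.
Proof.
move=> [xy gxy] [yz gyz]; split => [i|]; first exact: row_le_trans (xy i) (yz i).
apply: le_trans gyz; rewrite -lerBlDr opprK in gxy *.
by apply: le_trans gxy; rewrite le_eqVlt; apply/orP; left; apply/eqP; ring.
Qed.

(** The bound [y] collects the final values of the rows, which exist by [row_stable]. Each partial
    sum of [y] is eventually that of [u n]; hence [S y <= B] and [S (u n)] tends to [S y]. By
    [seq_sum_dist] the [u n] then tend to [y] in norm, and continuity of [g] carries the inequality
    on [g] to the limit. *)
Lemma bump_le_chain (u : nat -> nat -> E) B : 0 <= e ->
  (forall n, D (u n)) -> (forall n, S (u n) <= B) -> (forall n, bump_le (u n) (u n.+1)) ->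
  exists y, [/\ D y, S y <= B & forall n, bump_le (u n) y].
Proof.
move=> e0 Du uB uS.
have B0 : 0 <= B by apply: le_trans (uB 0%N); apply: seq_sum_ge0.
have uu n m : (n <= m)%N -> bump_le (u n) (u m).
  move=> /subnKC <-; elim: (m - n)%N => [|k IH]; first by rewrite addn0; exact: bump_le_refl.
  by rewrite addnS; exact: bump_le_trans IH (uS _).
have /choice[k kP] i : exists n0, forall n, (n0 <= n)%N -> u n i = u n0 i.
  apply: (@row_stable (fun n => u n i) (B `^ s^-1)) => [n|n]; first by case: (uS n).
  have -> : nE (u n i) = (nE (u n i) `^ s) `^ s^-1.
    by rewrite -powRrM divff ?gt_eqF// powRr1// (sn_ge0 SE).
  apply: ge0_ler_powR; rewrite ?invr_ge0 ?nnegrE ?powR_ge0 ?(ltW s0)//.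
  by apply: le_trans (uB n); apply: seq_term_le.
pose y : nat -> E := fun i => u (k i) i.
have uy n i : row_le (u n i) (y i).
  have -> : y i = u (maxn n (k i)) i by rewrite /y (kP i)// leq_maxr.
  by have [] := uu _ _ (leq_maxl n (k i)).
have psumE j : exists n0, forall n, (n0 <= n)%N ->
    seq_psum nE s y j = seq_psum nE s (u n) j.
  have [|n0 H] := @eventually_uniform j (fun i n => u n i = y i).
    by move=> i; exists (k i); exact: kP.
  by exists n0 => n nn; apply: eq_bigr => i _; rewrite H.
have yB j : seq_psum nE s y j <= B.
  have [n0 /(_ n0 (leqnn _)) ->] := psumE j.
  by apply: le_trans (uB n0); apply: seq_psum_le.
have Dy : D y.
  by split; [move=> i; rewrite /y; case: (Du (k i)) => + _; exact | exists B].
have Suy r : 0 < r -> exists n0, forall n, (n0 <= n)%N -> S y - S (u n) < r.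
  move=> r0; have /cvgrPdist_lt/(_ _ r0)[j _ /(_ j (leqnn j))] := is_cvg_seq_psum Dy.
  rewrite -/(S y) => Hj; have [n0 H] := psumE j; exists n0 => n nn.
  apply: le_lt_trans (le_lt_trans (ler_norm _) Hj); rewrite lerD2l lerN2 (H n nn).
  exact: seq_psum_le.
exists y; split => //; first exact: (seq_sum_le Dy yB).
move=> n; split => //; apply/ler_addgt0Pr => r r0.
have [d d0 Hd] := gcont Dy r0.
have ds0 : 0 < d `^ s / (K + 1) by rewrite divr_gt0 ?powR_gt0// ltr_wpDl.
have [n0 Hn0] := Suy _ ds0.
pose m := maxn n n0.
have [Dum Sum] := seq_sum_dist (Du m) Dy (uy m).
have Dmy : D (u m - y) by rewrite -opprB; exact: (sub_opp (seq_dom_subspace SE s0)).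
have Nm : N (u m - y) < d.
  have -> : N (u m - y) = N (y - u m).
    rewrite /seq_norm /seq_sum; congr (limn _ `^ _); apply/funext => j.
    apply: eq_bigr => i _; rewrite !fctE (sn_subC SE)//; first by case: (Du m).
    by case: Dy.
  rewrite /seq_norm.
  have -> : d = (d `^ s) `^ s^-1 by rewrite -powRrM divff ?gt_eqF// powRr1 ?ltW.
  apply: gt0_ltr_powR; rewrite ?invr_gt0 ?nnegrE ?powR_ge0 ?(seq_sum_ge0 Dum)//.
  apply: le_lt_trans Sum _.
  have := Hn0 m (leq_maxr _ _); rewrite ltr_pdivlMr ?ltr_wpDl//.
  apply: le_lt_trans; rewrite mulrC ler_wpM2l ?lerDl//.
  by rewrite subr_ge0; exact: seq_sum_mono.
have := Hd _ Dmy Nm; rewrite (addrC y) subrK => Hg.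
have [_ H1] := uu _ _ (leq_maxl n n0); rewrite -/m in H1.
have H2 : S (u m) <= S y by exact: seq_sum_mono.
apply: (@le_trans _ _ (g (u m))).
  apply: le_trans H1; rewrite lerD2l lerN2 ler_wpM2l//.
  by rewrite lerD2r.
by rewrite -lerBlDl (le_trans (ler_norm _))// ltW.
Qed.

End Order.

Variable e0 : E.
Hypotheses (De0 : DE e0) (ne0 : nE e0 = 1).

(** The radius [d] is chosen before the row: it depends only on the Taylor expansion at [x]. The row
    and the direction are then chosen so that the Taylor polynomial is almost nonnegative on that
    vector. *)
Lemma smooth_good_step (g : (nat -> E) -> R) x eta :
  Tsmooth D N s g ->
  (forall (m : nat) (A : ('I_m -> E) -> R) (eps : R), s = m%:R ->
     bounded_multilinear DE nE A -> 0 < eps ->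
     exists h, [/\ DE h, nE h = 1 & A (fun=> h) < eps]) ->
  D x -> 0 < eta ->
  exists2 d, 0 < d & forall c i0, 0 < c -> c < d ->
    exists i h, [/\ (i0 <= i)%N, DE h, nE h = 1 &
      g x - eta * c `^ s <= g (x + seq_row i (c *: h))].
Proof.
move=> gs Hno Dx eta0; have [m [P [ms [[A [bA PA]] H]]]] := gs x Dx.
(* Of the allowed loss, [eta / 2] goes to the Taylor remainder, [eta / 4] to the degrees below [s]
   and [eta / 4] to the degree equal to [s]. *)
have eta2 : 0 < eta / 2 by rewrite divr_gt0.
have eta4 : 0 < eta / 4 by rewrite divr_gt0.
have [d [d0 Hd]] := H _ eta2.
exists d => // c i0 c0 cd.
have D0 := (seq_dom0 SE s0).1.
have A0 h : D h -> A 0%N (fun=> h) = 0.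
  move=> Dh; have := Hd 0 D0; rewrite seq_norm0 addr0 subrr sub0r powR0 ?gt_eqF// mulr0.
  move=> /(_ d0); rewrite normrN normr_le0 (PA _ D0) big_ord_recl/= big1 ?addr0.
    by move=> /eqP <-; congr (A 0%N); apply/funext; case.
  move=> k _; have [mlA [C AC]] := bA k.+1 (ltn_ord k).
  apply/eqP; rewrite -normr_le0; apply: le_trans (AC _ (fun=> D0)) _.
  by rewrite prodr_const card_ord seq_norm0 expr0n /= mulr0.
have msR : m%:R <= s.
  have := ge_floor s; apply: le_trans; rewrite -(ler_int R) in ms; exact: ms.
(* Restricted to one row, the part of degree [m] is a form on [E]. If [s = m], the hypothesis
   applied to its opposite gives a unit vector where it is at least [- eta / 4]; otherwise any unit
   vector will do. *)
have top i : exists h, [/\ DE h, nE h = 1 &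
    s = m%:R -> - A m (fun=> seq_row i h) < eta / 4].
  have [sm|sm] := pselect (s = m%:R); last by exists e0; split.
  pose B (y : 'I_m -> E) := - A m (fun j => seq_row i (y j)).
  have [mlA [C AC]] := bA m (leqnn m).
  have bB : bounded_multilinear DE nE B.
    split.
      move=> y Dy j a z Dz; rewrite /B mulrN -opprD; congr (- _).
      have Dr v : DE v -> D (seq_row i v) by move=> Dv; have [] := seq_row_dom SE s0 i Dv.
      have := mlA _ (fun t => Dr _ (Dy t)) j a _ (Dr _ Dz).
      rewrite (_ : (fun _ => _) = (fun t => seq_row i (if t == j then a *: y j + z else y t))).
        by move=> ->; congr (_ + A m _); apply/funext => t; case: ifP.
      by apply/funext => t; case: ifP => // _; rewrite seq_rowD seq_rowZ.
    exists C => y Dy; rewrite normrN; apply: le_trans (AC _ _) _.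
      by move=> t; have [] := seq_row_dom SE s0 i (Dy t).
    rewrite le_eqVlt; apply/orP; left; apply/eqP; congr (_ * _).
    by apply: eq_bigr => t _; rewrite (seq_norm_row SE s0).
  by have [h [Dh nh Bh]] := Hno m B _ sm bB eta4; exists h.
have [h hP] := choice top.
have Dh i : DE (h i) by case: (hP i).
have nh i : nE (h i) = 1 by case: (hP i).
have nh1 i : nE (h i) <= 1 by rewrite nh.
have cs0 : 0 < eta / 4 * c `^ s by rewrite mulr_gt0 ?powR_gt0.
have [i [ii Hi]] := exists_small_lower_forms SE s0 i0 bA Dh nh1 c0 cs0.
exists i, (h i); split => //.
have Dr := (seq_row_dom SE s0 i (Dh i)).1.
have Dcr := (seq_row_dom SE s0 i (sub_scale SE c (Dh i))).1.
have Ncr : N (seq_row i (c *: h i)) = c.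
  rewrite (seq_norm_row SE s0); last exact: (sub_scale SE).
  by rewrite (snZ SE)// nh mulr1 gtr0_norm.
have := Hd _ Dcr; rewrite Ncr => /(_ cd).
suff HP : - (eta / 2 * c `^ s) <= P (seq_row i (c *: h i)).
  rewrite ler_norml => /andP[]; rewrite [eta in X in _ -> _ -> X](splitr eta).
  set G := g (_ + _); set Q := P _ in HP *; move: HP; set T := eta / 2 * _.
  by rewrite mulrDl -/T => H1 H2 _; lra.
have Ak (k : 'I_m) : A k.+1 (fun=> seq_row i (c *: h i)) =
    c ^+ k.+1 * A k.+1 (fun=> seq_row i (h i)).
  have [mlA _] := bA k.+1 (ltn_ord k).
  rewrite seq_rowZ (ml_scale (seq_dom_subspace SE s0) mlA (fun=> c))//.
  by rewrite prodr_const card_ord.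
rewrite (PA _ Dcr) big_ord_recl /= A0// add0r.
rewrite (eq_bigr (fun k : 'I_m => c ^+ k.+1 * A k.+1 (fun=> seq_row i (h i)))); last first.
  by move=> k _; exact: Ak.
rewrite (bigID (fun k : 'I_m => k.+1%:R < s))/=.
have -> : - (eta / 2 * c `^ s) = - (eta / 4 * c `^ s) - eta / 4 * c `^ s by field.
apply: lerD.
  rewrite lerNl -sumrN; apply: le_trans (ltW Hi); apply: ler_sum => k _.
  by rewrite -mulrN ler_wpM2l ?exprn_ge0 ?(ltW c0)// -normrN ler_norm.
have [_ _] := hP i.
case: (m) msR => [|m'] m's; first by rewrite big_ord0 oppr_le0 ltW.
(* As [m <= s], only the last index can carry a degree that is not below [s]. *)
rewrite big_mkcond big_ord_recr /= big1 ?add0r; last first.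
  move=> k _; rewrite ifF//; apply/negbTE; rewrite negbK.
  by rewrite (lt_le_trans _ m's)// ltr_nat ltnS ltn_ord.
case: ifPn => [|_ _]; last by rewrite oppr_le0 ltW.
rewrite -leNgt => sm; have {sm}e : s = m'.+1%:R by apply/eqP; rewrite eq_le sm m's.
move=> /(_ e) /ltW H4; rewrite -powR_mulrn ?(ltW c0)// -e.
by rewrite [X in - X]mulrC -mulrN ler_pM2l ?powR_gt0// lerNl.
Qed.

Theorem smooth_bump_separating_form (g : (nat -> E) -> R) :
  Tsmooth D N s g -> g 0 != 0 -> (exists M, forall x, D x -> g x != 0 -> N x <= M) ->
  exists (m : nat) (A : ('I_m -> E) -> R) (eps : R),
    [/\ s = m%:R, bounded_multilinear DE nE A, 0 < eps &
     forall h, DE h -> nE h = 1 -> eps <= A (fun=> h)].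
Proof.
wlog g0 : g / 0 < g 0.
  move=> H gs gn0 [M gM]; have [g0|g0|/eqP] := ltrgtP (g 0) 0; last by rewrite (negPf gn0).
    apply: (H (fun x => - g x)); rewrite ?oppr_gt0 ?oppr_eq0//; first exact: Tsmooth_opp.
    by exists M => x Dx; rewrite oppr_eq0; exact: gM.
  by apply: (H g) => //; exists M.
move=> gs _ [M gM]; apply: contrapT => Hno0.
have Hno (m : nat) (A : ('I_m -> E) -> R) (eps : R) : s = m%:R ->
     bounded_multilinear DE nE A -> 0 < eps ->
     exists h, [/\ DE h, nE h = 1 & A (fun=> h) < eps].
  move=> sm bA eps0; apply: contrapT => H; apply: Hno0; exists m, A, eps; split => // h Dh nh.
  by rewrite leNgt; apply/negP => lt; apply: H; exists h.
have [D0 S0] := seq_dom0 SE s0.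
(* Points of the support satisfy [S x <= |M| ^ s]; the extra [1] leaves room for one more step. *)
pose B : R := `|M| `^ s + 1.
have B0 : 0 < B by rewrite ltr_wpDl ?powR_ge0.
(* Below the level [B] the total loss of [g] is at most [e * B = g 0 / 2], so [g] stays positive. *)
pose e := g 0 / (2 * B).
have e_gt0 : 0 < e by rewrite divr_gt0// mulr_gt0.
pose Q x := [/\ D x, S x <= B & bump_le g e 0 x].
have gcont x : D x -> forall r, 0 < r ->
    exists2 d, 0 < d & forall h, D h -> N h < d -> `|g (x + h) - g x| < r.
  move=> Dx; exact: (Tsmooth_continuous (seq_dom_subspace SE s0) (fun x => seq_norm_ge0 _ _ x)
    seq_norm0 s0 gs Dx).
have [x [[Dx xB x0] xmax]] : exists x, Q x /\ forall y, Q y -> bump_le g e x y -> S y <= S x.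
  apply: (@exists_maximal _ _ (bump_le g e) Q S B 0).
  - exact: bump_le_refl.
  - exact: bump_le_trans.
  - by move=> x y [Dx _ _] [Dy _ _] [xy _]; exact: seq_sum_mono.
  - by move=> x [].
  - by split => //; [rewrite S0 ltW | exact: bump_le_refl].
  move=> u uQ uS; have [y [Dy yB uy]] := bump_le_chain gcont (ltW e_gt0)
    (fun n => let: And3 a _ _ := uQ n in a) (fun n => let: And3 _ a _ := uQ n in a) uS.
  exists y; split => //; split => //.
  by have [_ _ u0] := uQ 0%N; exact: bump_le_trans u0 (uy _).
have gx : 0 < g x.
  case: x0 => _; apply: lt_le_trans; rewrite S0 subr0 subr_gt0.
  rewrite (le_lt_trans (ler_wpM2l (ltW e_gt0) xB))// /e.
  have -> : g 0 / (2 * B) * B = g 0 / 2 by field; rewrite gt_eqF.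
  by rewrite ltr_pdivrMr// ltr_pMr// ltr1n.
have xM : S x <= `|M| `^ s.
  rewrite -(seq_norm_powR s0 Dx); apply: ge0_ler_powR; rewrite ?nnegrE ?seq_norm_ge0 ?(ltW s0)//.
  by apply: le_trans (gM x Dx _) (ler_norm _); rewrite gt_eqF.
(* A vector of norm [c] added to a row of norm below [c / 3] gives a row of norm at least [2 c / 3].
   The gain in [S] is thus at least [(2 c / 3) ^ s - (c / 3) ^ s], and [eta * c ^ s] is [e] times
   this quantity. *)
pose eta := e * (3^-1 `^ s * (2 `^ s - 1)).
have two_s : 0 < 2 `^ s - 1 :> R.
  rewrite subr_gt0; apply: (@le_lt_trans _ _ (1 `^ s)); first by rewrite powR1.
  by apply: gt0_ltr_powR; rewrite ?nnegrE// ltr1n.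
have eta0 : 0 < eta by apply: mulr_gt0 => //; apply: mulr_gt0 => //; rewrite powR_gt0 ?invr_gt0.
have [d d0 Hstep] := smooth_good_step gs Hno Dx eta0.
(* [c <= 1 / 2] keeps the new row in the unit ball, so that [S] grows by at most the [1] reserved in
   [B]. *)
pose c := Num.min (d / 2) 2^-1.
have c0 : 0 < c by rewrite lt_min divr_gt0//= invr_gt0.
have cd : c < d by rewrite gt_min ltr_pdivrMr// ltr_pMr// ltr1n.
have c1 : c <= 2^-1 by rewrite ge_min lexx orbT.
have c3 : 0 < c / 3 by rewrite divr_gt0.
have [i0 Hi0] := seq_tail SE s0 Dx c3.
have [i [h [ii Dh nh gy]]] := Hstep c i0 c0 cd.
have xi := Hi0 i ii.
have Dxi : DE (x i) by case: Dx.
have Dch : DE (c *: h) by exact: (sub_scale SE).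
have nch : nE (c *: h) = c by rewrite (snZ SE)// nh mulr1 gtr0_norm.
have Dv : DE (x i + c *: h) by exact: (sub_addr SE).
pose y := upd x i (x i + c *: h).
have yE : x + seq_row i (c *: h) = y.
  by apply/funext => j; rewrite fctE /y /seq_row /upd; case: eqP => [->//|_]; rewrite addr0.
rewrite yE in gy.
have [Dy Sy] := seq_sum_upd i Dx Dv.
have nxi := sn_ge0 SE (x i).
have v_lo : 2 * (c / 3) <= nE (x i + c *: h).
  have := sn_lerB SE Dch (sub_opp SE Dxi); rewrite opprK (sn_normN SE)// nch (addrC (c *: h)) => H.
  by apply: le_trans H; move: xi; lra.
have v_hi : nE (x i + c *: h) <= 1.
  apply: le_trans (snD SE Dxi Dch) _; rewrite nch; move: xi c1; lra.
(* The threshold [c / 3] was chosen for this: passing from below [c / 3] to at least [2 c / 3] is a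
   doubling. *)
have rl j : row_le (x j) (y j).
  rewrite /y /upd; case: eqP => [->|_]; last by left.
  right; split; last by apply: lt_le_trans v_lo; rewrite mulr_gt0.
  by apply: le_trans v_lo; rewrite ler_pM2l// ltW.
have dS : 3^-1 `^ s * (2 `^ s - 1) * c `^ s <= S y - S x.
  rewrite Sy addrAC subrr add0r.
  have -> : 3^-1 `^ s * (2 `^ s - 1) * c `^ s = (2 * (c / 3)) `^ s - (c / 3) `^ s.
    rewrite !powRM ?invr_ge0 ?mulr_ge0 ?(ltW c0)//; ring.
  apply: lerB; apply: ge0_ler_powR; rewrite ?nnegrE ?(sn_ge0 SE) ?(ltW s0)//.
    by rewrite mulr_ge0// ltW.
  - exact: ltW.
  exact: ltW.
have xy : bump_le g e x y.
  split => //; apply: le_trans gy; rewrite lerD2l lerN2 /eta -mulrA.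
  by rewrite ler_pM2l.
have Qy : Q y.
  split => //; last exact: bump_le_trans x0 xy.
  rewrite Sy /B; apply: lerD => //.
  rewrite lerBlDr; apply: (@le_trans _ _ 1); last by rewrite lerDl powR_ge0.
  apply: (@le_trans _ _ (1 `^ s)); last by rewrite powR1.
  by apply: ge0_ler_powR; rewrite ?nnegrE ?(sn_ge0 SE) ?(ltW s0).
have := xmax y Qy xy; apply/negP; rewrite -ltNge -subr_gt0.
by apply: lt_le_trans dS; rewrite !mulr_gt0 ?powR_gt0 ?invr_gt0.
Qed.

End Bump.

(** * The mixed norm *)

(** [h] is an arbitrary function: a preimage under [h \o pi] is a countable union of fibres of
    [pi]. *)
Lemma measurable_countable_comp d d' (T : measurableType d) (U : measurableType d')
    (I : countType) (pi : T -> I) (h : I -> U) :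
  (forall i, measurable (pi @^-1` [set i])) -> measurable_fun setT (h \o pi).
Proof.
move=> mpi _ Y mY; rewrite setTI.
have -> : (h \o pi) @^-1` Y =
    \bigcup_i (if `[< Y (h i) >] then pi @^-1` [set i] else set0).
  apply/seteqP; split => [t Yt|t [i _]].
    by exists (pi t) => //; rewrite asboolT.
  by case: ifPn => // /asboolP Yi /= e; rewrite /preimage /= e.
by apply: countable_bigcupT_measurable => // i; case: ifP.
Qed.

Section Lq.
Variables (R : realType) (d : measure_display) (T : measurableType d).
Variables (nu : {measure set T -> \bar R}) (q : R).
Hypothesis q1 : 1 <= q.
Let q0 : 0 < q. Proof. exact: lt_le_trans q1. Qed.
Implicit Types g h : T -> R.

Definition Lq_int g : \bar R := (\int[nu]_t (`|g t| `^ q)%:E)%E.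

Lemma Lq_int_ge0 g : (0 <= Lq_int g)%E.
Proof. by apply: integral_ge0 => t _; rewrite lee_fin powR_ge0. Qed.

Lemma LnormE g : Lnorm nu q%:E (EFin \o g) = poweR (Lq_int g) q^-1.
Proof. by rewrite unlock; congr poweR; apply: eq_integral => t _ /=; rewrite poweR_EFin. Qed.

Lemma Lq_memP g : Lq_mem nu q g <-> measurable_fun setT g /\ (Lq_int g < +oo)%E.
Proof.
rewrite /Lq_mem LnormE; split => -[mg gq]; split => //.
  by apply: lty_poweRy gq; rewrite invr_neq0 ?gt_eqF.
exact: poweR_lty.
Qed.

Lemma Lq_int_fin g : Lq_mem nu q g -> Lq_int g = (fine (Lq_int g))%:E.
Proof. by move=> /Lq_memP[_ gq]; rewrite fineK// ge0_fin_numE// Lq_int_ge0. Qed.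

Lemma Lq_norm_ge0 g : 0 <= Lq_norm nu q g.
Proof. by rewrite fine_ge0// Lnorm_ge0. Qed.

Lemma Lq_norm_powR g : Lq_mem nu q g -> (Lq_norm nu q g `^ q)%:E = Lq_int g.
Proof.
move=> Lg; rewrite /Lq_norm LnormE fine_poweR -powRrM mulVf ?gt_eqF//.
by rewrite powRr1 ?fine_ge0 ?Lq_int_ge0// -Lq_int_fin.
Qed.

Lemma Lq_normE g : Lq_norm nu q g = fine (Lq_int g) `^ q^-1.
Proof. by rewrite /Lq_norm LnormE fine_poweR. Qed.

Lemma Lq_mem_Lfun g : Lq_mem nu q g <-> g \in Lfun nu q%:E.
Proof.
split => [[mg gq]|/andP[]]; last by rewrite !inE.
by apply/andP; rewrite !inE.
Qed.

Lemma Lq_fineK g : Lq_mem nu q g -> (Lq_norm nu q g)%:E = Lnorm nu q%:E (EFin \o g).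
Proof. by move=> [_ gq]; rewrite fineK// ge0_fin_numE// Lnorm_ge0. Qed.

Let q1E : (1 <= q%:E)%E. Proof. by rewrite lee_fin. Qed.

Lemma Lq_seminormed : seminormed_on (Lq_mem nu q) (Lq_norm nu q).
Proof.
have DS : subspace_on (Lq_mem nu q).
  have [L0 LL] := @Lfun_submod_closed _ T R nu q%:E q1E.
  split; first exact/Lq_mem_Lfun.
  by move=> a x y /Lq_mem_Lfun Lx /Lq_mem_Lfun Ly; apply/Lq_mem_Lfun; exact: LL.
split => //.
- exact: Lq_norm_ge0.
- move=> a x Dx; apply: EFin_inj; rewrite EFinM !Lq_fineK//; last exact: (sub_scale DS).
  have /Lq_mem_Lfun Lx := Dx.
  exact: (LnormZ (Lfun_Sub q1E Lx) a).
- move=> x y Dx Dy; rewrite -lee_fin EFinD !Lq_fineK//; last exact: (sub_addr DS).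
  by apply: minkowski_EFin => //; [case: Dx | case: Dy].
Qed.

Lemma Lq_le g h : measurable_fun setT g -> Lq_mem nu q h -> (forall t, `|g t| <= `|h t|) ->
  Lq_mem nu q g /\ Lq_norm nu q g <= Lq_norm nu q h.
Proof.
move=> mg Lh gh; have /Lq_memP[mh hq] := Lh.
have mp (f : T -> R) : measurable_fun setT f -> measurable_fun setT (EFin \o (fun t => `|f t| `^ q)).
  move=> mf; apply/measurable_EFinP; apply: (measurableT_comp (measurable_powR _)).
  exact: measurableT_comp.
have le : (Lq_int g <= Lq_int h)%E.
  apply: ge0_le_integral => //.
  - exact: mp.
  - exact: mp.
  - by move=> t _; rewrite lee_fin; apply: ge0_ler_powR; rewrite ?nnegrE ?(ltW q0).
have Lg : Lq_mem nu q g by apply/Lq_memP; split => //; exact: le_lt_trans le hq.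
split => //; rewrite !Lq_normE; apply: ge0_ler_powR;
  rewrite ?nnegrE ?invr_ge0 ?(ltW q0) ?fine_ge0 ?Lq_int_ge0//.
by rewrite -lee_fin -!Lq_int_fin.
Qed.

End Lq.

(** * Measurability of functionals of strongly measurable functions *)

Section Strong.
Variables (R : realType) (d1 d2 : measure_display).
Variables (T1 : measurableType d1) (T2 : measurableType d2).
Variables (nu : {measure set T2 -> \bar R}) (q : R).
Hypothesis q1 : 1 <= q.
Let SL := Lq_seminormed nu q1.
Notation DL := (Lq_mem nu q).
Notation NL := (Lq_norm nu q).

Definition strongly_measurable (u : T1 -> T2 -> R) :=
  (forall w, DL (u w)) /\
  exists s : nat -> T1 -> T2 -> R, (forall n, simple_Lq nu q (s n)) /\
     forall w, (fun n => NL (u w - s n w)) @ \oo --> (0 : R).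

Lemma simple_Lq_mem (s : T1 -> T2 -> R) w : simple_Lq nu q s -> DL (s w).
Proof.
move=> [k [A [g [_ [Dg ->]]]]].
rewrite (_ : (fun t => _) = \sum_(i < k) (\1_(A i) w) *: g i).
  by apply: (sub_sum SL) => i _; exact: (sub_scale SL).
by apply/funext => t; rewrite fct_sumE.
Qed.

(** [Phi] is arbitrary: jointly, the simple functions depend on finitely many membership tests,
    recorded by [pi]. *)
Lemma measurable_simple_comp k (Phi : ('I_k -> T2 -> R) -> R) (s : 'I_k -> T1 -> T2 -> R) :
  (forall i, simple_Lq nu q (s i)) -> measurable_fun setT (fun w => Phi (fun i => s i w)).
Proof.
move=> Hs.
pose K i := projT1 (cid (Hs i)); pose HA i := cid (projT2 (cid (Hs i))).
pose A i : 'I_(K i) -> set T1 := projT1 (HA i); pose Hg i := cid (projT2 (HA i)).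
pose g i : 'I_(K i) -> T2 -> R := projT1 (Hg i).
have mA i j : measurable (A i j) by have [H _] := projT2 (Hg i); exact: H.
have sE i : s i = (fun w t => \sum_(j < K i) \1_(A i j) w * g i j t).
  by have [_ []] := projT2 (Hg i).
pose B := {ffun {i : 'I_k & 'I_(K i)} -> bool}.
pose pi (w : T1) : B := [ffun p => w \in A (tag p) (tagged p)].
pose G (b : B) := Phi (fun i t => \sum_(j < K i) (b (Tagged _ j))%:R * g i j t).
rewrite (_ : (fun w => _) = G \o pi); last first.
  apply/funext => w; rewrite /G /=; congr Phi; apply/funext => i; rewrite sE.
  by apply/funext => t; apply: eq_bigr => j _; rewrite indicE ffunE.
apply: measurable_countable_comp => b.
have -> : pi @^-1` [set b] = \bigcap_(p in [set: {i : 'I_k & 'I_(K i)}])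
    (if b p then A (tag p) (tagged p) else ~` A (tag p) (tagged p)).
  apply/seteqP; split => [w /= <- p _|w Hw].
    by rewrite ffunE; case: ifPn => [/set_mem//|/negP wA /mem_set].
  apply/ffunP => p; rewrite ffunE; have := Hw p I.
  by case: ifPn => _ => [/mem_set//|/= wA]; apply/negbTE/negP => /set_mem.
apply: fin_bigcap_measurable => //; first exact: finite_finset.
by move=> p _; case: ifP => _; [|apply: measurableC]; exact: mA.
Qed.

(** A pointwise limit of the simple case. It serves for the norm and for inner integrals of
    products: elements of [LpLq] are not assumed jointly measurable on the product, so Fubini-type
    measurability is not at hand. *)
Lemma measurable_strong_comp k (Phi : ('I_k -> T2 -> R) -> R) (u : 'I_k -> T1 -> T2 -> R) :
  (forall i, strongly_measurable (u i)) ->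
  (forall (x : 'I_k -> T2 -> R) (y : nat -> 'I_k -> T2 -> R),
     (forall i, DL (x i)) -> (forall n i, DL (y n i)) ->
     (forall i, NL (x i - y n i) @[n --> \oo] --> (0 : R)) ->
     Phi (y n) @[n --> \oo] --> Phi x) ->
  measurable_fun setT (fun w => Phi (fun i => u i w)).
Proof.
move=> Hu cPhi; have [s Hs] := choice (fun i => (Hu i).2).
apply: (@measurable_fun_cvg _ _ _ _ (fun n w => Phi (fun i => s i n w))).
  by move=> n; apply: measurable_simple_comp => i; have [H _] := Hs i; exact: H.
move=> w _; apply: cPhi.
- by move=> i; have [H _] := Hu i; exact: H.
- by move=> n i; apply: simple_Lq_mem; have [H _] := Hs i; exact: H.
- by move=> i; have [_ H] := Hs i; exact: H.
Qed.

Lemma measurable_strong_norm u : strongly_measurable u ->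
  measurable_fun setT (fun w => NL (u w)).
Proof.
move=> Hu; apply: (@measurable_strong_comp 1 (fun x => NL (x ord0)) (fun=> u)) => //.
move=> x y Dx Dy xy; apply/cvgrPdist_lt => e e0.
have /cvgrPdist_lt/(_ _ e0)[n0 _ H] := xy ord0.
exists n0 => // n nn; apply: le_lt_trans (sn_distB SL (Dx _) (Dy _ _)) _.
have := H n nn; rewrite /= sub0r normrN; apply: le_lt_trans; exact: ler_norm.
Qed.

Lemma simple_Lq_add (s s' : T1 -> T2 -> R) : simple_Lq nu q s -> simple_Lq nu q s' ->
  simple_Lq nu q (s + s' : T1 -> T2 -> R).
Proof.
move=> [k [A [g [mA [Dg ->]]]]] [k' [A' [g' [mA' [Dg' ->]]]]].
exists (k + k')%N, (fun i => match fintype.split i with inl j => A j | inr j => A' j end),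
  (fun i => match fintype.split i with inl j => g j | inr j => g' j end); split.
  by move=> i; case: fintype.split.
split; first by move=> i; case: fintype.split.
apply/funext => w; apply/funext => t; rewrite !fctE big_split_ord /=; congr (_ + _).
  by apply: eq_bigr => i _; rewrite (unsplitK (inl i)).
by apply: eq_bigr => i _; rewrite (unsplitK (inr i)).
Qed.

Lemma simple_Lq_scale a (s : T1 -> T2 -> R) : simple_Lq nu q s -> simple_Lq nu q (a *: s : T1 -> T2 -> R).
Proof.
move=> [k [A [g [mA [Dg ->]]]]]; exists k, A, (fun i => a *: g i); split => //.
split; first by move=> i; exact: (sub_scale SL).
apply/funext => w; apply/funext => t.
transitivity (a * \sum_(i < k) \1_(A i) w * g i t) => //.
by rewrite mulr_sumr; apply: eq_bigr => i _; rewrite mulrCA.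
Qed.

Lemma strongly_measurable_subspace : subspace_on strongly_measurable.
Proof.
split.
  split; first by move=> w; exact: (sub0 SL).
  exists (fun=> 0); split.
    move=> _; exists 0%N, (fun=> set0), (fun=> 0); do 2![split; first by case].
    by apply/funext => w; apply/funext => t; rewrite big_ord0.
  move=> w; rewrite (_ : (fun n => _) = fun=> 0); first exact: cvg_cst.
  by apply/funext => n; rewrite -[LHS]/(NL (0 - 0)) subr0 (sn_norm0 SL).
move=> a x y [Dx [s [ss xs]]] [Dy [s' [ss' ys]]]; split.
  by move=> w; exact: (subL SL).
exists (fun n => a *: s n + s' n); split.
  by move=> n; apply: simple_Lq_add => //; exact: simple_Lq_scale.
move=> w; have Dsn n := simple_Lq_mem w (ss n); have Dsn' n := simple_Lq_mem w (ss' n).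
have H : `|a| * NL (x w - s n w) + NL (y w - s' n w) @[n --> \oo] --> (0 : R).
  rewrite -[X in _ --> X](addr0 0) -[X in _ --> X + _](mulr0 `|a|).
  by apply: cvgD; [apply: cvgMr; exact: xs | exact: ys].
apply: (squeeze_cvgr _ (cvg_cst (0 : R)) H); apply: nearW => n.
rewrite Lq_norm_ge0 /= (_ : _ - _ = a *: (x w - s n w) + (y w - s' n w)); last first.
  by rewrite -[LHS]/((a *: x w + y w) - (a *: s n w + s' n w)) scalerBr addrACA -opprD.
rewrite (le_trans (snD SL _ _))//; last 1 first.
- by rewrite (snZ SL)//; exact: (sub_sub SL).
- by apply: (sub_scale SL); exact: (sub_sub SL).
- exact: (sub_sub SL).
Qed.

End Strong.

(** * The seminorm of [L_p(L_q)] *)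

Section Bochner.
Variables (R : realType) (d1 d2 : measure_display).
Variables (T1 : measurableType d1) (T2 : measurableType d2).
Variables (mu : {measure set T1 -> \bar R}) (nu : {measure set T2 -> \bar R}) (p q : R).
Hypotheses (p1 : 1 <= p) (q1 : 1 <= q).
Let SL := Lq_seminormed nu q1.
Let SM := Lq_seminormed mu p1.
Notation NL := (Lq_norm nu q).

Lemma LpLqP u : LpLq mu nu p q u <->
  strongly_measurable nu q u /\ Lq_mem mu p (fun w => NL (u w)).
Proof.
split=> [[Du [us fu]]|[[Du us] [_ fu]]]; last by [].
by split => //; split => //; apply: (measurable_strong_norm q1).
Qed.

Lemma LpLq_seminormed : seminormed_on (LpLq mu nu p q) (LpLq_norm mu nu p q).
Proof.
have normD a x y : LpLq mu nu p q x -> LpLq mu nu p q y ->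
    LpLq mu nu p q (a *: x + y) /\
    LpLq_norm mu nu p q (a *: x + y) <= `|a| * LpLq_norm mu nu p q x + LpLq_norm mu nu p q y.
  move=> /LpLqP[sx Nx] /LpLqP[sy Ny].
  have sxy := subL (strongly_measurable_subspace T1 nu q1) a sx sy.
  (* The triangle inequality is used twice: pointwise in [L_q], which bounds the norm function by
     [h], and then in [L_p] for [h]. *)
  pose h := `|a| *: (fun w => NL (x w)) + (fun w => NL (y w)).
  have Dh : Lq_mem mu p h by exact: (subL SM).
  have [Lxy le] : Lq_mem mu p (fun w => NL ((a *: x + y) w)) /\
      Lq_norm mu p (fun w => NL ((a *: x + y) w)) <= Lq_norm mu p h.
    apply: Lq_le => //; first exact: (measurable_strong_norm q1 sxy).
    move=> w; rewrite ger0_norm ?Lq_norm_ge0// ger0_norm; last first.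
      by rewrite /h !fctE addr_ge0 ?mulr_ge0 ?Lq_norm_ge0.
    have Dx := sx.1 w; have Dy := sy.1 w.
    rewrite /h !fctE (le_trans (snD SL _ _))//; first exact: (sub_scale SL).
    by rewrite (snZ SL).
  split; first exact/LpLqP.
  apply: le_trans le _; apply: le_trans (snD SM (sub_scale SM _ Nx) Ny) _.
  by rewrite (snZ SM)// normr_id.
have DS : subspace_on (LpLq mu nu p q).
  split; last by move=> a x y Dx Dy; case: (normD a x y Dx Dy).
  apply/LpLqP; split; first exact: (sub0 (strongly_measurable_subspace T1 nu q1)).
  rewrite (_ : (fun w => _) = 0); first exact: (sub0 SM).
  by apply/funext => w; exact: (sn_norm0 SL).
split => //; first by move=> x; exact: Lq_norm_ge0.
  move=> a x /LpLqP[sx Nx]; rewrite /LpLq_norm -/(Lq_norm mu p (fun w => NL ((a *: x) w))).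
  rewrite (_ : (fun w => _) = `|a| *: (fun w => NL (x w))).
    by rewrite (snZ SM)// normr_id.
  by apply/funext => w; rewrite !fctE (snZ SL)//; exact: sx.1.
move=> x y Dx Dy; have [_] := normD 1 x y Dx Dy.
by rewrite scale1r normr1 mul1r.
Qed.

End Bochner.

(** * Copies of [l_p(L_q)] and [l_q] in [L_p(L_q)] *)

Section Pullback.
Variables (R : realType) (V W : lmodType R) (D : set V) (N : V -> R).
Variables (D' : set W) (N' : W -> R) (phi : W -> V).
Hypothesis phiL : forall a x y, phi (a *: x + y) = a *: phi x + phi y.
Hypothesis phiD : forall x, D' x -> D (phi x).
Hypothesis phiN : forall x, D' x -> N (phi x) = N' x.

Lemma bounded_multilinear_pullback k (A : ('I_k -> V) -> R) :
  bounded_multilinear D N A -> bounded_multilinear D' N' (fun x => A (fun i => phi (x i))).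
Proof.
move=> [mlA [C AC]]; split.
  move=> x Dx i a y Dy.
  have := mlA _ (fun j => phiD (Dx j)) i a _ (phiD Dy); rewrite -phiL => e.
  rewrite [LHS](_ : _ = A (fun j => if j == i then phi (a *: x i + y) else phi (x j))).
    by rewrite e; congr (_ + A _); apply/funext => j; case: ifP.
  by congr A; apply/funext => j; case: ifP.
exists C => x Dx; apply: le_trans (AC _ (fun j => phiD (Dx j))) _.
by rewrite le_eqVlt; apply/orP; left; apply/eqP; congr (_ * _); apply: eq_bigr => j _; exact: phiN.
Qed.

Lemma Tsmooth_pullback s (f : V -> R) x0 : subspace_on D -> Tsmooth D N s f -> D x0 ->
  Tsmooth D' N' s (fun x => f (x0 + phi x)).
Proof.
move=> DS fs Dx0 x Dx.
have [m [P [ms [[A [bA PA]] H]]]] := fs _ (sub_addr DS Dx0 (phiD Dx)).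
exists m, (fun h => P (phi h)); split => //; split.
  exists (fun k x => A k (fun i => phi (x i))); split => [k km|h Dh].
    exact: bounded_multilinear_pullback (bA k km).
  exact: PA (phiD Dh).
move=> e e0; have [d [d0 Hd]] := H e e0; exists d; split => // h Dh hd.
have -> : phi (x + h) = phi x + phi h by rewrite -[x]scale1r phiL !scale1r.
rewrite addrA -[N' h]phiN//; apply: Hd; first exact: phiD.
by rewrite phiN.
Qed.

(* Composing with an isometric embedding, translated to a point where the bump
   does not vanish, gives a bump on the smaller space. *)
Lemma bump_pullback s (f : V -> R) : seminormed_on D N -> D' 0 ->
  bump_function D N f -> Tsmooth D N s f ->
  exists g : W -> R, [/\ Tsmooth D' N' s g, g 0 != 0 &
    exists M, forall x, D' x -> g x != 0 -> N' x <= M].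
Proof.
move=> DN D'0 [[x0 [Dx0 fx0]] [M fM]] fs; exists (fun x => f (x0 + phi x)); split.
- exact: (Tsmooth_pullback DN fs Dx0).
- have -> : phi 0 = 0.
    by have := phiL (-1) 0 0; rewrite scaler0 addr0 scaleN1r addNr.
  by rewrite addr0.
- exists (M + N x0) => x Dx fx; rewrite -phiN//.
  have H := fM _ (sub_addr DN Dx0 (phiD Dx)) fx.
  have -> : phi x = (x0 + phi x) + - x0 by rewrite addrAC subrr add0r.
  apply: le_trans (snD DN _ _) _.
  + exact: (sub_addr DN Dx0 (phiD Dx)).
  + exact: (sub_opp DN).
  by rewrite (sn_normN DN)// lerD2r.
Qed.

End Pullback.

(** * Sequences spread over a countable measurable partition *)

Section Index.
Variables (R : realType) (d : measure_display) (T : measurableType d).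
Variables (mu : {measure set T -> \bar R}) (idx : T -> nat).
Hypothesis midx : forall i, measurable (idx @^-1` [set i]).
Hypothesis mu_idx : forall i, (0 < mu (idx @^-1` [set i.+1]) < +oo)%E.

Lemma measurable_idx (v : nat -> R) : measurable_fun setT (fun t => v (idx t)).
Proof. exact: (measurable_countable_comp v midx). Qed.

Lemma integral_idx (v : nat -> R) : (forall i, 0 <= v i) ->
  (\int[mu]_t (v (idx t))%:E = \sum_(i <oo) (v i)%:E * mu (idx @^-1` [set i]))%E.
Proof.
move=> v0.
have -> : [set: T] = \bigcup_i (idx @^-1` [set i]).
  by apply/seteqP; split => // t _; exists (idx t).
rewrite ge0_integral_bigcup//.
- apply: eq_eseriesr => i _.
  rewrite (eq_integral (fun=> (v i)%:E)); first by rewrite integral_cst.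
  by move=> t; rewrite inE /= => ->.
- apply/measurable_EFinP; apply: measurable_funTS; exact: measurable_idx.
- by move=> t _; rewrite lee_fin.
exact: trivIset_preimage1.
Qed.

Variable s : R.
Hypothesis s0 : 0 < s.

Definition idx_weight (i : nat) : R := fine (mu (idx @^-1` [set i.+1])) `^ (- s^-1).

Let m_gt0 i : 0 < fine (mu (idx @^-1` [set i.+1])).
Proof. by rewrite fine_gt0// mu_idx. Qed.

Lemma idx_weight_gt0 i : 0 < idx_weight i.
Proof. exact: powR_gt0. Qed.

Section Embed.
Variables (E : lmodType R) (DE : set E) (nE : E -> R).
Hypothesis SE : seminormed_on DE nE.

(** Class [0] is a remainder of unrestricted measure, on which the image is [0]. The weight cancels
    the measure of class [i + 1], so that row [i] contributes exactly [nE (x i) ^ s] to the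
    integral. *)
Definition idx_embed (x : nat -> E) (t : T) : E :=
  if idx t is i.+1 then idx_weight i *: x i else 0.

Lemma idx_embedL a x y : idx_embed (a *: x + y) = a *: idx_embed x + idx_embed y.
Proof.
apply/funext => t; rewrite -[RHS]/(a *: idx_embed x t + idx_embed y t) /idx_embed.
case: (idx t) => [|i]; first by rewrite scaler0 addr0.
by rewrite fctE scalerDr scalerA mulrC -scalerA.
Qed.

Lemma idx_embed_mem x t : (forall i, DE (x i)) -> DE (idx_embed x t).
Proof.
move=> Dx; rewrite /idx_embed; case: (idx t) => [|i]; first exact: (sub0 SE).
exact: (sub_scale SE).
Qed.

Lemma measurable_idx_embed (h : E -> R) x : measurable_fun setT (fun t => h (idx_embed x t)).
Proof. exact: (measurable_idx (fun n => h (if n is i.+1 then idx_weight i *: x i else 0))). Qed.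

Lemma integral_idx_embed x : seq_dom DE nE s x ->
  (\int[mu]_t (nE (idx_embed x t) `^ s)%:E = (seq_sum nE s x)%:E)%E.
Proof.
move=> Dx; pose v n := nE (if n is i.+1 then idx_weight i *: x i else 0) `^ s.
rewrite (integral_idx (v := v)); last by move=> i; exact: powR_ge0.
apply/cvg_lim => //.
(* Row [i] lives on class [i + 1], hence the shift; the term of class [0] is [0] times its measure,
   which is [0] even if that measure is infinite. *)
rewrite -cvg_shiftS /=.
have -> : (fun n => \sum_(0 <= k < n.+1) (v k)%:E * mu (idx @^-1` [set k]))%E =
    EFin \o (seq_psum nE s x).
  apply/funext => n; rewrite big_nat_recl//= /v (sn_norm0 SE) powR0 ?gt_eqF// mul0e add0e.
  rewrite /seq_psum big_mkord -sumEFin; apply: eq_bigr => i _.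
  have mfin : mu (idx @^-1` [set i.+1]) = (fine (mu (idx @^-1` [set i.+1])))%:E.
    by rewrite fineK// ge0_fin_numE//; have /andP[] := mu_idx i.
  rewrite mfin -EFinM; congr EFin; rewrite (snZ SE); last by case: Dx.
  rewrite gtr0_norm ?idx_weight_gt0// powRM ?(sn_ge0 SE) ?(ltW (idx_weight_gt0 i))//.
  rewrite /idx_weight -powRrM mulNr mulVf ?gt_eqF// powR_inv1 ?(ltW (m_gt0 i))//.
  by rewrite mulrAC mulVf ?mul1r// gt_eqF.
apply/cvg_EFin; first exact: nearW.
exact: (is_cvg_seq_psum Dx).
Qed.

End Embed.
End Index.

Lemma scalar_seminormed (R : realType) :
  @seminormed_on R R^o setT (fun x : R^o => `|x|).
Proof.
split => //; first by move=> a x _; exact: normrM.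
by move=> x y _ _; exact: ler_normD.
Qed.

Section Embeddings.
Variables (R : realType) (d1 d2 : measure_display).
Variables (T1 : measurableType d1) (T2 : measurableType d2).
Variables (mu : {measure set T1 -> \bar R}) (nu : {measure set T2 -> \bar R}) (p q : R).
Hypotheses (p1 : 1 <= p) (q1 : 1 <= q).
Variables (idx1 : T1 -> nat) (idx2 : T2 -> nat).
Hypothesis midx1 : forall i, measurable (idx1 @^-1` [set i]).
Hypothesis mu_idx1 : forall i, (0 < mu (idx1 @^-1` [set i.+1]) < +oo)%E.
Hypothesis midx2 : forall i, measurable (idx2 @^-1` [set i]).
Hypothesis nu_idx2 : forall i, (0 < nu (idx2 @^-1` [set i.+1]) < +oo)%E.
Let p0 : 0 < p. Proof. exact: lt_le_trans p1. Qed.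
Let q0 : 0 < q. Proof. exact: lt_le_trans q1. Qed.
Let SL := Lq_seminormed nu q1.
Notation DL := (Lq_mem nu q).
Notation NL := (Lq_norm nu q).
Notation Dq := (seq_dom (setT : set R^o) (fun x : R^o => `|x|) q).
Notation Nq := (seq_norm (fun x : R^o => `|x|) q).

Definition seq_to_Lq (x : nat -> R^o) : T2 -> R := idx_embed nu idx2 q x.

Lemma seq_to_Lq_isometry x : Dq x -> DL (seq_to_Lq x) /\ NL (seq_to_Lq x) = Nq x.
Proof.
move=> Dx; have I := integral_idx_embed midx2 nu_idx2 q0 (scalar_seminormed R) Dx.
have Dg : DL (seq_to_Lq x).
  apply/(Lq_memP _ q1); split; last by rewrite [ltLHS]I ltry.
  exact: (measurable_idx_embed nu midx2 q (fun y : R^o => y)).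
by split => //; rewrite Lq_normE [Lq_int _ _ _]I.
Qed.

Definition seq_to_LpLq (x : nat -> T2 -> R) : T1 -> T2 -> R := idx_embed mu idx1 p x.

Lemma seq_to_LpLq_isometry x : seq_dom DL NL p x ->
  LpLq mu nu p q (seq_to_LpLq x) /\ LpLq_norm mu nu p q (seq_to_LpLq x) = seq_norm NL p x.
Proof.
move=> Dx; have I := integral_idx_embed midx1 mu_idx1 p0 SL Dx.
have Ie : Lq_int mu p (fun w => NL (seq_to_LpLq x w)) = (seq_sum NL p x)%:E.
  by rewrite -I; apply: eq_integral => w _; rewrite ger0_norm ?Lq_norm_ge0.
have Dh : Lq_mem mu p (fun w => NL (seq_to_LpLq x w)).
  apply/(Lq_memP _ p1); split; last by rewrite Ie ltry.
  exact: (measurable_idx_embed mu midx1 p NL).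
split; last by rewrite /LpLq_norm -/(Lq_norm mu p _) Lq_normE Ie.
apply/(LpLqP _ _ _ q1); split => //; split.
  by move=> w; apply: (idx_embed_mem mu idx1 p SL); case: Dx.
(* Truncations to finitely many classes: at a given [w] they are exact from [n = idx1 w] on. *)
exists (fun n w => \sum_(i < n) \1_(idx1 @^-1` [set i.+1]) w *: (idx_weight mu idx1 p i *: x i)).
split.
  move=> n; exists n, (fun i => idx1 @^-1` [set i.+1]), (fun i => idx_weight mu idx1 p i *: x i).
  split => //; split; first by move=> i; apply: (sub_scale SL); case: Dx.
  by apply/funext => w; apply/funext => t; rewrite fct_sumE.
move=> w; apply: cvg_near_cst; exists (idx1 w) => // n /= wn.
suff -> : \sum_(i < n) \1_(idx1 @^-1` [set i.+1]) w *: (idx_weight mu idx1 p i *: x i) =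
    seq_to_LpLq x w by rewrite subrr (sn_norm0 SL).
rewrite /seq_to_LpLq /idx_embed; case e : (idx1 w) => [|j].
  rewrite big1// => i _; rewrite indicE memNset ?scale0r//=.
  by rewrite e.
have jn : (j < n)%N by rewrite -e.
rewrite (bigD1 (Ordinal jn))//= indicE mem_set// scale1r big1 ?addr0// => i ij.
rewrite indicE memNset ?scale0r//= e => -[ji].
by move: ij; rewrite -val_eqE /= ji eqxx.
Qed.

Lemma seq_dom_row v : DL v -> seq_dom DL NL p (seq_row 0 v).
Proof. by move=> Dv; have [] := seq_row_dom SL p0 0 Dv. Qed.

Let one_row : Dq (seq_row 0 (1 : R^o)).
Proof. by have [] := seq_row_dom (scalar_seminormed R) q0 0 (I : setT (1 : R^o)). Qed.

Lemma Lq_unit : exists e, DL e /\ NL e = 1.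
Proof.
exists (seq_to_Lq (seq_row 0 1)); have [? ->] := seq_to_Lq_isometry one_row; split => //.
by rewrite (seq_norm_row (scalar_seminormed R) q0 0)// normr1.
Qed.

Lemma form_even (E : lmodType R) (DE : set E) (nE : E -> R) m (A : ('I_m -> E) -> R) eps e :
  seminormed_on DE nE -> bounded_multilinear DE nE A -> 0 < eps ->
  (forall h, DE h -> nE h = 1 -> eps <= A (fun=> h)) -> DE e -> nE e = 1 -> ~~ odd m.
Proof.
move=> SE [mlA _] eps0 Aeps De ne; apply/negP => om.
have := Aeps _ (sub_opp SE De); rewrite (sn_normN SE)// => /(_ ne).
rewrite -scaleN1r (ml_scale SE mlA (fun=> -1))// prodr_const card_ord -signr_odd om expr1 mulN1r.
by have := Aeps _ De ne => H1 H2; lra.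
Qed.

(** The climb on [l_p(L_q)] gives a form on [L_q] itself. It is then pulled back to the copy of
    scalar [l_q] in [L_q], where the averaging argument applies with exponent [q]. *)
Lemma bump_p_consequence f : bump_function (LpLq mu nu p q) (LpLq_norm mu nu p q) f ->
  Tsmooth (LpLq mu nu p q) (LpLq_norm mu nu p q) p f ->
  exists m : nat, [/\ p = m%:R, ~~ odd m & exists k : nat, m%:R = k%:R * q].
Proof.
move=> bf fs; have [e [De ne]] := Lq_unit.
have [g [gs g0 gM]] := bump_pullback (@idx_embedL _ _ _ mu idx1 p _)
   (fun x Dx => (seq_to_LpLq_isometry Dx).1) (fun x Dx => (seq_to_LpLq_isometry Dx).2)
   (LpLq_seminormed mu nu p1 q1) (seq_dom0 SL p0).1 bf fs.
have [m [A [eps [pm bA eps0 Aeps]]]] := smooth_bump_separating_form SL p0 De ne gs g0 gM.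
exists m; split => //; first exact: (form_even SL bA eps0 Aeps De ne).
have bB := bounded_multilinear_pullback (@idx_embedL _ _ _ nu idx2 q _)
  (fun x Dx => (seq_to_Lq_isometry Dx).1) (fun x Dx => (seq_to_Lq_isometry Dx).2) bA.
apply: (separating_form_ratio (scalar_seminormed R) q0 (e0 := 1) I (normr1 R) bB eps0).
move=> y Dy ny; have [D1 N1] := seq_to_Lq_isometry Dy.
by apply: Aeps => //; rewrite -ny.
Qed.

Lemma bump_q_consequence f : bump_function (LpLq mu nu p q) (LpLq_norm mu nu p q) f ->
  Tsmooth (LpLq mu nu p q) (LpLq_norm mu nu p q) q f ->
  exists m : nat, q = m%:R /\ ~~ odd m.
Proof.
move=> bf fs; pose phi (x : nat -> R^o) := seq_to_LpLq (seq_row 0 (seq_to_Lq x)).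
have phiL a x y : phi (a *: x + y) = a *: phi x + phi y.
  by rewrite /phi /seq_to_Lq idx_embedL seq_rowD seq_rowZ /seq_to_LpLq idx_embedL.
have phiP x : Dq x -> LpLq mu nu p q (phi x) /\ LpLq_norm mu nu p q (phi x) = Nq x.
  move=> Dx; have [Dg Ng] := seq_to_Lq_isometry Dx.
  have [HD HN] := seq_to_LpLq_isometry (seq_dom_row Dg); split; first exact: HD.
  by rewrite /phi HN (seq_norm_row SL p0).
have SR := scalar_seminormed R.
have [g [gs g0 gM]] := bump_pullback phiL (fun x Dx => (phiP x Dx).1)
   (fun x Dx => (phiP x Dx).2) (LpLq_seminormed mu nu p1 q1) (seq_dom0 SR q0).1 bf fs.
have [m [A [eps [qm bA eps0 Aeps]]]] := smooth_bump_separating_form SR q0 I (normr1 R) gs g0 gM.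
by exists m; split => //; exact: (form_even SR bA eps0 Aeps (e := 1) I (normr1 R)).
Qed.

End Embeddings.

(** * Disjoint sets in infinite-dimensional Lebesgue spaces *)

Section DisjointFamilies.
Variables (R : realType) (d : measure_display) (T : measurableType d).
Variables (mu : {measure set T -> \bar R}).
Implicit Types (X Y B E : set T).

Definition pos_fin X := measurable X /\ (0 < mu X < +oo)%E.

Definition disjoint_family (k : nat) E (F : 'I_k -> set T) :=
  (forall i, pos_fin (F i) /\ F i `<=` E) /\
  (forall i j, i != j -> F i `&` F j = set0).

Lemma pos_finI X B : pos_fin X -> measurable B -> mu (X `&` B) <> 0%E -> pos_fin (X `&` B).
Proof.
move=> [mX /andP[_ Xfin]] mB XB; have mXB := measurableI _ _ mX mB.
split => //; apply/andP; split; first by rewrite lt0e measure_ge0 andbT; apply/eqP.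
by apply: le_lt_trans Xfin; apply: le_measure; rewrite ?inE//; exact: subIsetl.
Qed.

Lemma disjoint_family_extend k E (F : 'I_k -> set T) Y :
  disjoint_family E F -> pos_fin Y -> Y `<=` E -> (forall i, F i `&` Y = set0) ->
  exists G : 'I_k.+1 -> set T, disjoint_family E G.
Proof.
move=> [FE Fd] Yp YE FY.
exists (fun i => if unlift ord0 i is Some j then F j else Y); split.
  by move=> i; case: unliftP => [j _|_].
move=> i j; case: unliftP => [i' ->|->]; case: unliftP => [j' ->|->].
- by rewrite (inj_eq lift_inj); exact: Fd.
- by move=> _; exact: FY.
- by move=> _; rewrite setIC; exact: FY.
- by rewrite eqxx.
Qed.

(** As [X] and [Y] are disjoint, each [F i] is covered by its parts off [X] and off [Y], one of
    which has positive measure. The pigeonhole principle on [a + b] sets does the rest. *)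
Lemma disjoint_family_split X Y E (a b : nat) (F : 'I_(a + b) -> set T) :
  measurable X -> measurable Y -> X `&` Y = set0 -> disjoint_family E F ->
  (exists G : 'I_a -> set T, disjoint_family (E `\` X) G) \/
  (exists G : 'I_b -> set T, disjoint_family (E `\` Y) G).
Proof.
move=> mX mY XY [FE Fd].
have sub (Z : set T) (A : {pred 'I_(a + b)}) c : measurable Z -> (c <= #|A|)%N ->
    (forall i, i \in A -> mu (F i `&` ~` Z) <> 0%E) ->
    exists G : 'I_c -> set T, disjoint_family (E `\` Z) G.
  move=> mZ cA AZ; pose h (i : 'I_c) := enum_val (widen_ord cA i).
  have hA i : h i \in A by exact: enum_valP.
  exists (fun i => F (h i) `&` ~` Z); split.
    move=> i; have [Fp FEi] := FE (h i); split.
      by apply: pos_finI => //; [exact: measurableC | exact: AZ].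
    by rewrite setDE; exact: setSI.
  move=> i j ij; rewrite setIACA Fd ?set0I// (inj_eq enum_val_inj).
  by rewrite -val_eqE /= val_eqE.
pose A : {pred 'I_(a + b)} := [pred i | mu (F i `&` ~` X) != 0%E].
have [aA|Aa] := leqP a #|A|.
  by left; apply: (sub X A) => // i; rewrite inE => /eqP.
right; apply: (sub Y [predC A]) => //.
  have := cardC A; rewrite card_ord => e.
  by rewrite -(leq_add2l #|A|) e leq_add2r ltnW.
move=> i; rewrite !inE negbK => /eqP FX FY.
have [[mF /andP[F0 _]] _] := FE i.
have : (mu (F i) <= mu (F i `&` ~` X) + mu (F i `&` ~` Y))%E.
  have {1}-> : F i = (F i `&` ~` X) `|` (F i `&` ~` Y).
    by rewrite -setIUr -setCI XY setC0 setIT.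
  by apply: measureU2; apply: measurableI => //; exact: measurableC.
by rewrite FX FY adde0 leNgt F0.
Qed.

(** Of two disjoint sets, at least one can be removed while keeping families of every size: if size
    [a] failed off the first and size [b] off the second, a family of size [a + b] would contradict
    [disjoint_family_split]. *)
Lemma disjoint_family_remove E : measurable E ->
  (forall k, exists F : 'I_k -> set T, disjoint_family E F) ->
  exists A, [/\ pos_fin A, A `<=` E &
    forall k, exists F : 'I_k -> set T, disjoint_family (E `\` A) F].
Proof.
move=> mE HE; have [F [FE Fd]] := HE 2%N.
have [[mX Xp] XE] := FE ord0; have [[mY Yp] YE] := FE ord_max.
have XY : F ord0 `&` F ord_max = set0 by exact: Fd.
have [HX|/existsNP[a Ha]] := pselect (forall k, exists G : 'I_k -> set T,
  disjoint_family (E `\` F ord0) G); first by exists (F ord0).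
exists (F ord_max); split => // b.
have [G Gd] := HE (a + b)%N.
by have [|] := disjoint_family_split mX mY XY Gd.
Qed.

(** Finite families of every size need not be nested. Removing one set at a time, with [good] as the
    invariant, produces an infinite disjoint sequence; class [0] is what it leaves uncovered. *)
Lemma pos_fin_partition :
  (forall k, exists F : 'I_k -> set T, disjoint_family setT F) ->
  exists idx : T -> nat, (forall i, measurable (idx @^-1` [set i])) /\
    forall i, (0 < mu (idx @^-1` [set i.+1]) < +oo)%E.
Proof.
move=> H0.
pose good E := measurable E /\ forall k, exists F : 'I_k -> set T, disjoint_family E F.
have next E : exists A, good E -> [/\ pos_fin A, A `<=` E & good (E `\` A)].
  have [[mE HE]|nE] := pselect (good E); last by exists set0.
  have [A [Ap AE HA]] := disjoint_family_remove mE HE.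
  by exists A => _; split => //; split => //; apply: measurableD => //; case: Ap.
have [a aP] := choice next.
pose u := fix u n := if n is n'.+1 then u n' `\` a (u n') else [set: T].
pose A n := a (u n).
have gu n : good (u n).
  by elim: n => [|n IH]; [split; [exact: measurableT | exact: H0] | have [] := aP _ IH].
have Ap n : pos_fin (A n) by have [] := aP _ (gu n).
have AU n : A n `<=` u n by have [] := aP _ (gu n).
have umono n k : u (n + k)%N `<=` u n.
  elim: k => [|k IH]; first by rewrite addn0.
  by rewrite addnS => t /= [/IH].
have Adisj n m t : (n < m)%N -> A n t -> A m t -> False.
  move=> nm Ant /AU; rewrite -(subnKC nm) => /umono /= [_ nA].
  exact: nA.
have Auniq n m t : A n t -> A m t -> n = m.
  by move=> An Am; case: (ltngtP n m) => // nm; [case: (Adisj _ _ _ nm An Am)|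
    case: (Adisj _ _ _ nm Am An)].
pose idx t := if pselect (exists n, A n t) is left H then (projT1 (cid H)).+1 else 0%N.
have idxS n : idx @^-1` [set n.+1] = A n.
  apply/seteqP; split => t /=; rewrite /idx; case: pselect => [H|nH] //.
    by case=> <-; exact: (projT2 (cid H)).
    by move=> Ant; congr _.+1; apply: Auniq (projT2 (cid H)) Ant.
  by move=> Ant; exfalso; apply: nH; exists n.
have idx0 : idx @^-1` [set 0%N] = ~` \bigcup_n A n.
  apply/seteqP; split => t /=; rewrite /idx; case: pselect => [H|nH] //.
    by move=> _ [n _ Ant]; apply: nH; exists n.
  by case: H => n Ant []; exists n.
exists idx; split => [[|i]|i]; rewrite ?idxS ?idx0; last by case: (Ap i).
  by apply: measurableC; apply: bigcupT_measurable => n; case: (Ap n).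
by case: (Ap i).
Qed.

(** On an atom each sublevel set of [g] is null or of null complement, so [g] is almost everywhere
    the supremum of the levels [r] for which [g < r] is null. *)
Lemma atom_const X (g : T -> R) : pos_fin X -> measurable_fun setT g ->
  (forall B, measurable B -> mu (X `&` B) = 0%E \/ mu (X `&` ~` B) = 0%E) ->
  exists c, mu.-negligible (X `&` [set t | g t != c]).
Proof.
move=> [mX /andP[X0 _]] mg HX.
have mlt r : measurable [set t | g t < r].
  rewrite [X in measurable X](_ : _ = setT `&` g @^-1` `]-oo, r[%classic).
    exact: mg.
  by rewrite setTI; apply/seteqP; split => t /=; rewrite in_itv.
have mXlt r : measurable (X `&` [set t | g t < r]) by exact: measurableI.
have mXge r : measurable (X `&` ~` [set t | g t < r]).
  by apply: measurableI => //; exact: measurableC.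
pose S := [set r : R | mu (X `&` [set t | g t < r]) = 0%E].
have nS r : ~ S r -> mu (X `&` ~` [set t | g t < r]) = 0%E.
  by move=> nSr; case: (HX _ (mlt r)).
have nX : ~ mu.-negligible X.
  by move=> /(negligibleP mu mX) e; move: X0; rewrite e ltxx.
have Sdown r r' : S r -> r' <= r -> S r'.
  move=> Sr le; apply/(negligibleP mu (mXlt r')).
  apply: (negligibleS _ ((negligibleP mu (mXlt r)).2 Sr)).
  by move=> t [Xt /= lt]; split => //=; exact: lt_le_trans le.
have [n1 Sn1] : exists n : nat, S (- n%:R).
  apply: contrapT => /forallNP H; apply: nX.
  apply: (@negligibleS _ _ _ mu (\bigcup_(n in [set: nat]) (X `&` ~` [set t | g t < - n%:R]))).
    move=> t Xt; exists (Num.truncn `|g t|).+1 => //; split => //=; apply/negP; rewrite -leNgt.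
    rewrite lerNl; apply: le_trans (ler_norm _) _; rewrite normrN.
    exact/ltW/truncnS_gt.
  by apply: negligible_bigcup => n; apply/negligibleP => //; exact: nS.
have [n2 Sn2] : exists n : nat, ~ S n%:R.
  apply: contrapT => /forallNP H; apply: nX.
  apply: (@negligibleS _ _ _ mu (\bigcup_(n in [set: nat]) (X `&` [set t | g t < n%:R]))).
    move=> t Xt; exists (Num.truncn `|g t|).+1 => //; split => //=.
    by apply: le_lt_trans (ler_norm _) _; exact: truncnS_gt.
  by apply: negligible_bigcup => n; apply/negligibleP => //; exact: (contrapT (H n)).
have hS : has_sup S.
  split; first by exists (- n1%:R).
  by exists n2%:R => r Sr; rewrite leNgt; apply/negP => lt; apply: Sn2; apply: Sdown Sr (ltW lt).
have in0 n : 0 < n.+1%:R^-1 :> R by rewrite invr_gt0.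
have inv_small (e : R) : 0 < e -> exists n : nat, n.+1%:R^-1 < e.
  move=> e0; have [n [n0 /(_ n (leqnn n))]] := powR_nat_unbounded e^-1 (ltr01 : 0 < 1 :> R).
  rewrite powRr1// => H; exists n; rewrite -[ltRHS]invrK ltf_pV2 ?posrE ?invr_gt0//.
  by rewrite (lt_trans H)// ltr_nat.
exists (sup S).
apply: (@negligibleS _ _ _ mu (\bigcup_(n in [set: nat]) (X `&` [set t | g t < sup S - n.+1%:R^-1])
  `|` \bigcup_(n in [set: nat]) (X `&` ~` [set t | g t < sup S + n.+1%:R^-1]))).
  move=> t [Xt /=]; rewrite neq_lt => /orP[lt|lt].
    left; have /inv_small[n Hn] : 0 < sup S - g t by rewrite subr_gt0.
    by exists n => //; split => //=; move: Hn; set z := _^-1; move: lt; lra.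
  right; have /inv_small[n Hn] : 0 < g t - sup S by rewrite subr_gt0.
  exists n => //; split => //=; apply/negP; rewrite -leNgt.
  by move: Hn; set z := _^-1; move: lt; lra.
apply: negligibleU; apply: negligible_bigcup => n; apply/negligibleP => //.
  have [r Sr lt] := sup_adherent (in0 n) hS.
  exact: Sdown Sr (ltW lt).
apply: nS => Sr; have := sup_upper_bound hS Sr.
by rewrite gerDl leNgt in0.
Qed.

Variable p : R.
Hypothesis p1 : 1 <= p.
Let p0 : 0 < p. Proof. exact: lt_le_trans p1. Qed.

(** Markov's inequality for [|g| ^ p]. *)
Lemma Lq_superlevel_fin (g : T -> R) (c : R) : Lq_mem mu p g -> 0 < c ->
  measurable [set t : T | c <= `|g t|] /\ (mu [set t : T | (c <= `|g t|)%R] < +oo)%E.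
Proof.
move=> /(Lq_memP _ p1)[mg gp] c0.
have mng : measurable_fun setT (fun t => `|g t|) by exact: measurableT_comp.
have mS : measurable [set t : T | c <= `|g t|].
  rewrite [X in measurable X](_ : _ = setT `&` (fun t => `|g t|) @^-1` `[c, +oo[%classic).
    exact: mng.
  by rewrite setTI; apply/seteqP; split => t /=; rewrite in_itv /= andbT.
split => //.
have cp : 0 < c `^ p by exact: powR_gt0.
have : ((c `^ p)%:E * mu [set t : T | (c <= `|g t|)%R] <= Lq_int mu p g)%E.
  rewrite -integral_cst// [leLHS]integral_mkcond.
  apply: ge0_le_integral => //.
  - by move=> t _; apply: erestrict_ge0 => ? _; rewrite lee_fin ltW.
  - by apply/(measurable_restrictT _ _).1 => //.
  - apply/measurable_EFinP; apply: (measurableT_comp (measurable_powR _)); exact: mng.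
  move=> t _; rewrite patchE; case: ifPn => [|_]; last by rewrite lee_fin powR_ge0.
  rewrite inE /= => ct; rewrite lee_fin; apply: ge0_ler_powR; rewrite ?nnegrE ?(ltW p0) ?(ltW c0)//.
move=> H; rewrite ltNge; apply/negP; rewrite leye_eq => /eqP e.
by move: H; rewrite e gt0_muley ?lte_fin// leye_eq => /eqP e'; rewrite e' ltxx in gp.
Qed.

(** Otherwise some family of [m] sets cannot be enlarged. Each of its members is then an atom, and a
    function of [L_p] vanishes almost everywhere off their union, since a non-null superlevel set
    there would enlarge the family. Such a function is determined by [m] constants, so the left
    kernel of an [m + 1] by [m] matrix makes any [m + 1] of them dependent. *)
Lemma infinite_dim_families : Lspace_infinite_dim mu p ->
  forall k, exists F : 'I_k -> set T, disjoint_family setT F.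
Proof.
move=> Hinf k0; apply: contrapT => nk0.
have [m [[F Fd] Fmax]] : exists m, (exists F : 'I_m -> set T, disjoint_family setT F) /\
    ~ exists F : 'I_m.+1 -> set T, disjoint_family setT F.
  apply: contrapT => H; apply: nk0; elim: k0 => [|k IH].
    by exists (fun=> set0); split; case.
  by apply: contrapT => nk; apply: H; exists k.
have Fmax' Y : pos_fin Y -> (forall i, F i `&` Y = set0) -> False.
  by move=> Yp FY; apply: Fmax; apply: disjoint_family_extend Fd Yp _ FY.
have [FE Fdd] := Fd.
have atom j B : measurable B -> mu (F j `&` B) = 0%E \/ mu (F j `&` ~` B) = 0%E.
  move=> mB; have [|n1] := pselect (mu (F j `&` B) = 0%E); first by left.
  have [|n2] := pselect (mu (F j `&` ~` B) = 0%E); first by right.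
  exfalso; apply: Fmax.
  have Fj := (FE j).1.
  apply: (@disjoint_family_extend _ _ (upd F j (F j `&` B)) (F j `&` ~` B)) => //.
  - split.
      move=> i; rewrite /upd; case: eqP => [_|_]; last exact: FE.
      by split => //; exact: pos_finI.
    move=> i i' ii'; rewrite /upd; case: eqP => [ei|_]; case: eqP => [ei'|_].
    + by move: ii'; rewrite ei ei' eqxx.
    + by rewrite setIAC -ei Fdd ?set0I.
    + by rewrite setIA -ei' Fdd ?set0I.
    + exact: Fdd.
  - by apply: pos_finI => //; exact: measurableC.
  move=> i; rewrite /upd; case: (eqVneq i j) => [_|ij]; last by rewrite setIA Fdd ?set0I.
  by rewrite setIACA setICr setI0.
pose U := \bigcup_(j in [set: 'I_m]) F j.
have mU : measurable U.
  by apply: fin_bigcup_measurable => [|j _]; [exact: finite_finset | case: (FE j) => -[]].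
have out g : Lq_mem mu p g -> mu.-negligible (~` U `&` [set t | g t != 0]).
  move=> Lg.
  apply: (@negligibleS _ _ _ mu (\bigcup_(n in [set: nat]) (~` U `&` [set t | n.+1%:R^-1 <= `|g t|]))).
    move=> t [Ut /= gt0]; have ngt0 : 0 < `|g t| by rewrite normr_gt0.
    have [n [n0 /(_ n (leqnn n))]] := powR_nat_unbounded `|g t|^-1 (ltr01 : 0 < 1 :> R).
    rewrite powRr1// => H; exists n => //; split => //=.
    rewrite -[leRHS]invrK lef_pV2 ?posrE ?invr_gt0// (le_trans (ltW H))//.
    by rewrite ler_nat.
  apply: negligible_bigcup => n.
  have in0 : 0 < n.+1%:R^-1 :> R by rewrite invr_gt0.
  have [mS Sfin] := Lq_superlevel_fin Lg in0.
  have mUS : measurable (~` U `&` [set t | n.+1%:R^-1 <= `|g t|]).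
    by apply: measurableI => //; exact: measurableC.
  apply/negligibleP => //; apply: contrapT => n0.
  apply: (Fmax' (~` U `&` [set t | n.+1%:R^-1 <= `|g t|])).
    split => //; apply/andP; split; first by rewrite lt0e measure_ge0 andbT; apply/eqP.
    by apply: le_lt_trans Sfin; apply: le_measure; rewrite ?inE//; exact: subIsetr.
  by move=> i; apply/seteqP; split => // t [Fit [nU _]]; apply: nU; exists i.
have [g [Lg Hg]] := Hinf m.+1.
have /choice[c cP] (ij : 'I_m.+1 * 'I_m) :
    exists c, mu.-negligible (F ij.2 `&` [set t | g ij.1 t != c]).
  apply: atom_const; [exact: (FE _).1 | by case: (Lg ij.1) | exact: atom].
pose M : 'M[R]_(m.+1, m) := \matrix_(i, j) c (i, j).
have [v vM v0] : exists2 v : 'rV[R]_m.+1, v *m M = 0 & v != 0.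
  have : kermx M != 0.
    rewrite kermx_eq0 /row_free neq_ltn; apply/orP; left.
    by rewrite ltnS rank_leq_col.
  by move=> /rowV0Pn[v /sub_kermxP vM v0]; exists v.
move/negP: v0; apply; apply/eqP/rowP => i; rewrite mxE.
apply: (Hg (fun i => v ord0 i)).
pose f t := \sum_(i < m.+1) v ord0 i * g i t.
have mf : measurable_fun setT f.
  by apply: measurable_sum => j; apply: measurable_funM => //; case: (Lg j).
rewrite (_ : (fun t => _) = EFin \o f)// LnormE.
suff -> : Lq_int mu p f = 0%E by rewrite poweR0r// invr_neq0// gt_eqF.
have neg : mu.-negligible [set t | f t != 0].
  apply: (@negligibleS _ _ _ mu
    ((\bigcup_(ij in [set: 'I_m.+1 * 'I_m]) (F ij.2 `&` [set t | g ij.1 t != c ij])) `|`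
     (\bigcup_(i in [set: 'I_m.+1]) (~` U `&` [set t | g i t != 0])))).
    move=> t /= ft0; apply: contrapT => /not_orP[H1 H2]; move/negP: ft0; apply; apply/eqP.
    have [[j _ Fjt]|Ut] := pselect (U t).
      rewrite /f (eq_bigr (fun i => v ord0 i * M i j)).
        by have := congr1 (fun A : 'rV_m => A ord0 j) vM; rewrite !mxE.
      move=> i' _; congr (_ * _); rewrite mxE; apply/eqP/negPn/negP => nc.
      by apply: H1; exists (i', j).
    rewrite /f big1// => i' _; rewrite (_ : g i' t = 0) ?mulr0//.
    by apply/eqP/negPn/negP => nc; apply: H2; exists i'.
  have fbig (I : finType) (Q : I -> set T) : (forall i, mu.-negligible (Q i)) ->
      mu.-negligible (\bigcup_(i in [set: I]) Q i).
    move=> HQ; apply: (@negligibleS _ _ _ mu (\bigcup_(n in [set: nat])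
        (if insub n is Some j then Q (enum_val (j : 'I_#|I|)) else set0))).
      move=> t [i' _ Qt]; exists (enum_rank i') => //.
      by rewrite valK enum_rankK.
    apply: negligible_bigcup => n; case: insubP => // _; exact: negligible_set0.
  by apply: negligibleU; apply: fbig => // i'; exact: out.
rewrite /Lq_int (ae_eq_integral (cst 0%E))//; first by rewrite integral0.
  apply/measurable_EFinP; apply: (measurableT_comp (measurable_powR _)).
  exact: measurableT_comp.
case: neg => N [mN N0 fN]; exists N; split => // t /= nt; apply: fN => /=.
apply/negP => /eqP ft0; apply: nt => _; rewrite ft0 normr0 powR0// gt_eqF//.
Qed.

End DisjointFamilies.

(** * Bumps from polynomial powers of the norm *)

Section HomogeneousPolynomials.
Variables (R : realType) (V : lmodType R) (D : set V) (N : V -> R).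
Hypothesis DN : seminormed_on D N.

Definition homog_poly (k : nat) (f : V -> R) :=
  exists A : ('I_k -> V) -> R, bounded_multilinear D N A /\
    forall h, D h -> f h = A (fun=> h).

Lemma homog_poly0 k : homog_poly k (fun=> 0).
Proof.
exists (fun=> 0); split => //; split; first by move=> *; rewrite mulr0 addr0.
by exists 0 => x Dx; rewrite normr0 mul0r.
Qed.

Lemma homog_polyD k f g : homog_poly k f -> homog_poly k g ->
  homog_poly k (fun h => f h + g h).
Proof.
move=> [A [[mlA [C AC]] fA]] [B [[mlB [C' BC]] gB]].
exists (fun x => A x + B x); split; last by move=> h Dh; rewrite fA// gB.
split; first by move=> x Dx i a y Dy; rewrite mlA// mlB// mulrDr addrACA.
exists (C + C') => x Dx; rewrite (le_trans (ler_normD _ _))// mulrDl.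
by rewrite lerD ?AC ?BC.
Qed.

Lemma homog_polyN k f : homog_poly k f -> homog_poly k (fun h => - f h).
Proof.
move=> [A [[mlA [C AC]] fA]].
exists (fun x => - A x); split; last by move=> h Dh; rewrite fA.
split; first by move=> x Dx i a y Dy; rewrite mlA// opprD mulrN.
by exists C => x Dx; rewrite normrN AC.
Qed.

Lemma homog_poly_sum k (I : Type) (r : seq I) (P : pred I) (f : I -> V -> R) :
  (forall i, P i -> homog_poly k (f i)) -> homog_poly k (fun h => \sum_(i <- r | P i) f i h).
Proof.
move=> Hf; elim: r => [|i r IH].
  by under eq_fun do rewrite big_nil; exact: homog_poly0.
case Pi : (P i); under eq_fun do rewrite big_cons Pi; last exact: IH.
by apply: homog_polyD => //; exact: Hf.
Qed.

Lemma homog_poly_cst c : homog_poly 0 (fun=> c).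
Proof.
exists (fun=> c); split => //; split; first by move=> x Dx i; case: i.
by exists `|c| => x Dx; rewrite big_ord0 mulr1.
Qed.

Lemma homog_polyM k l f g : homog_poly k f -> homog_poly l g ->
  homog_poly (k + l) (fun h => f h * g h).
Proof.
move=> [A [/(bounded_multilinearE DN)[mlA [C [C0 AC]]] fA]].
move=> [B [/(bounded_multilinearE DN)[mlB [C' [C'0 BC]]] gB]].
exists (fun x => A (fun i => x (lshift l i)) * B (fun j => x (rshift k j))); split; last first.
  by move=> h Dh; rewrite fA// gB.
split.
  move=> x Dx i a y Dy; rewrite -[i]splitK; case: (fintype.split i) => j /=.
    have e1 (z : V) : (fun i' => if lshift l i' == lshift l j then z else x (lshift l i')) =
        upd (fun i' => x (lshift l i')) j z.
      by apply/funext => i'; rewrite /upd (inj_eq (@lshift_inj _ _)).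
    have e2 (z : V) : (fun i' => if rshift k i' == lshift l j then z else x (rshift k i')) =
        (fun i' => x (rshift k i')).
      by apply/funext => i'; rewrite eq_rlshift.
    by rewrite !e1 !e2 (mlA _ (fun i' => Dx (lshift l i')) j a _ Dy) mulrDl mulrA.
  have e1 (z : V) : (fun i' => if lshift l i' == rshift k j then z else x (lshift l i')) =
      (fun i' => x (lshift l i')).
    by apply/funext => i'; rewrite eq_lrshift.
  have e2 (z : V) : (fun i' => if rshift k i' == rshift k j then z else x (rshift k i')) =
      upd (fun i' => x (rshift k i')) j z.
    by apply/funext => i'; rewrite /upd (inj_eq (@rshift_inj _ _)).
  by rewrite !e1 !e2 (mlB _ (fun i' => Dx (rshift k i')) j a _ Dy) mulrDr mulrCA.
exists (C * C') => x Dx; rewrite normrM big_split_ord /= mulrACA.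
by apply: ler_pM => //; [exact: AC | exact: BC].
Qed.

Lemma homog_poly_bound k f : homog_poly k f ->
  exists2 C, 0 <= C & forall h, D h -> `|f h| <= C * N h ^+ k.
Proof.
move=> [A [/(bounded_multilinearE DN)[mlA [C [C0 AC]]] fA]]; exists C => // h Dh.
rewrite fA//; apply: le_trans (AC _ (fun=> Dh)) _.
by rewrite prodr_const card_ord.
Qed.

Lemma cont_polyP m (f : nat -> V -> R) P : (forall k, homog_poly k (f k)) ->
  (forall h, D h -> P h = \sum_(k < m.+1) f k h) -> cont_poly D N m P.
Proof.
move=> Hf PE; exists (fun k => projT1 (cid (Hf k))); split.
  by move=> k _; case: (projT2 (cid (Hf k))).
move=> h Dh; rewrite PE//; apply: eq_bigr => k _.
by have [_ ->] := projT2 (cid (Hf k)).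
Qed.

(* A polynomial function is written [h |-> (G h).[1]], the coefficient of ['X^k]
   being its [k]-homogeneous part. *)
Definition graded_poly (G : V -> {poly R}) :=
  (exists B : nat, forall h, (size (G h) <= B)%N) /\
  forall k, homog_poly k (fun h => (G h)`_k).

Lemma graded_polyC c : graded_poly (fun=> c%:P).
Proof.
split; first by exists 1%N => h; exact: size_polyC_leq1.
move=> [|k]; under eq_fun do rewrite coefC /=.
  exact: homog_poly_cst.
exact: homog_poly0.
Qed.

Lemma graded_polyD G H : graded_poly G -> graded_poly H -> graded_poly (fun h => G h + H h).
Proof.
move=> [[B GB] HG] [[B' HB] HH]; split.
  exists (maxn B B') => h; apply: leq_trans (size_polyD _ _) _.
  by rewrite geq_max !leq_max GB HB orbT.
by move=> k; under eq_fun do rewrite coefD; exact: homog_polyD.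
Qed.

Lemma graded_polyN G : graded_poly G -> graded_poly (fun h => - G h).
Proof.
move=> [[B GB] HG]; split; first by exists B => h; rewrite size_polyN.
by move=> k; under eq_fun do rewrite coefN; exact: homog_polyN.
Qed.

Lemma graded_polyM G H : graded_poly G -> graded_poly H -> graded_poly (fun h => G h * H h).
Proof.
move=> [[B GB] HG] [[B' HB] HH]; split.
  exists (B + B')%N => h; apply: leq_trans (size_polyMleq _ _) _.
  by apply: leq_trans (leq_pred _) _; exact: leq_add.
move=> k; under eq_fun do rewrite coefM; apply: homog_poly_sum => i _.
have ik : (i <= k)%N by rewrite -ltnS.
by have := homog_polyM (HG i) (HH (k - i)%N); rewrite subnKC.
Qed.

Lemma graded_polyX G n : graded_poly G -> graded_poly (fun h => G h ^+ n).
Proof.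
move=> HG; elim: n => [|n IH]; first by under eq_fun do rewrite expr0; exact: graded_polyC.
by under eq_fun do rewrite exprS; exact: graded_polyM.
Qed.

Lemma graded_poly_homog n f : homog_poly n f -> graded_poly (fun h => f h *: 'X^n).
Proof.
move=> Hf; split.
  by exists n.+1 => h; apply: leq_trans (size_scale_leq _ _) _; rewrite size_polyXn.
move=> k; under eq_fun do rewrite coefZ coefXn.
case: eqVneq => [->|_]; first by under eq_fun do rewrite mulr1.
by under eq_fun do rewrite mulr0; exact: homog_poly0.
Qed.

(** The coefficients of index at least [n] are finite in number, uniformly in [h], and each is
    [O(N h ^ n)] on the unit ball. *)
Lemma graded_poly_remainder G n : graded_poly G -> exists2 C, 0 <= C &
  forall h, D h -> N h <= 1 -> `|(G h).[1] - \sum_(k < n) (G h)`_k| <= C * N h ^+ n.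
Proof.
move=> [[B GB] HG].
have /choice[C CP] k : exists C, 0 <= C /\ forall h, D h -> `|(G h)`_k| <= C * N h ^+ k.
  by have [C C0 H] := homog_poly_bound (HG k); exists C.
exists (\sum_(k < B) C (n + k)%N); first by apply: sumr_ge0 => k _; case: (CP (n + k)%N).
move=> h Dh h1; rewrite (@horner_coef_wide _ (n + B)).
  rewrite big_split_ord /= (eq_bigr (fun k : 'I_n => (G h)`_k)); last first.
    by move=> k _; rewrite expr1n mulr1.
  rewrite addrAC subrr add0r mulr_suml (le_trans (ler_norm_sum _ _ _))//.
  apply: ler_sum => k _; rewrite expr1n mulr1; have [C0 H] := CP (n + k)%N.
  apply: le_trans (H h Dh) _; rewrite ler_wpM2l// exprD.
  by rewrite -[leRHS]mulr1 ler_wpM2l ?exprn_ge0 ?exprn_ile1 ?(sn_ge0 DN).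
exact: leq_trans (GB h) (leq_addl _ _).
Qed.

Lemma bounded_multilinear_plug n (A : ('I_n.+1 -> V) -> R) (j : 'I_n.+1) x : D x ->
  bounded_multilinear D N A ->
  bounded_multilinear D N (fun y : 'I_n -> V =>
    A (fun i => if unlift j i is Some i' then y i' else x)).
Proof.
move=> Dx /(bounded_multilinearE DN)[mlA [C [C0 AC]]].
have Dz (y : 'I_n -> V) : (forall i, D (y i)) ->
    forall i, D (if unlift j i is Some i' then y i' else x).
  by move=> Dy i; case: unliftP.
split.
  move=> y Dy i a z Dz'.
  have := mlA _ (Dz y Dy) (lift j i) a z Dz'; rewrite liftK => e.
  rewrite [LHS](_ : _ = A (upd (fun i => if unlift j i is Some i' then y i' else x)
     (lift j i) (a *: y i + z))).
    rewrite e; congr (_ + A _); apply/funext => i'; rewrite /upd.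
    case: unliftP => [k ->|->]; first by rewrite (inj_eq lift_inj).
    by rewrite (negPf (neq_lift _ _)).
  congr A; apply/funext => i'; rewrite /upd.
  case: unliftP => [k ->|->]; first by rewrite (inj_eq lift_inj).
  by rewrite (negPf (neq_lift _ _)).
exists (C * N x) => y Dy; apply: le_trans (AC _ (Dz y Dy)) _.
rewrite (bigD1_ord j)//= unlift_none mulrA.
by rewrite (eq_bigr (fun i => N (y i)))// => i _; rewrite liftK.
Qed.

(** [A] need not be symmetric, so the binomial formula is replaced by splitting [x + h] in one slot
    at a time: either [h] goes there, or [x] is plugged in and a form with one slot less remains. *)
Lemma graded_poly_translate n (A : ('I_n -> V) -> R) x : D x -> bounded_multilinear D N A ->
  exists G, graded_poly G /\ forall h, D h -> A (fun=> x + h) = (G h).[1].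
Proof.
move=> Dx; move: A.
(* The first [j] slots already hold [h]; [c] bounds the number of slots that still hold [x + h]. *)
have H : forall c A, bounded_multilinear D N A -> forall j, (n - j <= c)%N -> (j <= n)%N ->
    exists G, graded_poly G /\
      forall h, D h -> A (fun i : 'I_n => if (i < j)%N then h else x + h) = (G h).[1].
  elim: n => [|n IHn] c.
    move=> A bA j _ _; exists (fun=> (A (fun=> x))%:P); split; first exact: graded_polyC.
    by move=> h _; rewrite hornerC; congr A; apply/funext; case.
  elim: c => [|c IHc] A bA j jc jn.
    have {jc jn}-> : j = n.+1 by apply/eqP; rewrite eqn_leq jn -subn_eq0 -leqn0.
    exists (fun h => A (fun=> h) *: 'X^(n.+1)); split.
      by apply: graded_poly_homog; exists A.
    move=> h Dh; rewrite hornerZ hornerXn expr1n mulr1; congr A.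
    by apply/funext => i; rewrite ltn_ord.
  move: jn; rewrite leq_eqVlt => /orP[/eqP jn|jn].
    by apply: IHc => //; rewrite jn ?subnn.
  have jn' : (j <= n)%N by rewrite -ltnS.
  pose j0 := Ordinal jn.
  have [G1 [HG1 G1E]] := IHc A bA j.+1 (ltac:(rewrite subnS; move: jc; lia)) jn.
  have [G2 [HG2 G2E]] := IHn n _ (bounded_multilinear_plug j0 Dx bA) j (leq_subr _ _) jn'.
  exists (fun h => G2 h + G1 h); split; first exact: graded_polyD.
  move=> h Dh; rewrite hornerD -G1E// -G2E//.
  pose y := fun i : 'I_n.+1 => if (i < j)%N then h else x + h.
  have Dy i : D (y i) by rewrite /y; case: ifP => // _; exact: (sub_addr DN).
  have -> : A (fun i : 'I_n.+1 => if (i < j)%N then h else x + h) = A (upd y j0 (x + h)).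
    by congr A; apply/funext => i; rewrite /upd; case: eqP => // ->; rewrite ltnn.
  rewrite (ml_updD bA.1)//; congr (_ + _); congr A; apply/funext => i; rewrite /upd.
    case: unliftP => [i' ->|->]; last by rewrite eqxx.
    rewrite eq_sym (negPf (neq_lift _ _)) /y /= /bump.
    by case: (leqP j i') => ji; rewrite ?add1n ?add0n ?ji// ifN// -leqNgt leqW.
  by rewrite /y -val_eqE /= ltnS (leq_eqVlt i); case: eqP.
move=> A bA; have [G [HG GE]] := H n A bA 0%N (leq_subr _ _) (leq0n _).
by exists G; split => // h Dh; rewrite -GE.
Qed.

Section Bump.
Variables (m : nat) (A : ('I_m -> V) -> R).
Hypotheses (m0 : (0 < m)%N) (bA : bounded_multilinear D N A).
Hypothesis AN : forall h, D h -> A (fun=> h) = N h ^+ m.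

Lemma separating_poly_form : separating_poly D N (fun h => A (fun=> h)).
Proof.
split.
  exists m; apply: (cont_polyP (f := fun k h => if k == m then A (fun=> h) else 0)).
    by move=> k; case: eqVneq => [->|_]; [exists A | exact: homog_poly0].
  move=> h Dh; rewrite big_ord_recr /= eqxx big1 ?add0r// => k _.
  by rewrite ltn_eqF.
have D0 := sub0 DN.
split; first by rewrite AN// (sn_norm0 DN) expr0n gtn_eqF.
by move=> x Dx Nx; rewrite AN// Nx expr1n.
Qed.

Definition poly_bump (x : V) : R := Num.max 0 (1 - A (fun=> x)) ^+ m.+1.

Lemma poly_bump_bump : bump_function D N poly_bump.
Proof.
split.
  have D0 := sub0 DN; exists 0; split => //.
  by rewrite /poly_bump AN// (sn_norm0 DN) expr0n gtn_eqF//= subr0.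
exists 1 => x Dx; rewrite /poly_bump AN// expf_eq0 /= => H.
have {H} : 0 < 1 - N x ^+ m.
  by rewrite ltNge; apply/negP => le; move: H; rewrite (max_idPl le) eqxx.
rewrite subr_gt0 => H; rewrite leNgt; apply/negP => N1.
by move: H; apply/negP; rewrite -leNgt exprn_ege1// ltW.
Qed.

(* Where [A(x,...,x) < 1] the bump is locally a polynomial; where [A(x,...,x) >= 1]
   it vanishes to order [m + 1]. *)
Lemma poly_bump_smooth : Tsmooth D N m%:R poly_bump.
Proof.
move=> x Dx; have [G [HG GE]] := graded_poly_translate Dx bA.
have D0 := sub0 DN; have N0 := sn_norm0 DN.
(* The coefficient of index [0] is a form without slots, hence independent of [h]; at [h = 0] it is
   the value of the polynomial. *)
have const0 H : graded_poly H -> forall h, D h -> (H h)`_0 = (H 0)`_0.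
  move=> [_ /(_ 0%N)[B [_ BE]]] h Dh; rewrite !BE//; congr B; apply/funext; case=> //.
have value0 H : graded_poly H -> (H 0)`_0 = (H 0).[1].
  move=> HH; have [C C0 HC] := graded_poly_remainder 1 HH.
  have := HC 0 D0; rewrite N0 ler01 expr1 mulr0 big_ord1 normr_le0 subr_eq0.
  by move=> /(_ isT)/eqP.
have [C C0 HC] := graded_poly_remainder 1 HG.
have A0 : (G 0).[1] = A (fun=> x) by rewrite -GE// addr0.
have HA h : D h -> N h <= 1 -> `|A (fun=> x + h) - A (fun=> x)| <= C * N h.
  move=> Dh h1; have := HC h Dh h1.
  by rewrite big_ord1 const0// value0// A0 GE// expr1.
have floorm : m%:Z <= Num.floor (m%:R : R) by rewrite floor_ge_int.
have powN h : N h `^ m%:R = N h ^+ m by rewrite powR_mulrn// (sn_ge0 DN).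
have [a1|a1] := ltP (A (fun=> x)) 1; last first.
  exists m, (fun=> 0); split => //; split.
    by apply: (cont_polyP (f := fun k h => 0)) => [k|h Dh]; [exact: homog_poly0 | rewrite big1].
  move=> e e0; have Cm : 0 <= C ^+ m.+1 by rewrite exprn_ge0.
  exists (Num.min 1 (e / (C ^+ m.+1 + 1))); split.
    by rewrite lt_min ltr01 divr_gt0// ltr_wpDl.
  move=> h Dh; rewrite lt_min => /andP[h1 he].
  have -> : poly_bump x = 0 by rewrite /poly_bump (max_idPl _) ?subr_le0// exprS mul0r.
  rewrite !subr0 powN /poly_bump ger0_norm; last by rewrite exprn_ge0// le_max lexx.
  apply: (@le_trans _ _ ((C * N h) ^+ m.+1)).
    apply: lerXn2r; rewrite ?nnegrE ?le_max ?lexx ?mulr_ge0 ?(sn_ge0 DN)//.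
    rewrite ge_max mulr_ge0 ?(sn_ge0 DN)//=.
    apply: le_trans (HA h Dh (ltW h1)); rewrite distrC; apply: le_trans (ler_norm _).
    by rewrite lerD2r.
  rewrite exprMn exprS [N h ^+ m.+1]exprS !mulrA ler_wpM2r ?exprn_ge0 ?(sn_ge0 DN)// -exprS.
  move: he; rewrite ltr_pdivlMr ?ltr_wpDl// => he.
  by apply: le_trans (ltW he); rewrite mulrC ler_wpM2l ?(sn_ge0 DN)// lerDl.
pose H h := (1%:P - G h) ^+ m.+1.
have HH : graded_poly H.
  by apply: graded_polyX; apply: graded_polyD; [exact: graded_polyC | exact: graded_polyN].
have HE h : D h -> (H h).[1] = (1 - A (fun=> x + h)) ^+ m.+1.
  by move=> Dh; rewrite /H horner_exp hornerD hornerN hornerC GE.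
(* The constant coefficient is omitted because it equals [poly_bump x]; the degrees above [m] go
   into the remainder. *)
exists m, (fun h => \sum_(k < m) (H h)`_k.+1); split => //; split.
  apply: (cont_polyP (f := fun k h => if k is k'.+1 then (H h)`_k else 0)).
    by case=> [|k]; [exact: homog_poly0 | exact: HH.2].
  by move=> h Dh; rewrite big_ord_recl /= add0r.
move=> e e0; have [C' C'0 HC'] := graded_poly_remainder m.+1 HH.
(* The second bound keeps [A] below [1] at [x + h], where the bump is still polynomial; the third
   brings the remainder below [e * N h ^ m]. *)
exists (Num.min 1 (Num.min ((1 - A (fun=> x)) / (C + 1)) (e / (C' + 1)))); split.
  by rewrite !lt_min ltr01 !divr_gt0 ?subr_gt0 ?ltr_wpDl.
move=> h Dh; rewrite !lt_min => /and3P[h1 ha he].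
have Ah : A (fun=> x + h) < 1.
  rewrite -(subrK (A (fun=> x)) (A _)) -ltrBrDr.
  apply: le_lt_trans (ler_norm _) _; apply: le_lt_trans (HA h Dh (ltW h1)) _.
  have C1 : 0 < C + 1 by rewrite ltr_wpDl.
  move: ha; rewrite ltr_pdivlMr// => ha; apply: le_lt_trans ha.
  by rewrite mulrC ler_wpM2l ?(sn_ge0 DN)// lerDl.
have -> : poly_bump (x + h) = (H h).[1].
  by rewrite HE// /poly_bump (max_idPr _)// subr_ge0 ltW.
have -> : poly_bump x = (H h)`_0.
  by rewrite const0// value0// HE// addr0 /poly_bump (max_idPr _)// subr_ge0 ltW.
rewrite -addrA -opprD -(big_ord_recl m (fun k => (H h)`_k)).
apply: le_trans (HC' h Dh (ltW h1)) _; rewrite powN exprS mulrA.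
rewrite ler_wpM2r ?exprn_ge0 ?(sn_ge0 DN)//.
move: he; rewrite ltr_pdivlMr ?ltr_wpDl// => he.
by apply: le_trans (ltW he); rewrite mulrC ler_wpM2l ?(sn_ge0 DN)// lerDl.
Qed.

End Bump.
End HomogeneousPolynomials.

(** * The mixed norm as a polynomial *)

(** A crude AM-GM inequality through the largest factor; it plays the part of Hölder's inequality
    for [r] functions of [L_r]. *)
Lemma prod_le_sum_expr (R : realDomainType) r (a : 'I_r -> R) : (0 < r)%N ->
  (forall i, 0 <= a i) -> \prod_i a i <= \sum_i a i ^+ r.
Proof.
case: r a => // r a _ a0; pose j := [arg max_(i > ord0) a i]%O.
have aj i : a i <= a j.
  by rewrite /j; case: Order.TotalTheory.arg_maxP => // j' _; exact.
apply: (@le_trans _ _ (\prod_(i < r.+1) a j)).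
  by apply: ler_prod => i _; rewrite a0 aj.
rewrite prodr_const card_ord (bigD1 j)//= lerDl.
by apply: sumr_ge0 => i _; exact: exprn_ge0.
Qed.

Section Continuity.
Variables (R : realType) (V : lmodType R) (D : set V) (N : V -> R).
Hypothesis DN : seminormed_on D N.

(** Writing [y n] as [x + (y n - x)] and expanding all slots, every term but the first contains a
    factor [N (y n - x)], while the other factors stay bounded by [N (x i) + 1]. *)
Lemma bounded_multilinear_cvg k (A : ('I_k -> V) -> R) (x : 'I_k -> V) (y : nat -> 'I_k -> V) :
  bounded_multilinear D N A -> (forall i, D (x i)) -> (forall n i, D (y n i)) ->
  (forall i, N (x i - y n i) @[n --> \oo] --> (0 : R)) ->
  A (y n) @[n --> \oo] --> A x.
Proof.
move=> /(bounded_multilinearE DN)[mlA [C [C0 AC]]] Dx Dy xy.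
pose M := \prod_i (N (x i) + 1).
have M0 : 0 <= M by apply: prodr_ge0 => i _; rewrite addr_ge0 ?(sn_ge0 DN).
pose K : R := #|{ffun 'I_k -> bool}|%:R * (C * M) + 1.
have K0 : 0 < K by rewrite ltr_wpDl// !mulr_ge0.
apply/cvgrPdist_lt => e e0.
pose e' := Num.min 1 (e / K).
have e'0 : 0 < e' by rewrite lt_min ltr01 divr_gt0.
have [|n0 Hn0] := @eventually_uniform k (fun i n => N (x i - y n i) < e').
  move=> i; have /cvgrPdist_lt/(_ _ e'0)[n0 _ H] := xy i.
  exists n0 => n nn; have := H n nn; rewrite /= sub0r normrN.
  by rewrite ger0_norm// (sn_ge0 DN).
exists n0 => // n nn; have {Hn0 nn} Hn := Hn0 n nn.
pose z (i : 'I_k) (b : bool) := if b then x i else y n i - x i.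
have Dz i b : D (z i b).
  by rewrite /z; case: b => //; exact: (sub_sub DN).
have -> : y n = (fun i => \sum_b z i b).
  by apply/funext => i; rewrite big_bool /= addrC subrK.
rewrite (ml_expand DN mlA true Dz) (bigD1 [ffun=> true])//=.
rewrite (_ : A (fun i => z i _) = A x); last first.
  by congr A; apply/funext => i; rewrite ffunE.
rewrite opprD addrA subrr sub0r normrN.
apply: le_lt_trans (ler_norm_sum _ _ _) _.
apply: (@le_lt_trans _ _ (\sum_(f : {ffun 'I_k -> bool}) C * (e' * M))).
  rewrite [leRHS](bigD1 [ffun=> true])//= ler_wpDl ?mulr_ge0 ?(ltW e'0)//.
  apply: ler_sum => f fT.
  have [i0 fi0] : exists i, ~~ f i.
    apply: contrapT => /forallNP H; move/negP: fT; apply; apply/eqP/ffunP => i.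
    by rewrite ffunE; apply/negPn/negP; exact: H.
  apply: le_trans (AC _ (fun i => Dz i _)) _; rewrite ler_wpM2l//.
  rewrite (bigD1 i0)//= /M [in leRHS](bigD1 i0)//= mulrA.
  have zle i : N (z i (f i)) <= N (x i) + 1.
    rewrite /z; case: (f i); first by rewrite lerDl.
    rewrite (sn_subC DN)// (le_trans (ltW (Hn i)))// /e' ge_min lerDr (sn_ge0 DN).
    by [].
  apply: ler_pM; rewrite ?(sn_ge0 DN) ?prodr_ge0//.
  - by move=> i _; exact: (sn_ge0 DN).
  - rewrite /z (negPf fi0) (sn_subC DN)//; apply: le_trans (ltW (Hn i0)) _.
    by rewrite -[leLHS]mulr1 ler_wpM2l ?(ltW e'0)// lerDr (sn_ge0 DN).
  by apply: ler_prod => i _; rewrite (sn_ge0 DN) zle.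
rewrite sumr_const (_ : #|_| = #|{ffun 'I_k -> bool}|); last exact: eq_card.
rewrite -[ltLHS]mulr_natl (_ : _ * _ = e' * (K - 1)); last by rewrite /K addrK; ring.
apply: (@lt_le_trans _ _ (e' * K)); first by rewrite ltr_pM2l// ltrBlDr ltrDl.
by rewrite -ler_pdivlMr// ge_min lexx orbT.
Qed.

End Continuity.

(** * Integrals of products of [r] functions of [L_r] *)

Section ProductIntegral.
Variables (R : realType) (d : measure_display) (T : measurableType d).
Variables (mu : {measure set T -> \bar R}) (r : nat).
Hypothesis r0 : (0 < r)%N.
Notation DL := (Lq_mem mu r%:R).
Notation NL := (Lq_norm mu r%:R).
Let r1 : 1 <= r%:R :> R. Proof. by rewrite ler1n. Qed.
Let SL := Lq_seminormed mu r1.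

Definition prod_integral (y : 'I_r -> T -> R) : R := (\int[mu]_t \prod_i y i t)%R.

Lemma integrable_pow g : DL g -> mu.-integrable setT (EFin \o (fun t => `|g t| ^+ r)).
Proof.
move=> Lg; have /(Lq_memP _ r1)[mg gr] := Lg.
apply/integrableP; split.
  by apply/measurable_EFinP; apply: measurable_funX; exact: measurableT_comp.
apply: le_lt_trans gr; rewrite le_eqVlt; apply/orP; left; apply/eqP.
apply: eq_integral => t _ /=; rewrite powR_mulrn//.
by rewrite ger0_norm ?exprn_ge0.
Qed.

Lemma Rintegral_pow g : DL g -> (\int[mu]_t `|g t| ^+ r)%R = NL g ^+ r.
Proof.
move=> Lg; apply: EFin_inj; rewrite -powR_mulrn ?Lq_norm_ge0// (Lq_norm_powR r1 Lg).
rewrite (Lq_int_fin r1 Lg); congr (fine _)%:E; apply: eq_integral => t _.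
by rewrite powR_mulrn.
Qed.

Lemma measurable_prod_fun (y : 'I_r -> T -> R) : (forall i, measurable_fun setT (y i)) ->
  measurable_fun setT (fun t => \prod_(i < r) y i t).
Proof. by move=> my; apply: measurable_prod => i _; exact: my. Qed.

Lemma integrable_prod (y : 'I_r -> T -> R) : (forall i, DL (y i)) ->
  mu.-integrable setT (EFin \o (fun t => \prod_(i < r) y i t)).
Proof.
move=> Ly.
have Hs : mu.-integrable setT (EFin \o (fun t => \sum_(i < r) `|y i t| ^+ r)).
  rewrite (_ : _ \o _ = (fun t => \sum_(i < r) (`|y i t| ^+ r)%:E)%E); last first.
    by apply/funext => t; rewrite /= sumEFin.
  by apply: integrable_sum => // i _; exact: integrable_pow.
apply: (le_integrable _ _ _ Hs) => //.
  by apply/measurable_EFinP; apply: measurable_prod_fun => i; case: (Ly i).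
move=> t _ /=; rewrite lee_fin normr_prod; apply: le_trans (ler_norm _).
by apply: prod_le_sum_expr.
Qed.

(** On the unit ball the sum of the integrals of [|x i| ^ r] is at most [r], which is the constant;
    homogeneity extends the bound. *)
Lemma prod_integral_bounded : bounded_multilinear DL NL prod_integral.
Proof.
have mlP : multilinear DL prod_integral.
  move=> x Dx i a y Dy.
  have updE z t : \prod_j upd x i z j t = z t * \prod_(j | j != i) x j t.
    rewrite (bigD1 i)//= upd_same; congr (_ * _).
    by apply: eq_bigr => j /negPf ji; rewrite /upd ji.
  rewrite /prod_integral -RintegralZl//; last exact: integrable_prod.
  rewrite -RintegralD//; last 2 first.
  - rewrite (_ : _ \o _ = (fun t => a%:E * (EFin \o (fun t => (\prod_(i < r) x i t)%R)) t)%E)//.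
    by apply: integrableZl => //; exact: integrable_prod.
  - by apply: integrable_prod; exact: upd_in.
  apply: eq_Rintegral => t _; rewrite !updE.
  by rewrite [\prod_(i < r) _](bigD1 i)//= mulrA -mulrDl.
apply/(bounded_multilinearE SL); split => //; exists r%:R; split => // x Dx.
apply: (ml_bounded_unit SL mlP) => // {Dx}x Dx x1.
apply: le_trans (le_normr_Rintegral _ _) _ => //; first exact: integrable_prod.
apply: (@le_trans _ _ (\sum_(i < r) NL (x i) ^+ r)); last first.
  rewrite -[X in _ <= X%:R](card_ord r) -sumr_const; apply: ler_sum => i _.
  by rewrite exprn_ile1 ?Lq_norm_ge0.
have -> : \sum_(i < r) NL (x i) ^+ r = (\int[mu]_t \sum_(i < r) `|x i t| ^+ r)%R.
  apply: EFin_inj; rewrite /Rintegral fineK; last first.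
    apply: (integrable_fin_num measurableT).
    rewrite (_ : (fun t => _) = (fun t => \sum_(i < r) (`|x i t| ^+ r)%:E)%E); last first.
      by apply/funext => t; rewrite sumEFin.
    by apply: integrable_sum => // i _; exact: integrable_pow.
  under eq_integral do rewrite -sumEFin.
  rewrite integral_sum//; last by move=> i; exact: integrable_pow.
  rewrite -sumEFin; apply: eq_bigr => i _.
  rewrite -Rintegral_pow// /Rintegral fineK//.
  by apply: (integrable_fin_num measurableT); exact: integrable_pow.
apply: le_Rintegral => //.
- rewrite (_ : EFin \o _ = (fun t => `|(EFin \o (fun t => (\prod_(i < r) x i t)%R)) t|)%E)//.
  by apply: integrable_abse; exact: integrable_prod.
- rewrite (_ : _ \o _ = (fun t => \sum_(i < r) (`|x i t| ^+ r)%:E)%E); last first.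
    by apply/funext => t; rewrite /= sumEFin.
  by apply: integrable_sum => // i _; exact: integrable_pow.
by move=> t _; rewrite normr_prod; exact: prod_le_sum_expr.
Qed.

Lemma prod_integral_diag g : ~~ odd r -> DL g -> prod_integral (fun=> g) = NL g ^+ r.
Proof.
move=> er Lg; rewrite -Rintegral_pow//; apply: eq_Rintegral => t _.
rewrite prodr_const card_ord; apply/esym.
by rewrite -normrX ger0_norm// -(odd_double_half r) (negPf er) add0n -mul2n exprM exprn_ge0// sqr_ge0.
Qed.

End ProductIntegral.

(** * The multilinear form whose diagonal is the [p]-th power of the mixed norm *)

Section MixedIntegral.
Variables (R : realType) (d1 d2 : measure_display).
Variables (T1 : measurableType d1) (T2 : measurableType d2).
Variables (mu : {measure set T1 -> \bar R}) (nu : {measure set T2 -> \bar R}).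
Variables (k q : nat).
Hypotheses (k0 : (0 < k)%N) (q0 : (0 < q)%N) (qeven : ~~ odd q).
Let kq0 : (0 < k * q)%N. Proof. by rewrite muln_gt0 k0. Qed.
Let q1 : 1 <= q%:R :> R. Proof. by rewrite ler1n. Qed.
Let p1 : 1 <= (k * q)%:R :> R. Proof. by rewrite ler1n. Qed.
Let SL := Lq_seminormed nu q1.
Notation X := (LpLq mu nu (k * q)%:R q%:R).
Notation N := (LpLq_norm mu nu (k * q)%:R q%:R).
Notation NL := (Lq_norm nu q%:R).
Notation F := (@prod_integral R d2 T2 nu q).

(** [mxvec_index] arranges the [k * q] arguments in [k] blocks of [q], with one inner integral per
    block. *)
Definition mixed_integrand (x : 'I_(k * q) -> T1 -> T2 -> R) (w : T1) : R :=
  \prod_(j < k) F (fun l => x (mxvec_index j l) w).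

Definition mixed_form (x : 'I_(k * q) -> T1 -> T2 -> R) : R :=
  (\int[mu]_w mixed_integrand x w)%R.

Lemma mxvec_index_bij : bijective (fun jl : 'I_k * 'I_q => mxvec_index jl.1 jl.2).
Proof.
have [g gK Kg] := curry_mxvec_bij k q.
exists g => [[j l]|i]; first exact: (gK (j, l)).
by have := Kg i isT; case: (g i).
Qed.

Lemma prod_mxvec (a : 'I_(k * q) -> R) :
  \prod_(j < k) \prod_(l < q) a (mxvec_index j l) = \prod_i a i.
Proof.
rewrite pair_big /= [RHS](reindex (fun jl : 'I_k * 'I_q => mxvec_index jl.1 jl.2))//=.
by have [g gK Kg] := mxvec_index_bij; exists g => ? _; [exact: gK | exact: Kg].
Qed.

Lemma measurable_mixed_integrand x : (forall i, X (x i)) ->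
  measurable_fun setT (mixed_integrand x).
Proof.
move=> Dx; apply: measurable_prod => j _.
apply: (measurable_strong_comp (nu := nu) q1 (u := fun l => x (mxvec_index j l))).
  by move=> l; have /(LpLqP _ _ _ q1)[] := Dx (mxvec_index j l).
move=> y z Dy Dz yz.
exact: (bounded_multilinear_cvg SL (prod_integral_bounded nu q0) Dy Dz yz).
Qed.

(** The bound is again a product of [k * q] functions, now in [L_(kq)] of the outer variable, so the
    estimates for [prod_integral] apply a second time, to [mu]. *)
Lemma mixed_integrand_le : exists C, 0 <= C /\ forall x w, (forall i, X (x i)) ->
  `|mixed_integrand x w| <= C * \prod_i NL (x i w).
Proof.
have /(bounded_multilinearE SL)[_ [C [C0 FC]]] := prod_integral_bounded nu q0 (R := R).
exists (C ^+ k); split; first exact: exprn_ge0.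
move=> x w Dx; rewrite normr_prod.
rewrite -(prod_mxvec (fun i => NL (x i w))) -[k in C ^+ k]card_ord -prodr_const -big_split /=.
apply: ler_prod => j _; rewrite normr_ge0 /=; apply: FC => l.
by have [H _] := Dx (mxvec_index j l).
Qed.

Lemma mixed_norm_mem u : X u -> Lq_mem mu (k * q)%:R (fun w => NL (u w)).
Proof. by move=> /(LpLqP _ _ _ q1)[]. Qed.

Lemma integrable_mixed_integrand x : (forall i, X (x i)) ->
  mu.-integrable setT (EFin \o mixed_integrand x).
Proof.
move=> Dx; have [C [C0 HC]] := mixed_integrand_le.
have Hi : mu.-integrable setT (fun w => C%:E * (EFin \o (fun w => (\prod_i NL (x i w))%R)) w)%E.
  apply: integrableZl => //; apply: (integrable_prod kq0) => i.
  exact: mixed_norm_mem.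
apply: (le_integrable _ _ _ Hi) => //.
  by apply/measurable_EFinP; exact: measurable_mixed_integrand.
move=> w _; rewrite /= lee_fin; apply: le_trans (HC _ _ Dx) _.
exact: ler_norm.
Qed.

Lemma mixed_integrand_linear x i a y w : (forall i, X (x i)) -> X y ->
  mixed_integrand (upd x i (a *: x i + y)) w =
  a * mixed_integrand x w + mixed_integrand (upd x i y) w.
Proof.
move=> Dx Dy; have [g gK Kg] := mxvec_index_bij.
have inj (j : 'I_k) (l : 'I_q) (j' : 'I_k) (l' : 'I_q) : (mxvec_index j l == mxvec_index j' l') = ((j, l) == (j', l')).
  by apply/eqP/eqP => [e|[-> ->//]]; have := gK (j, l); rewrite /= e => <-; exact: (gK (j', l')).
move: (Kg i); case: (g i) => j0 l0 /= <-; set i0 := mxvec_index j0 l0.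
pose G z j := F (fun l => upd x i0 z (mxvec_index j l) w).
have Gother z j : j != j0 -> G z j = F (fun l => x (mxvec_index j l) w).
  move=> jj; congr F; apply/funext => l; rewrite /upd inj xpair_eqE.
  by rewrite (negPf jj).
have G0 z : G z j0 = F (upd (fun l => x (mxvec_index j0 l) w) l0 (z w)).
  congr F; apply/funext => l; rewrite /upd inj xpair_eqE eqxx /=.
  by case: eqP.
have E z : mixed_integrand (upd x i0 z) w =
    F (upd (fun l => x (mxvec_index j0 l) w) l0 (z w)) *
    \prod_(j | j != j0) F (fun l => x (mxvec_index j l) w).
  rewrite /mixed_integrand (bigD1 j0)//= -[X in X * _]/(G z j0) G0; congr (_ * _).
  by apply: eq_bigr => j jj; exact: Gother.
have := E (x i0); rewrite upd_id => ->; rewrite !E mulrA -mulrDl; congr (_ * _).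
have /(bounded_multilinearE SL)[mlF _] := prod_integral_bounded nu q0 (R := R).
have Dxw l : Lq_mem nu q%:R (x (mxvec_index j0 l) w) by have [H _] := Dx (mxvec_index j0 l).
have Dyw : Lq_mem nu q%:R (y w) by have [H _] := Dy.
rewrite (upd_id (fun l => x (mxvec_index j0 l) w) l0).
exact: (mlF _ Dxw l0 a _ Dyw).
Qed.

Lemma mixed_form_bounded : bounded_multilinear X N mixed_form.
Proof.
split.
  move=> x Dx i a y Dy; rewrite -/(upd x i (a *: x i + y)) -/(upd x i y).
  have ix := integrable_mixed_integrand Dx.
  rewrite /mixed_form -RintegralZl// -RintegralD//; last 2 first.
  - rewrite (_ : _ \o _ = (fun w => a%:E * (EFin \o mixed_integrand x) w)%E)//.
    exact: integrableZl.
  - by apply: integrable_mixed_integrand; exact: upd_in.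
  by apply: eq_Rintegral => w _; exact: mixed_integrand_linear.
have [C [C0 HC]] := mixed_integrand_le.
have /(bounded_multilinearE (Lq_seminormed mu p1))[_ [K [K0 HK]]] :=
  prod_integral_bounded mu kq0 (R := R).
exists (C * K) => x Dx.
have ih : mu.-integrable setT (EFin \o (fun w => \prod_i NL (x i w))).
  by apply: (integrable_prod kq0) => i; exact: mixed_norm_mem.
apply: le_trans (le_normr_Rintegral _ (integrable_mixed_integrand Dx)) _ => //.
apply: (@le_trans _ _ (\int[mu]_w (C * \prod_i NL (x i w)))%R).
  apply: le_Rintegral => //.
  - rewrite (_ : EFin \o _ = (fun w => `|(EFin \o mixed_integrand x) w|)%E)//.
    by apply: integrable_abse; exact: integrable_mixed_integrand.
  - rewrite (_ : _ \o _ = (fun w => C%:E * (EFin \o (fun w => (\prod_i NL (x i w))%R)) w)%E)//.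
    exact: integrableZl.
  by move=> w _; exact: HC.
rewrite RintegralZl// -mulrA ler_wpM2l//.
apply: le_trans (ler_norm _) _.
exact: (HK (fun i w => NL (x i w)) (fun i => mixed_norm_mem (Dx i))).
Qed.

Lemma mixed_form_diag u : X u -> mixed_form (fun=> u) = N u ^+ (k * q).
Proof.
move=> Du; have Lh := mixed_norm_mem Du.
rewrite -[N u]/(Lq_norm mu (k * q)%:R (fun w => NL (u w))) -(Rintegral_pow kq0 Lh).
apply: eq_Rintegral => w _; rewrite /mixed_integrand.
rewrite (eq_bigr (fun=> NL (u w) ^+ q)); last first.
  by move=> j _; apply: (prod_integral_diag q0 qeven); case: Du.
by rewrite prodr_const card_ord -exprM mulnC ger0_norm ?Lq_norm_ge0.
Qed.

End MixedIntegral.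

Section Characterization.
Variables (R : realType) (d1 d2 : measure_display).
Variables (T1 : measurableType d1) (T2 : measurableType d2).
Variables (mu : {measure set T1 -> \bar R}) (nu : {measure set T2 -> \bar R}).

Lemma even_multiple_form (p q : R) : 1 < p -> 1 < q -> even_int q ->
  (exists k : nat, p = k%:R * q) ->
  exists (m : nat) (A : ('I_m -> T1 -> T2 -> R) -> R),
    [/\ p = m%:R, (0 < m)%N, bounded_multilinear (LpLq mu nu p q) (LpLq_norm mu nu p q) A &
     forall h, LpLq mu nu p q h -> A (fun=> h) = LpLq_norm mu nu p q h ^+ m].
Proof.
move=> p1 q1 [n qn] [k pk]; pose Q := (2 * n)%N.
have Q0 : (0 < Q)%N by rewrite -(ltr_nat R) -qn (lt_trans _ q1).
have k0 : (0 < k)%N.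
  by case: k pk => // pk; move: p1; rewrite pk mul0r ltr10.
have Qe : ~~ odd Q by rewrite /Q oddM.
have pE : p = (k * Q)%:R by rewrite pk qn -natrM.
exists (k * Q)%N, (@mixed_form R d1 d2 T1 T2 mu nu k Q).
rewrite {}pE qn muln_gt0 k0 Q0; split => //; first exact: mixed_form_bounded.
by move=> h Dh; exact: (mixed_form_diag k0 Q0 Qe Dh).
Qed.

Lemma even_int_nat (m : nat) : ~~ odd m -> @even_int R m%:R.
Proof.
by move=> em; exists m./2; rewrite mul2n -[in LHS](odd_double_half m) (negPf em) add0n.
Qed.

End Characterization.

Theorem theorem3p1 (R : realType) (d1 d2 : measure_display)
  (T1 : measurableType d1) (T2 : measurableType d2)
  (mu : {measure set T1 -> \bar R}) (nu : {measure set T2 -> \bar R})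
  (p q : R) :
  1 < p -> 1 < q ->
  Lspace_infinite_dim mu p -> Lspace_infinite_dim nu q ->
  let X := LpLq mu nu p q in
  let N := LpLq_norm mu nu p q in
  let r := Num.min p q in
  ((~ even_int r \/ (p < q /\ even_int p)) ->
     ~ exists f, bump_function X N f /\ Tsmooth X N r f) /\
  (r = q -> even_int r ->
     ((exists f, bump_function X N f /\ Tsmooth X N p f) <->
        (even_int p /\ even_int q /\ exists k : nat, p = k%:R * q)) /\
     ((even_int p /\ even_int q /\ exists k : nat, p = k%:R * q) ->
        exists P, separating_poly X N P)).
Proof.
move=> p1 q1 Hmu Hnu X N r.
have p1' := ltW p1; have q1' := ltW q1.
have SX : seminormed_on X N by exact: LpLq_seminormed.
have [idx1 [midx1 mu1]] := pos_fin_partition (infinite_dim_families p1' Hmu).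
have [idx2 [midx2 nu2]] := pos_fin_partition (infinite_dim_families q1' Hnu).
have Hp f : bump_function X N f -> Tsmooth X N p f ->
    even_int p /\ exists k : nat, p = k%:R * q.
  move=> bf fs; have [m [pm em [k mk]]] := bump_p_consequence p1' q1' midx1 mu1 midx2 nu2 bf fs.
  by split; [rewrite pm; exact: even_int_nat | exists k; rewrite pm].
have Hq f : bump_function X N f -> Tsmooth X N q f -> even_int q.
  move=> bf fs; have [m [-> em]] := bump_q_consequence p1' q1' midx1 mu1 midx2 nu2 bf fs.
  exact: even_int_nat.
split.
  rewrite /r; have [pq|qp] := leP p q => H [f [bf fs]].
    have [ep [k pk]] := Hp f bf fs.
    case: H => [//|[pq' _]].
    (* [p > 1] excludes [k = 0], so [p] is at least [q], against [p < q]. *)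
    case: k pk => [|k] pk; first by move: p1; rewrite pk mul0r ltr10.
    have : q <= p by rewrite pk ler_peMl ?ler1n// (le_trans ler01).
    by rewrite leNgt pq'.
  (* Here [r = q < p]: either [q] is not even, against [Hq], or [p < q], against the order. *)
  case: H => [|[pq _]]; first by apply; exact: Hq bf fs.
  by move: (lt_trans pq qp); rewrite ltxx.
move=> rq er; have eq : even_int q by rewrite -rq.
have Hform := even_multiple_form mu nu p1 q1 eq.
split; last first.
  by move=> [_ [_ /Hform[m [A [pm m0 bA AN]]]]]; exists (fun h => A (fun=> h));
    exact: (separating_poly_form SX m0 bA AN).
split=> [[f [bf fs]]|[_ [_ /Hform[m [A [pm m0 bA AN]]]]]].
  by have [? ?] := Hp f bf fs.
exists (poly_bump A); split; first exact: (poly_bump_bump SX m0 AN).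
by have := poly_bump_smooth SX bA; rewrite -pm.
Qed.
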